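(* Let $J$ be either the simple random walk kernel on $\mathbb Z^d$ with $d\ge3$, or a $\gamma$-stable kernel on $\mathbb Z$ with $\gamma\in(0,1)$. Then there exists a constant $C_0$ such that for all $\rho\in(0,\frac12)$ and any $\beta\in[\beta_0,2\beta_0]$, $$F(\rho,\beta+C_0\rho)\ge F(\beta).$$
   Context: The simple random walk kernel on $\mathbb Z^d$ is $J(x)=\frac1{2d}\mathbf 1_{\{|x|=1\}}$. A $\gamma$-stable kernel is a function $J:\mathbb Z\to\mathbb R_+$ with $\sum_x J(x)=1$, of the form $J(x)=\varphi(|x|)(1+|x|)^{-(1+\gamma)}$ with $\varphi$ positive and slowly varying at infinity, and which is moreover assumed to be non-increasing in $|x|$ (unimodality, standing assumption). $W=(W_t)_{t\ge0}$ denotes the continuous-time random walk started at $0$ which at rate $1$ makes a jump whose increment has distribution $J$ (increment $0$ allowed); its law is $\mathrm P$. For $\rho\in[0,1)$ let $X_t=W^{(1)}_{(1-\rho)t}$ and $Y_t=W^{(2)}_{\rho t}$, where $W^{(1)},W^{(2)}$ are independent copies of $W$; $\mathbf P,\mathbf E$ denote the law of and expectation with respect to $X$, and $\mathbb P,\mathbb E$ those for $Y$. The partition function of the Random Walk Pinning Model is $$Z^Y_{\beta,T}=\mathbf E\Big[\exp\Big(\beta\int_0^T \mathbf 1_{\{X_t=Y_t\}}\,dt\Big)\Big].$$ The quenched free energy is $F(\rho,\beta)=\lim_{T\to\infty}\frac1T\log Z^Y_{\beta,T}$ (the limit exists $\mathbb P$-a.s. and in $L^1(\mathbb P)$ and is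 non-random), $F(\beta):=F(0,\beta)$, and $\beta_0:=\big(\int_0^\infty \mathrm P(W_t=0)\,dt\big)^{-1}>0$. *)

(* Defs.v *)
From HB Require Import structures.
From mathcomp Require Import all_boot all_order all_algebra.
From mathcomp Require Import all_classical all_reals all_analysis.
Set Implicit Arguments.
Unset Strict Implicit.
Unset Printing Implicit Defensive.
Import Order.TTheory GRing.Theory Num.Theory.
Import numFieldNormedType.Exports.
Local Open Scope classical_set_scope.
Local Open Scope ring_scope.

(* On points of Z^d, |x| = 1 means the same for the Euclidean and the l^1 norm;
   the latter is used. MathComp's own norm on row vectors is the sup norm, for
   which |x| = 1 would be a different set. *)
Definition srw_kernel (R : realType) (d : nat) (x : 'rV[int]_d) : R :=
  if \sum_(i < d) `|x ord0 i| == 1 then (2 * d%:R)^-1 else 0.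

Definition slowly_varying (R : realType) (phi : R -> R) : Prop :=
  measurable_fun `[(0 : R), +oo[ phi /\
  forall a : R, 0 < a -> phi (a * x) / phi x @[x --> +oo] --> (1 : R).

Definition stable_kernel (R : realType) (gamma : R) (J : int -> R) : Prop :=
  [/\ \esum_(x in [set: int]) (J x)%:E = 1%E,
      exists phi : R -> R,
        [/\ forall r : R, 0 <= r -> 0 < phi r,
            slowly_varying phi
          & forall x : int,
              J x = phi `|x|%:~R * (1 + `|x|%:~R) `^ (- (1 + gamma))]
    & forall x y : int, `|x| <= `|y| -> J y <= J x].

Inductive srw_or_stable (R : realType) :
    forall G : zmodType, (G -> R) -> Prop :=
| Srw (d : nat) : (3 <= d)%N -> srw_or_stable (@srw_kernel R d)
| Stable (gamma : R) (J : int -> R) :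
    0 < gamma < 1 -> stable_kernel gamma J -> srw_or_stable J.

(* N is the counting process of the jump times (a Poisson process of rate 1)
   and xi n is the n-th increment. [joint_law] says at once that N has
   independent Poisson increments, that the xi n are i.i.d. with law J, and
   that N and xi are independent: everything is discrete, so the probabilities
   of these atoms determine the joint law. The times are strictly increasing
   because poisson_pmf 0 is not the point mass at 0. *)
Record jump_data (R : realType) (disp : measure_display)
    (T : measurableType disp) (P : probability T R) (G : zmodType)
    (J : G -> R) (N : R -> T -> nat) (xi : nat -> T -> G) : Prop := JumpData {
  measurable_clock : forall t n, 0 <= t -> measurable (N t @^-1` [set n]);
  measurable_increment : forall n x, measurable (xi n @^-1` [set x]);
  clock0 : forall w, N 0 w = 0%N;
  clock_nondecreasing : forall w s t, 0 <= s -> s <= t -> (N s w <= N t w)%N;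
  clock_right_continuous : forall w t, 0 <= t ->
    \forall s \near t^'+, N s w = N t w;
  joint_law : forall (k m : nat) (t : nat -> R) (n : nat -> nat) (x : nat -> G),
    0 <= t 0%N -> (forall i, t i < t i.+1) ->
    P [set w | (forall i, (i < k)%N -> N (t i.+1) w = (N (t i) w + n i)%N) /\
               (forall j, (j < m)%N -> xi j w = x j)] =
    ((\prod_(i < k) poisson_pmf (t i.+1 - t i) (n i)) *
     \prod_(j < m) J (x j))%:E
}.

Definition is_walk (R : realType) (disp : measure_display)
    (T : measurableType disp) (P : probability T R) (G : zmodType)
    (J : G -> R) (W : R -> T -> G) : Prop :=
  exists (N : R -> T -> nat) (xi : nat -> T -> G),
    jump_data P J N xi /\
    forall t w, 0 <= t -> W t w = \sum_(i < N t w) xi i w.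

Definition beta0 (R : realType) (disp : measure_display)
    (T : measurableType disp) (P : probability T R) (G : zmodType)
    (W : R -> T -> G) : R :=
  (fine (\int[lebesgue_measure]_(t in `[0%R, +oo[)
           P [set w | W t w = 0%R])%E)^-1.

(* The partition function at horizon S for a fixed path Y. *)
Definition partition_function (R : realType) (disp : measure_display)
    (T : measurableType disp) (P : probability T R) (G : zmodType)
    (X : R -> T -> G) (Y : R -> G) (beta S : R) : R :=
  fine ('E_P[fun w => expR (beta *
    (\int[lebesgue_measure]_(t in `[0, S]) (X t w == Y t)%:R)%R)])%E.

(* X and Y live on separate probability spaces, so that they are independent
   and P1, P2 are the laws denoted by boldface and blackboard P. *)
Definition is_free_energy (R : realType) (G : zmodType)
    (d1 : measure_display) (T1 : measurableType d1) (P1 : probability T1 R)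
    (W1 : R -> T1 -> G)
    (d2 : measure_display) (T2 : measurableType d2) (P2 : probability T2 R)
    (W2 : R -> T2 -> G) (rho beta f : R) : Prop :=
  let X t := W1 ((1 - rho) * t) in
  let Y w t := W2 (rho * t) w in
  let logZ w S := ln (partition_function P1 X (Y w) beta S) in
  {ae P2, forall w, S^-1 * logZ w S @[S --> +oo] --> f} /\
  (\int[P2]_w `|S^-1 * logZ w S - f|%:E)%E @[S --> +oo] --> 0%E.

(* Main.v *)
Require Import Defs.
From mathcomp Require Import all_boot all_order all_algebra.
From mathcomp Require Import all_classical all_reals all_analysis.
From mathcomp Require Import measurable_realfun.
From mathcomp Require Import ring lra zify.
Import Order.TTheory GRing.Theory Num.Theory.
Import numFieldNormedType.Exports.
Set Implicit Arguments.
Unset Strict Implicit.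
Unset Printing Implicit Defensive.
Local Open Scope classical_set_scope.
Local Open Scope ring_scope.

(** The two free energies are compared through their finite horizons: for every
horizon S,

   (1)   E ln Z^Y(beta', S) >= ln Z^0(beta, S),   beta' = beta + C0 rho,

where Z^Y is the partition function of X, run at rate 1 - rho, against the path
Y, run at rate rho, and Z^0 that of a walk run at rate 1 against the constant
path 0. Dividing by S and letting S tend to infinity gives the theorem
([L1_limit_le]).

For (1), time is discretised with a step h and the exponential is replaced by
the product of the factors 1 + beta h 1_(X = Y) over the grid. Expanding the
product and using the independence of the increments of X turns its expectation
into a sum over chains 0 = j_0 < ... < j_k of grid indices of the products of
beta h q(j_l, j_(l+1)) ([integral_reward]). Let p_t be the law of the walk at
time t. For two indices i < j put u = (1 - rho) (j - i) h and
s = rho (j - i) h; then q(i, j) = p_u(Y_j - Y_i) in Z^Y and q(i, j) = p_(u+s)(0)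
in Z^0. The ratio Z^Y / Z^0 is thus a mean, for the probability on chains with
weights those of Z^0, of a product over the steps of the chain, and Jensen's
inequality for the logarithm gives ([polymer_ln_ge])

   ln Z^0 - ln Z^Y <= mean of the sum over the steps (i, j) of
                      ln (p_(u+s)(0) / p_u(Y_j - Y_i)) - ln (beta' / beta).

The probability on chains does not depend on Y, so the average over Y can be
taken step by step, and (1) holds as soon as each step has a nonpositive
average. As p_(u+s)(0) <= p_u(0) and Y_j - Y_i has law p_s, this follows from

   (2)   sum_x p_s(x) ln (p_u(0) / p_u(x)) <= K s / u   for 0 < s <= u

([log_bound]) if K rho / (1 - rho) <= ln (beta' / beta). Since rho < 1/2 and
beta <= 2 beta0 <= 2 e ([beta0_bounds]), a constant C0 depending on K only does
this ([coupling_gain]). The mesh h then tends to 0: the paths are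
right-continuous step functions, so that Riemann sums and bounded convergence
suffice ([riemann_cvg], [grid_Z_cvg]).

The estimate (2) rests on p_u = exp(-u) sum_n u^n J^{*n} / n!, the exponential of
u (J - delta_0) for convolution, and on two properties of it. First, p_u is
unimodal along each coordinate, because unimodality survives convolution
([unimodal_conv]). Secondly, multiplication by an additive coordinate c is a
derivation for convolution, so that c(x) p_u(x) = u sum_y c(y) J(y) p_u(x - y);
pairing y with its mirror image makes all terms nonnegative for c(x) >= 0, and
any finite part of the sum is a lower bound ([heat_reflected_drift]).

- For the simple random walk, the single term y = e_i bounds
  p_u(x - e_i) / p_u(x) by 1 + 2 d x_i / u. Iterating, ln (p_u(0) / p_u(x)) is at
  most 2 d |x|^2 / u, and p_s has second moment at most s ([srw_log_bound]).

- For a stable kernel, the terms y between 2^i and 3 2^i compare p_u at 2^i and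
  at 2^(i+1); with h_i = 2^i J(2^i) this gives
  ln (p_u(0) / p_u(x)) <= C (u h_i)^(-1/2) for |x| <= 2^i ([heat_ratio]). The ratios
  h_(i+1) / h_i tend to 2^(-gamma), strictly between 1/2 and 1, so all sums over
  scales are geometric. Points at scales with u h_i < 1 contribute O(s / u)
  because p_s charges the complement of [-2^i, 2^i] by at most C s h_i
  ([heat_cutoff], [sum_far]). At the other points the ratio p_u(0) / p_u(x) is
  bounded, the logarithm is of the order of 1 - p_u(x) / p_u(0), and
  the sum is of the order of (p_u(0) - p_(u+s)(0)) / p_u(0), which is O(s / u) by
  convexity of t |-> p_t(0) and a doubling inequality ([heat_slope],
  [heat_doubling]). *)

(** * Unconditional sums with values in [[0, +oo]] *)

Definition tsum (R : realType) (T : choiceType) (f : T -> \bar R) : \bar R :=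
  \esum_(x in [set: T]) f x.

Notation "\tsum_ ( x ) F" := (tsum (fun x => F%E))
  (at level 36, F at level 36, x binder, format "\tsum_ ( x )  F") : ereal_scope.
Notation "\tsum_ ( x ) F" := (tsum (fun x => F%E)) : ring_scope.

Section tsum.
Local Open Scope ereal_scope.
Variable R : realType.
Implicit Types T U : choiceType.

Lemma tsum_ge0 T (f : T -> \bar R) : (forall x, 0 <= f x) -> 0 <= tsum f.
Proof. by move=> f0; apply: esum_ge0 => x _. Qed.

Lemma le_tsum T (f g : T -> \bar R) : (forall x, f x <= g x) -> tsum f <= tsum g.
Proof. by move=> fg; apply: le_esum => x _. Qed.

Lemma eq_tsum T (f g : T -> \bar R) : f =1 g -> tsum f = tsum g.
Proof. by move=> fg; apply: eq_esum => x _. Qed.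

Lemma tsum0 T (f : T -> \bar R) : (forall x, f x = 0) -> tsum f = 0.
Proof. by move=> f0; apply: esum1 => x _. Qed.

Lemma tsumD T (f g : T -> \bar R) :
  (forall x, 0 <= f x) -> (forall x, 0 <= g x) ->
  \tsum_(x) (f x + g x) = tsum f + tsum g.
Proof. by move=> f0 g0; apply: esumD => x _. Qed.

Lemma tsum_ge_fin T (f : T -> \bar R) (s : seq T) :
  (forall x, 0 <= f x) -> uniq s -> \sum_(x <- s) f x <= tsum f.
Proof.
move=> f0 us; apply: esum_ge; exists [set` s]; first by split.
by rewrite fsbig_seq.
Qed.

Lemma tsum_ge1 T (f : T -> \bar R) x : (forall x, 0 <= f x) -> f x <= tsum f.
Proof.
by move=> f0; have := @tsum_ge_fin T f [:: x] f0 isT; rewrite big_seq1.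
Qed.

Lemma tsum_fin T (f : T -> \bar R) (s : seq T) : (forall x, 0 <= f x) ->
  uniq s -> (forall x, x \notin s -> f x = 0) -> tsum f = \sum_(x <- s) f x.
Proof.
move=> f0 us fs; apply/eqP; rewrite eq_le tsum_ge_fin// andbT.
have -> : tsum f = \esum_(x in [set` s]) f x.
  rewrite [RHS]esum_mkcond; apply: eq_esum => x _.
  by case: ifPn => // /negP xs; apply: fs; apply/negP => H; apply: xs; rewrite inE.
by rewrite esum_fset// -fsbig_seq.
Qed.

Lemma tsum1 T (f : T -> \bar R) a : (forall x, 0 <= f x) ->
  (forall x, x != a -> f x = 0) -> tsum f = f a.
Proof.
move=> f0 fa; rewrite (@tsum_fin T f [:: a])// ?big_seq1// => x.
by rewrite inE; exact: fa.
Qed.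

Lemma tsumZ T (f : T -> \bar R) (a : \bar R) : 0 <= a -> (forall x, 0 <= f x) ->
  \tsum_(x) (a * f x) = a * tsum f.
Proof.
have key (b : \bar R) (g : T -> \bar R) : 0 <= b -> (forall x : T, 0 <= g x) ->
    \tsum_(x) (b * g x) <= b * tsum g.
  move=> b0 g0; rewrite ge_ereal_sup// => _ [X [finX _]] <-.
  rewrite -ge0_mule_fsumr// lee_wpmul2l// ereal_sup_ubound//.
  by exists X.
move=> a0 f0; apply/eqP; rewrite eq_le key//=.
case: a a0 => [r| |//] /= r0; last first.
  have [[x fx]|nx] := pselect (exists x, 0 < f x).
    have -> : tsum (fun x => +oo * f x) = +oo; last by rewrite leey.
    apply/eqP; rewrite -leye_eq -{1}(gt0_mulye fx).
    by apply: (@tsum_ge1 _ (fun x => +oo * f x)) => y; rewrite mule_ge0// leey.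
  rewrite [tsum f]tsum0 ?mule0; first by apply: tsum_ge0 => x; rewrite mule_ge0.
  move=> x; apply/eqP; rewrite eq_le f0 andbT leNgt; apply/negP => fx.
  by apply: nx; exists x.
move: r0; rewrite lee_fin [(0 <= r)%R]le_eqVlt => /orP[/eqP r0|r0].
  by rewrite -r0 mul0e; apply: tsum_ge0 => x; rewrite mule_ge0.
have := @key (r^-1)%:E (fun x => r%:E * f x).
rewrite lee_fin invr_ge0 (ltW r0) => /(_ isT).
rewrite (@eq_tsum _ (fun x => (r^-1)%:E * (r%:E * f x)) f); last first.
  by move=> x; rewrite muleA -EFinM mulVf ?gt_eqF// mul1e.
move=> /(_ (fun x => mule_ge0 (ltW r0 : 0 <= r%:E) (f0 x))) H.
rewrite (le_trans (lee_wpmul2l _ H))//; first by rewrite lee_fin ltW.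
by rewrite muleA -EFinM divff ?gt_eqF// mul1e.
Qed.

Lemma tsumZr T (f : T -> \bar R) (a : \bar R) : 0 <= a -> (forall x, 0 <= f x) ->
  \tsum_(x) (f x * a) = tsum f * a.
Proof.
by move=> a0 f0; rewrite muleC -tsumZ//; apply: eq_tsum => x; rewrite muleC.
Qed.

Lemma tsum_pair T U (f : T -> U -> \bar R) : (forall x y, 0 <= f x y) ->
  \tsum_(x) \tsum_(y) f x y = \tsum_(k : T * U) f k.1 k.2.
Proof.
move=> f0; rewrite /tsum esum_esum//.
by congr (esum _ _); apply/seteqP; split.
Qed.

Lemma tsum_bij T U (e : T -> U) (e' : U -> T) (f : U -> \bar R) :
  cancel e e' -> cancel e' e -> tsum f = \tsum_(x) f (e x).
Proof.
move=> ee' e'e; apply: reindex_esum; split => //.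
- by move=> x y _ _ /(congr1 e'); rewrite !ee'.
- by move=> y _ /=; exists (e' y).
Qed.

Lemma tsum_exchange T U (f : T -> U -> \bar R) : (forall x y, 0 <= f x y) ->
  \tsum_(x) \tsum_(y) f x y = \tsum_(y) \tsum_(x) f x y.
Proof.
move=> f0; rewrite !tsum_pair//.
rewrite (@tsum_bij _ _ (fun k : U * T => (k.2, k.1)) (fun k => (k.2, k.1)))//.
- by case.
- by case.
Qed.

Lemma tsum_fiber T U (g : T -> U) (f : T -> \bar R) : (forall x, 0 <= f x) ->
  tsum f = \tsum_(y) \tsum_(x) (if g x == y then f x else 0).
Proof.
move=> f0; rewrite tsum_exchange; last by move=> x y; case: ifP.
apply: eq_tsum => x; rewrite (@tsum1 _ _ (g x)) ?eqxx//.
- by move=> y; case: ifP.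
- by move=> y yg; rewrite ifN// eq_sym.
Qed.

Lemma tsum_nat (f : nat -> \bar R) : (forall n, 0 <= f n) ->
  tsum f = \sum_(n <oo) f n.
Proof. by move=> f0; rewrite nneseries_esumT. Qed.

End tsum.

(** * Convolutions and their exponential *)

Section convolution_def.
Local Open Scope ereal_scope.
Variables (R : realType) (G : zmodType).
Implicit Types (f g h A B : G -> \bar R).

Definition conv f g (x : G) : \bar R := \tsum_(y) (f y * g (x - y)%R).

Definition delta0 (x : G) : \bar R := (x == 0%R)%:R%:E.

Fixpoint cpow A n : G -> \bar R :=
  if n is m.+1 then conv A (cpow A m) else delta0.

Definition nng f := forall x, 0 <= f x.

Lemma conv_ge0 f g : nng f -> nng g -> nng (conv f g).
Proof. by move=> f0 g0 x; apply: tsum_ge0 => y; rewrite mule_ge0. Qed.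

Lemma delta0_ge0 : nng delta0.
Proof. by move=> x; rewrite lee_fin ler0n. Qed.

Lemma cpow_ge0 A n : nng A -> nng (cpow A n).
Proof.
by move=> A0; elim: n => [|n IH]; [exact: delta0_ge0|exact: conv_ge0].
Qed.

(** Divided powers: the binomial formula for them has no coefficients. *)
Definition dpow A n (x : G) : \bar R := (n`!%:R^-1)%:E * cpow A n x.

Definition cexp A (x : G) : \bar R := \tsum_(n : nat) dpow A n x.

Lemma dpow_ge0 A n : nng A -> nng (dpow A n).
Proof.
by move=> A0 x; apply: mule_ge0; [rewrite lee_fin invr_ge0 ler0n|exact: cpow_ge0].
Qed.

Lemma cexp_ge0 A : nng A -> nng (cexp A).
Proof. by move=> A0 x; apply: tsum_ge0 => n; exact: dpow_ge0. Qed.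

End convolution_def.

(** Discharges the nonnegativity side conditions of the summation lemmas, which
    follow from the shape of the summand. *)
Ltac nonneg := lazymatch goal with
  | |- nng (conv _ _) => apply: conv_ge0; nonneg
  | |- nng (cpow _ _) => apply: cpow_ge0; nonneg
  | |- nng (dpow _ _) => apply: dpow_ge0; nonneg
  | |- nng (cexp _) => apply: cexp_ge0; nonneg
  | |- nng (@delta0 _ _) => exact: delta0_ge0
  | |- nng _ => first [assumption | let x := fresh "x" in intro x; cbv beta; nonneg]
  | |- forall x, _ => let x := fresh "x" in intro x; cbv beta; nonneg
  | |- is_true (Order.le _ (conv _ _ _)) => apply: conv_ge0; nonneg
  | |- is_true (Order.le _ (cpow _ _ _)) => apply: cpow_ge0; nonneg
  | |- is_true (Order.le _ (dpow _ _ _)) => apply: dpow_ge0; nonneg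
  | |- is_true (Order.le _ (cexp _ _)) => apply: cexp_ge0; nonneg
  | |- is_true (Order.le _ (@delta0 _ _ _)) => apply: delta0_ge0
  | |- is_true (Order.le _ (tsum _)) => apply: tsum_ge0; nonneg
  | |- is_true (Order.le _ (mule _ _)) => apply: mule_ge0; nonneg
  | |- is_true (Order.le _ (adde _ _)) => apply: adde_ge0; nonneg
  | |- is_true (Order.le _ (GRing.add _ _)) => apply: adde_ge0; nonneg
  | |- is_true (Order.le _ (bigop _ _ _)) => apply: sume_ge0; nonneg
  | |- is_true (Order.le _ (EFin _)) =>
      rewrite ?lee_fin ?invr_ge0 ?ler0n ?expR_ge0; solve [assumption | done]
  | |- is_true (Order.le _ (?f ?x)) =>
      first [assumption | match goal with H : nng f |- _ => exact (H x)
             | H : forall y, is_true (Order.le _ (f y)) |- _ => exact (H x) end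
             | match goal with H : forall i, nng _ |- _ => exact: H end | done]
  | |- _ => first [assumption | done]
  end.

Section convolution.
Local Open Scope ereal_scope.
Variables (R : realType) (G : zmodType).
Implicit Types (f g h A B : G -> \bar R).
Local Notation delta0 := (@delta0 R G).

Lemma convC f g : conv f g = conv g f.
Proof.
apply/funext => x; rewrite /conv (@tsum_bij _ _ _ (fun y => x - y)%R (fun y => x - y)%R).
- by apply: eq_tsum => y; rewrite muleC opprB addrC subrK.
- by move=> y; rewrite opprB addrC subrK.
- by move=> y; rewrite opprB addrC subrK.
Qed.

Lemma tsum_conv f g h : nng f -> nng g -> nng h ->
  \tsum_(x) (conv f g x * h x) = \tsum_(y) \tsum_(z) (f y * g z * h (y + z)%R).
Proof.
move=> f0 g0 h0.
rewrite [LHS](_ : _ = \tsum_(x) \tsum_(y) (f y * g (x - y)%R * h x)); last first.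
  by apply: eq_tsum => x; rewrite -tsumZr// => y; rewrite mule_ge0.
rewrite tsum_exchange; try nonneg.
apply: eq_tsum => y.
rewrite (@tsum_bij _ _ _ (fun z => y + z)%R (fun z => z - y)%R).
- by apply: eq_tsum => z; rewrite [(y + z - y)%R]addrC addKr.
- by move=> z; rewrite addrC addKr.
- by move=> z; rewrite addrC subrK.
Qed.

Lemma convA f g h : nng f -> nng g -> nng h ->
  conv (conv f g) h = conv f (conv g h).
Proof.
move=> f0 g0 h0; apply/funext => x.
rewrite /conv -/(conv f g).
rewrite (@tsum_conv f g (fun y => h (x - y)%R))//.
apply: eq_tsum => y.
rewrite -tsumZ//; try nonneg.
by apply: eq_tsum => z; rewrite muleA opprD addrA.
Qed.

Lemma convCA f g h : nng f -> nng g -> nng h ->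
  conv f (conv g h) = conv g (conv f h).
Proof. by move=> *; rewrite -!convA// (convC f). Qed.

Lemma conv0f f : nng f -> conv delta0 f = f.
Proof.
move=> f0; apply/funext => x; rewrite /conv (@tsum1 _ _ _ 0%R).
- by rewrite /delta0 eqxx mul1e subr0.
- by nonneg.
- by move=> y y0; rewrite /delta0 (negbTE y0) mul0e.
Qed.

Lemma conv_delta0Z f (a : \bar R) : nng f -> 0 <= a ->
  conv (fun x => a * delta0 x) f = fun x => a * f x.
Proof.
move=> f0 a0; apply/funext => x; rewrite /conv (@tsum1 _ _ _ 0%R).
- by rewrite /delta0 eqxx mule1 subr0.
- by nonneg.
- by move=> y y0; rewrite /delta0 (negbTE y0) mule0 mul0e.
Qed.

Lemma convDl f g h : nng f -> nng g -> nng h ->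
  conv (fun x => f x + g x) h = fun x => conv f h x + conv g h x.
Proof.
move=> f0 g0 h0; apply/funext => x; rewrite /conv -tsumD//.
- by apply: eq_tsum => y; rewrite ge0_muleDl.
- by nonneg.
- by nonneg.
Qed.

Lemma convZl f g (a : \bar R) : nng f -> nng g -> 0 <= a ->
  conv (fun x => a * f x) g = fun x => a * conv f g x.
Proof.
move=> f0 g0 a0; apply/funext => x; rewrite /conv -tsumZ//.
- by apply: eq_tsum => y; rewrite muleA.
- by nonneg.
Qed.

Lemma convZr f g (a : \bar R) : nng f -> nng g -> 0 <= a ->
  conv f (fun x => a * g x) = fun x => a * conv f g x.
Proof. by move=> *; rewrite convC convZl// convC. Qed.

Lemma conv_tsuml (T : choiceType) (f : T -> G -> \bar R) g :
  (forall t, nng (f t)) -> nng g ->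
  conv (fun x => \tsum_(t) f t x) g = fun x => \tsum_(t) conv (f t) g x.
Proof.
move=> f0 g0; apply/funext => x; rewrite /conv tsum_exchange; last first.
  by move=> t y; rewrite mule_ge0//; exact: f0.
apply: eq_tsum => y; rewrite tsumZr//.
by move=> t; exact: f0.
Qed.

Lemma conv_suml (I : Type) (s : seq I) (f : I -> G -> \bar R) g :
  (forall t, nng (f t)) -> nng g ->
  conv (fun x => \sum_(t <- s) f t x) g = fun x => \sum_(t <- s) conv (f t) g x.
Proof.
move=> f0 g0; elim: s => [|i s IH].
  apply/funext => x; rewrite big_nil /conv tsum0// => y.
  by rewrite big_nil mul0e.
under eq_fun do rewrite big_cons.
rewrite convDl//; try nonneg.
by rewrite IH; apply/funext => x; rewrite big_cons.
Qed.

Lemma tsum_mass_conv f g : nng f -> nng g ->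
  tsum (conv f g) = tsum f * tsum g.
Proof.
move=> f0 g0; rewrite (@eq_tsum _ _ _ (fun x => conv f g x * cst 1 x)); last first.
  by move=> x; rewrite mule1.
rewrite tsum_conv// -tsumZr//; try nonneg.
apply: eq_tsum => y; rewrite -tsumZ//.
by apply: eq_tsum => z; rewrite mule1.
Qed.

Lemma conv_le_mass f g (M : \bar R) x : nng f -> nng g -> 0 <= M ->
  (forall y, f y <= M) -> conv f g x <= M * tsum g.
Proof.
move=> f0 g0 M0 fM; rewrite convC /conv -tsumZ//; apply: le_tsum => y.
by rewrite muleC lee_wpmul2r.
Qed.

Lemma mass_delta0 : tsum delta0 = 1.
Proof.
rewrite (@tsum1 _ _ _ 0%R); [by rewrite /delta0 eqxx|by nonneg|].
by move=> x x0; rewrite /delta0 (negbTE x0).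
Qed.

Lemma mass_cpow A n (a : R) : nng A -> tsum A = a%:E ->
  tsum (cpow A n) = (a ^+ n)%:E.
Proof.
move=> A0 Aa; elim: n => [|n IH] /=; first by rewrite mass_delta0.
by rewrite tsum_mass_conv//; [rewrite IH Aa exprS EFinM|exact: cpow_ge0].
Qed.

Lemma conv_dpowS A n : nng A ->
  conv A (dpow A n) = fun x => n.+1%:R%:E * dpow A n.+1 x.
Proof.
move=> A0; rewrite /dpow convZr//; try nonneg.
apply/funext => x /=; rewrite muleA -EFinM factS natrM invfM mulrA.
by rewrite divff ?mul1r// pnatr_eq0.
Qed.

Lemma mass_dpow A n (a : R) : nng A -> tsum A = a%:E ->
  tsum (dpow A n) = (a ^+ n / n`!%:R)%:E.
Proof.
move=> A0 Aa; rewrite /dpow tsumZ//; try nonneg.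
by rewrite (mass_cpow _ A0 Aa) -EFinM mulrC.
Qed.

(** The Leibniz rule: multiplied by [n.+1], both sides satisfy the recursion
    given by [conv_dpowS]. *)
Lemma dpowD A B n x : nng A -> nng B ->
  dpow (fun y => A y + B y) n x =
  \sum_(k < n.+1) conv (dpow A k) (dpow B (n - k)) x.
Proof.
move=> A0 B0; elim: n x => [|n IH] x.
  rewrite big_ord1 subnn.
  have d0 C : dpow C 0 = delta0.
    by apply/funext => y; rewrite /dpow /= invr1 mul1e.
  by rewrite !d0 conv0f//; nonneg.
set T := fun k => conv (dpow A k) (dpow B (n.+1 - k)) x.
have T0 k : 0 <= T k by rewrite /T; nonneg.
have AB0 : nng (fun y => A y + B y) by move=> y; rewrite adde_ge0.
have N0 k : 0 <= (k%:R : R)%:E by rewrite lee_fin ler0n.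
suff H : n.+1%:R%:E * dpow (fun y => A y + B y) n.+1 x =
    n.+1%:R%:E * \sum_(k < n.+2) T k.
  have E z : z = (n.+1%:R^-1 : R)%:E * (n.+1%:R%:E * z).
    by rewrite muleA -EFinM mulVf ?pnatr_eq0// mul1e.
  by rewrite [LHS]E H -E.
transitivity (\sum_(k < n.+1) (k.+1%:R%:E * T k.+1) +
              \sum_(k < n.+1) ((n.+1 - k)%:R%:E * T k)).
  rewrite -[LHS]/((fun x => n.+1%:R%:E * dpow (fun y => A y + B y) n.+1 x) x).
  rewrite -conv_dpowS//.
  have -> : dpow (fun y => A y + B y) n = fun y =>
      \sum_(k <- index_enum 'I_n.+1) conv (dpow A k) (dpow B (n - k)) y.
    by apply/funext => y; rewrite IH.
  rewrite convC conv_suml//; try nonneg.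
  rewrite -big_split/=; apply: eq_bigr => k _.
  rewrite convC convDl//; try nonneg.
  congr (_ + _).
    change (conv A (conv (dpow A k) (dpow B (n - k))) x = k.+1%:R%:E * T k.+1).
    rewrite -convA; try nonneg.
    rewrite conv_dpowS// convZl; try nonneg.
  change (conv B (conv (dpow A k) (dpow B (n - k))) x = (n.+1 - k)%:R%:E * T k).
  rewrite convCA; try nonneg.
  rewrite conv_dpowS// convZr; try nonneg.
  by rewrite /T subSn// -ltnS ltn_ord.
rewrite ge0_sume_distrr//.
rewrite [X in X + _](_ : _ = \sum_(k < n.+2) (k%:R%:E * T k)); last first.
  by rewrite [RHS]big_ord_recl mul0e add0e; apply: eq_bigr.
rewrite [X in _ + X](_ : _ = \sum_(k < n.+2) ((n.+1 - k)%:R%:E * T k)); last first.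
  by rewrite [RHS]big_ord_recr/= subnn mul0e adde0.
rewrite -big_split/=; apply: eq_bigr => k _.
rewrite -ge0_muleDl// -EFinD -natrD subnKC//.
by rewrite -ltnS ltn_ord.
Qed.

Lemma cexpD A B : nng A -> nng B ->
  conv (cexp A) (cexp B) = cexp (fun y => A y + B y).
Proof.
move=> A0 B0; rewrite /cexp.
rewrite conv_tsuml//; try nonneg.
apply/funext => x.
rewrite [LHS](_ : _ = \tsum_(k) \tsum_(l) conv (dpow A k) (dpow B l) x); last first.
  apply: eq_tsum => k; rewrite convC conv_tsuml//; try nonneg.
  by apply: eq_tsum => l; rewrite convC.
rewrite tsum_pair; try nonneg.
rewrite (@tsum_fiber _ _ _ (fun k => k.1 + k.2)%N); last first.
  by move=> *; apply: conv_ge0; exact: dpow_ge0.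
apply: eq_tsum => n; rewrite dpowD//.
rewrite (@tsum_fin _ _ _ [seq (k, n - k)%N | k <- iota 0 n.+1]).
- rewrite big_map -[iota 0 n.+1]/(index_iota 0 n.+1) big_mkord.
  apply: eq_bigr => k _ /=; rewrite subnKC ?eqxx//.
  by rewrite -ltnS ltn_ord.
- move=> k; case: ifP => // _; apply: conv_ge0; exact: dpow_ge0.
- by rewrite map_inj_uniq ?iota_uniq// => a b [].
- move=> [k l] kl; rewrite ifN//; apply: contra kl => /eqP <-.
  apply/mapP; exists k; last by rewrite addKn.
  by rewrite mem_iota/= add0n ltnS leq_addr.
Qed.

Lemma tsum_expR (a : R) : (0 <= a)%R ->
  \tsum_(n) (n`!%:R^-1 * a ^+ n)%:E = (expR a)%:E.
Proof.
move=> a0; rewrite tsum_nat; last first.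
  by move=> n; rewrite lee_fin mulr_ge0 ?invr_ge0 ?ler0n// exprn_ge0.
rewrite expRE -EFin_lim; last first.
  rewrite /pseries/=; under eq_fun do rewrite mulrC.
  exact: is_cvg_series_exp_coeff.
by apply/congr_lim/funext => n/=; rewrite /pseries/= /series/= -sumEFin.
Qed.

Lemma cexp_delta0 (a : R) : (0 <= a)%R ->
  cexp (fun x => a%:E * delta0 x) = fun x => (expR a)%:E * delta0 x.
Proof.
move=> a0; apply/funext => x.
have E n : cpow (fun x => a%:E * delta0 x) n = fun x => (a ^+ n)%:E * delta0 x.
  elim: n => [|n IH] /=; first by apply/funext => y; rewrite expr0 mul1e.
  rewrite IH conv_delta0Z//; last first.
    by move=> y; apply: mule_ge0; [rewrite lee_fin exprn_ge0|nonneg].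
  by apply/funext => y; rewrite muleA -EFinM -exprS.
rewrite /cexp -tsum_expR// -tsumZr; last 2 first.
- by nonneg.
- by move=> n; rewrite lee_fin mulr_ge0 ?invr_ge0 ?ler0n// exprn_ge0.
by apply: eq_tsum => n; rewrite /dpow E muleA -EFinM.
Qed.

Lemma mass_cexp A (a : R) : nng A -> tsum A = a%:E ->
  tsum (cexp A) = (expR a)%:E.
Proof.
move=> A0 Aa; have a0 : (0 <= a)%R by rewrite -lee_fin -Aa; nonneg.
rewrite /cexp tsum_exchange; last by nonneg.
rewrite -tsum_expR//; apply: eq_tsum => n.
by rewrite -/(tsum _) (mass_dpow _ A0 Aa) mulrC.
Qed.

Lemma tsum_natS (f : nat -> \bar R) : (forall n, 0 <= f n) ->
  tsum f = f 0%N + \tsum_(n) f n.+1.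
Proof.
move=> f0; rewrite !tsum_nat//; rewrite nneseries_recl//; congr (_ + _).
by rewrite -nneseries_addn//; apply: eq_eseriesr => i _; rewrite addn1.
Qed.

Lemma conv_inv (s : G -> G) f g : nng f -> nng g ->
  (forall x y, s (x - y)%R = (s x - s y)%R) -> involutive s ->
  (forall x, f (s x) = f x) -> (forall x, g (s x) = g x) ->
  forall x, conv f g (s x) = conv f g x.
Proof.
move=> f0 g0 sB ss fs gs x; rewrite /conv (@tsum_bij _ _ _ s s)//.
by apply: eq_tsum => y; rewrite fs -sB gs.
Qed.

Lemma delta0_inv (s : G -> G) : (forall x y, s (x - y)%R = (s x - s y)%R) ->
  involutive s -> forall x, delta0 (s x) = delta0 x.
Proof.
move=> sB ss x; have s0 : s 0%R = 0%R by rewrite -{1}(subrr 0%R) sB subrr.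
by rewrite /delta0 -(inj_eq (inv_inj ss) (s x)) ss s0.
Qed.

Lemma cpow_inv (s : G -> G) A n : nng A ->
  (forall x y, s (x - y)%R = (s x - s y)%R) -> involutive s ->
  (forall x, A (s x) = A x) -> forall x, cpow A n (s x) = cpow A n x.
Proof.
move=> A0 sB ss As; elim: n => [|n IH] /=; first exact: delta0_inv.
by apply: conv_inv => //; nonneg.
Qed.

Lemma cexp_inv (s : G -> G) A : nng A ->
  (forall x y, s (x - y)%R = (s x - s y)%R) -> involutive s ->
  (forall x, A (s x) = A x) -> forall x, cexp A (s x) = cexp A x.
Proof.
by move=> A0 sB ss As x; apply: eq_tsum => n; rewrite /dpow cpow_inv.
Qed.

Section subadditive.
Variables (m : G -> \bar R) (m_ge0 : nng m) (m0 : m 0%R = 0).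
Hypothesis m_par : forall y z,
  m (y + z)%R + m (y - z)%R <= 2%:E * m y + 2%:E * m z.

(** A function with the parallelogram inequality, like a square or a truncated
    absolute value, is subadditive along independent sums: [m (y + z)] and [m
    (y - z)] have the same mean when [g] is symmetric. *)
Lemma tsum_conv_moment f g : nng f -> nng g -> (forall x, g (- x)%R = g x) ->
  \tsum_(x) (conv f g x * m x) <=
  \tsum_(x) (f x * m x) * tsum g + tsum f * \tsum_(x) (g x * m x).
Proof.
move=> f0 g0 gN.
have two0 : 0 <= (2%:R : R)%:E by rewrite lee_fin ler0n.
have E1 : \tsum_(x) (conv f g x * m x) =
    \tsum_(y) \tsum_(z) (f y * g z * m (y + z)%R) by exact: tsum_conv.
have E2 : \tsum_(x) (conv f g x * m x) =
    \tsum_(y) \tsum_(z) (f y * g z * m (y - z)%R).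
  rewrite E1; apply: eq_tsum => y.
  rewrite (@tsum_bij _ _ _ (fun z => - z)%R (fun z => - z)%R)//; try exact: opprK.
  by apply: eq_tsum => z; rewrite gN.
suff H : 2%:E * \tsum_(x) (conv f g x * m x) <= 2%:E *
    (\tsum_(x) (f x * m x) * tsum g + tsum f * \tsum_(x) (g x * m x)).
  by rewrite -(@lee_pmul2l _ 2%:E)// lte_fin.
rewrite mule_natl mule2n {1}E1 {1}E2 -tsumD; try nonneg.
rewrite [X in X <= _](_ : _ = \tsum_(y) \tsum_(z)
   (f y * g z * (m (y + z)%R + m (y - z)%R))); last first.
  apply: eq_tsum => y; rewrite -tsumD; try nonneg.
  by apply: eq_tsum => z; rewrite ge0_muleDr.
rewrite [X in _ <= X](_ : _ = \tsum_(y) \tsum_(z)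
   (f y * g z * (2%:E * m y + 2%:E * m z))).
  apply: le_tsum => y; apply: le_tsum => z.
  by apply: lee_wpmul2l => //; nonneg.
rewrite ge0_muleDr; try nonneg.
rewrite [RHS](_ : _ = \tsum_(y) (2%:E * (f y * m y) * tsum g +
   2%:E * (f y * \tsum_(x) (g x * m x)))).
  rewrite tsumD; try nonneg.
  rewrite tsumZr; try nonneg.
  rewrite tsumZ; try nonneg.
  rewrite muleA; congr (_ + _).
  rewrite tsumZ; try nonneg.
  by rewrite tsumZr; try nonneg.
apply: eq_tsum => y; rewrite -!tsumZ; try nonneg.
rewrite -tsumD; try nonneg.
apply: eq_tsum => z; rewrite ge0_muleDr; try nonneg.
congr (_ + _).
  by rewrite muleCA -[RHS]muleA; congr (_ * _); rewrite muleAC.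
by rewrite muleCA; congr (_ * _); rewrite muleA.
Qed.

Lemma tsum_cpow_moment A (a : R) n : nng A -> (forall x, A (- x)%R = A x) ->
  tsum A = a%:E ->
  \tsum_(x) (cpow A n.+1 x * m x) <=
    (n.+1%:R * a ^+ n)%:E * \tsum_(x) (A x * m x).
Proof.
move=> A0 AN Aa; have a0 : (0 <= a)%R by rewrite -lee_fin -Aa; nonneg.
have key k : \tsum_(x) (cpow A k.+1 x * m x) <=
    \tsum_(x) (cpow A k x * m x) * a%:E + (a ^+ k)%:E * \tsum_(x) (A x * m x).
  rewrite /= convC; apply: le_trans (tsum_conv_moment _ _ _) _ => //; first by nonneg.
  by rewrite Aa (mass_cpow _ A0 Aa).
elim: n => [|n IH].
  apply: le_trans (key 0%N) _; rewrite [X in X * _]tsum0 ?mul0e ?add0e ?mulr1//.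
  move=> x /=; rewrite /delta0; case: eqP => [->|]; rewrite ?m0 ?mule0//.
  by rewrite mul0e.
apply: le_trans (key n.+1) _.
have T0 : 0 <= \tsum_(x) (A x * m x) by nonneg.
have /(@lee_wpmul2r _ a%:E a0) H := IH.
apply: le_trans (leeD2r _ H) _.
rewrite muleAC -ge0_muleDl//; try by rewrite -EFinM lee_fin !mulr_ge0 ?ler0n ?exprn_ge0.
  by rewrite -EFinM -EFinD exprSr mulrA [n.+2%:R]mulrS [in leRHS]mulrDl mul1r !mulrDl addrC ?mulrA.
by rewrite lee_fin exprn_ge0.
Qed.

Lemma tsum_cexp_moment A (a : R) : nng A -> (forall x, A (- x)%R = A x) ->
  tsum A = a%:E ->
  \tsum_(x) (cexp A x * m x) <= (expR a)%:E * \tsum_(x) (A x * m x).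
Proof.
move=> A0 AN Aa; have a0 : (0 <= a)%R by rewrite -lee_fin -Aa; nonneg.
have T0 : 0 <= \tsum_(x) (A x * m x) by nonneg.
rewrite [leLHS](_ : _ = \tsum_(n) \tsum_(x) (dpow A n x * m x)); last first.
  rewrite tsum_exchange; last by nonneg.
  by apply: eq_tsum => x; rewrite -tsumZr// => n; nonneg.
rewrite tsum_natS; last by nonneg.
rewrite [X in X + _]tsum0 ?add0e; last first.
  move=> x; rewrite /dpow /= /delta0; case: eqP => [->|]; rewrite ?m0 ?mule0//.
  by rewrite mul0e.
rewrite -tsum_expR// -tsumZr//; last first.
  by move=> n; rewrite lee_fin mulr_ge0 ?invr_ge0 ?ler0n// exprn_ge0.
apply: le_tsum => n.
rewrite [leLHS](_ : _ = (n.+1`!%:R^-1)%:E * \tsum_(x) (cpow A n.+1 x * m x)).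
  have f0 : (0 <= (n.+1)`!%:R^-1 :> R)%R by rewrite invr_ge0 ler0n.
  apply: le_trans (lee_wpmul2l _ (tsum_cpow_moment n A0 AN Aa)) _ => //.
  rewrite muleA -EFinM factS natrM invfM mulrA -(mulrA n.+1%:R^-1)%R.
  rewrite (mulrC n`!%:R^-1)%R mulrA mulVf ?pnatr_eq0// mul1r.
  by [].
by rewrite -tsumZ; [apply: eq_tsum => x; rewrite /dpow muleA|nonneg|move=> *; nonneg].
Qed.

End subadditive.

End convolution.

(** * Additive coordinates are derivations for convolution *)

Section derivation.
Local Open Scope ereal_scope.
Variables (R : realType) (G : zmodType) (c : G -> int).
Hypothesis cB : forall x y, c (x - y)%R = (c x - c y)%R.
Implicit Types (f g A : G -> \bar R).

Definition wpos (x : G) : \bar R := (Num.max (c x) 0)%:~R%:E.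
Definition wneg (x : G) : \bar R := (Num.max (- c x) 0)%:~R%:E.

Lemma wpos_ge0 : nng wpos.
Proof. by move=> x; rewrite lee_fin ler0z le_max lexx orbT. Qed.
Lemma wneg_ge0 : nng wneg.
Proof. by move=> x; rewrite lee_fin ler0z le_max lexx orbT. Qed.
Let wp0 := wpos_ge0.
Let wn0 := wneg_ge0.

Lemma coord0 : c 0%R = 0%R.
Proof. by rewrite -(subrr 0%R) cB subrr. Qed.

Lemma wposneg x y : wpos x + wneg y + wneg (x - y)%R =
  wneg x + wpos y + wpos (x - y)%R.
Proof.
rewrite /wpos /wneg -!EFinD -!rmorphD/= cB; congr (_%:~R%:E).
by lia.
Qed.

(** As [c] is additive, [c x = c y + c (x - y)], so multiplication by [c] is a
    derivation for convolution. All sums have values in [[0, +oo]], hence the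
    splitting of [c] into positive and negative parts, placed on the side where
    they are added. *)
Lemma conv_deriv f g x : nng f -> nng g ->
  wpos x * conv f g x + conv (fun y => wneg y * f y) g x +
    conv f (fun y => wneg y * g y) x =
  wneg x * conv f g x + conv (fun y => wpos y * f y) g x +
    conv f (fun y => wpos y * g y) x.
Proof.
move=> f0 g0.
have key (w1 w2 : G -> \bar R) : nng w1 -> nng w2 ->
    w1 x * conv f g x + conv (fun y => w2 y * f y) g x +
      conv f (fun y => w2 y * g y) x =
    \tsum_(y) ((w1 x + w2 y + w2 (x - y)%R) * (f y * g (x - y)%R)).
  move=> w10 w20; rewrite /conv -tsumZ; try nonneg.
  rewrite -!tsumD; try nonneg.
  apply: eq_tsum => y; rewrite !ge0_muleDl; try nonneg.
  congr (_ + _ + _); first by rewrite muleA.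
  by rewrite muleCA.
by rewrite !key//; apply: eq_tsum => y; rewrite wposneg.
Qed.

Definition wabs x : \bar R := wpos x + wneg x.

Lemma wabs_ge0 : nng wabs.
Proof. by move=> x; apply: adde_ge0. Qed.
Let wa0 := wabs_ge0.

Lemma wabs_sub x y : wabs x <= wabs y + wabs (x - y)%R.
Proof.
rewrite /wabs /wpos /wneg -!EFinD -!rmorphD/= lee_fin ler_int cB.
by lia.
Qed.

(** Makes the terms that [cpow_deriv] cancels finite. *)
Lemma wabs_cpow A (a M : R) n : nng A -> tsum A = a%:E ->
  (forall x, wabs x * A x <= M%:E) ->
  exists M', forall x, wabs x * cpow A n x <= M'%:E.
Proof.
move=> A0 Aa AM; elim: n => [|n [K HK]].
  exists 0%R => x; rewrite /= /delta0; case: eqP => [->|_]; last by rewrite mule0.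
  by rewrite /wabs /wpos /wneg coord0 oppr0 maxxx add0e mul0e.
have M0 : 0 <= M%:E by apply: le_trans (AM 0%R); nonneg.
have K0 : 0 <= K%:E by apply: le_trans (HK 0%R); nonneg.
exists (M * a ^+ n + K * a)%R => x.
have -> : (M * a ^+ n + K * a)%:E =
    M%:E * tsum (cpow A n) + K%:E * tsum A.
  by rewrite (mass_cpow _ A0 Aa) Aa EFinD !EFinM.
apply: (@le_trans _ _ (conv (fun y => wabs y * A y) (cpow A n) x +
    conv (fun y => wabs y * cpow A n y) A x)).
  rewrite (convC _ A) /= /conv -tsumD; try nonneg.
  rewrite -tsumZ; try nonneg.
  apply: le_tsum => y; rewrite [X in _ + X]muleCA -muleA.
  rewrite -ge0_muleDl; try nonneg.
  by apply: lee_wpmul2r; [nonneg|exact: wabs_sub].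
by apply: leeD; apply: conv_le_mass => //; nonneg.
Qed.

Lemma cpow_deriv A (a M : R) n x : nng A -> tsum A = a%:E ->
  (forall x, wabs x * A x <= M%:E) ->
  wpos x * cpow A n x + n%:R%:E * conv (fun y => wneg y * A y) (cpow A n.-1) x =
  wneg x * cpow A n x + n%:R%:E * conv (fun y => wpos y * A y) (cpow A n.-1) x.
Proof.
move=> A0 Aa AM; elim: n x => [|n IH] x.
  rewrite !mul0e !adde0 /= /delta0; case: eqP => [->|_]; last by rewrite !mule0.
  by rewrite /wpos /wneg coord0 oppr0.
set f := cpow A n.
have f0 : nng f by rewrite /f; nonneg.
have {}IH : conv A (fun y => wpos y * f y) x +
      n%:R%:E * conv (fun y => wneg y * A y) f x =
    conv A (fun y => wneg y * f y) x +
      n%:R%:E * conv (fun y => wpos y * A y) f x.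
  have key w1 w2 : nng w1 -> nng w2 ->
      conv A (fun y => w1 y * f y) x + n%:R%:E * conv (fun y => w2 y * A y) f x =
      conv A (fun y => w1 y * cpow A n y + n%:R%:E *
               conv (fun y => w2 y * A y) (cpow A n.-1) y) x.
    move=> w10 w20; rewrite [in RHS]convC convDl; try nonneg.
    rewrite (convC _ A); congr (_ + _).
    rewrite convZl; try nonneg.
    rewrite /f; case: n {IH f f0} => [|n]; first by rewrite !mul0e.
    congr (_ * _); rewrite [in RHS]convC convCA; try nonneg.
  have := key _ _ wp0 wn0; have := key _ _ wn0 wp0.
  have -> : (fun y => wneg y * cpow A n y +
               n%:R%:E * conv (fun y => wpos y * A y) (cpow A n.-1) y) =
      (fun y => wpos y * cpow A n y +
               n%:R%:E * conv (fun y => wneg y * A y) (cpow A n.-1) y).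
    by apply/funext => y; rewrite IH.
  by move=> -> ->.
have [M' HM'] := wabs_cpow n A0 Aa AM.
have M'0 : 0 <= M'%:E by apply: le_trans (HM' 0%R); nonneg.
set K1 := conv A (fun y => wpos y * f y) x.
set K2 := conv A (fun y => wneg y * f y) x.
pose K := K2 + K1.
have K0 : 0 <= K by rewrite /K /K1 /K2; nonneg.
have Kfin : K \is a fin_num.
  rewrite ge0_fin_numE//; apply: (@le_lt_trans _ _ (M'%:E * tsum A)).
    have -> : K = conv (fun y => wneg y * f y + wpos y * f y) A x.
      by rewrite convDl; try nonneg; rewrite /K /K1 /K2 !(convC A).
    apply: conv_le_mass; try nonneg.
    by move=> y; rewrite -ge0_muleDl// addeC; exact: HM'.
  by rewrite Aa -EFinM ltry.
move: IH (conv_deriv x A0 f0).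
rewrite -[cpow A n.+1]/(conv A f) -/K1 -/K2.
set P1 := wpos x * _; set N1 := wneg x * _.
set P2 := conv _ f x; set N2 := conv _ f x => IH H.
have P20 : 0 <= P2 by rewrite /P2; nonneg.
have N20 : 0 <= N2 by rewrite /N2; nonneg.
have S z : n.+1%:R%:E * z = z + n%:R%:E * z :> \bar R.
  by rewrite mulrS EFinD ge0_muleDl ?mul1e// lee_fin.
(* [K1] and [K2] occur on both sides and are finite, so they can be cancelled.
   *)
suff : P1 + n.+1%:R%:E * P2 + (K2 + K1) = N1 + n.+1%:R%:E * N2 + (K2 + K1).
  by move/(congr1 (fun z => z - (K2 + K1))); rewrite !addeK.
rewrite !S.
transitivity ((P1 + P2 + K2) + (K1 + n%:R%:E * P2)).
  by rewrite (AC (1*2*2) (1*2*4*(5*3))).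
rewrite H IH.
by rewrite (AC (3*2) (1*(2*5)*(4*3))).
Qed.

(** The identity [c p = (c A) * p] for the exponential [p] of [A]: the
    derivation [c] obeys the chain rule. It is written without subtraction as
    in [conv_deriv]. *)
Lemma cexp_deriv A (a M : R) x : nng A -> tsum A = a%:E ->
  (forall x, wabs x * A x <= M%:E) ->
  wpos x * cexp A x + conv (fun y => wneg y * A y) (cexp A) x =
  wneg x * cexp A x + conv (fun y => wpos y * A y) (cexp A) x.
Proof.
move=> A0 Aa AM.
have key w1 w2 : nng w1 -> nng w2 -> w1 0%R = 0 ->
    w1 x * cexp A x + conv (fun y => w2 y * A y) (cexp A) x =
    \tsum_(n) (((n.+1)`!%:R^-1)%:E * (w1 x * cpow A n.+1 x +
         n.+1%:R%:E * conv (fun y => w2 y * A y) (cpow A n.+1.-1) x)).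
  move=> w10 w20 w00; rewrite convC /cexp conv_tsuml; try nonneg.
  rewrite -tsumZ; try nonneg.
  rewrite tsum_natS; try nonneg.
  rewrite [X in X + _ + _](_ : _ = 0); last first.
    rewrite /dpow /= /delta0; case: eqP => [->|_]; last by rewrite !mule0.
    by rewrite w00 mul0e.
  rewrite add0e -tsumD; try nonneg.
  apply: eq_tsum => n; rewrite ge0_muleDr; try nonneg.
  congr (_ + _); first by rewrite /dpow muleCA.
  rewrite /dpow convZl; try nonneg.
  rewrite convC muleA -EFinM factS natrM invfM mulrAC mulVf ?pnatr_eq0//.
  by rewrite mul1r.
have p00 : wpos 0%R = 0 by rewrite /wpos coord0.
have n00 : wneg 0%R = 0 by rewrite /wneg coord0 oppr0.
rewrite (key _ _ wp0 wn0 p00) (key _ _ wn0 wp0 n00).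
by apply: eq_tsum => n; rewrite (cpow_deriv _ _ A0 Aa AM).
Qed.

End derivation.

(** * Reflections and unimodality *)

(** The mirror image [s] in the hyperplane [c = 0], [e] being the unit vector
    orthogonal to it. For the integers [s] is the opposite; for the lattice it
    changes the sign of one coordinate. *)
Record reflection (G : zmodType) (c : G -> int) (s : G -> G) (e : G) : Prop := {
  reflection_coordB : forall x y, c (x - y) = c x - c y;
  reflectionB : forall x y, s (x - y) = s x - s y;
  reflectionK : involutive s;
  reflectionE : forall x, s x = x - e *~ (2 * c x);
  reflection_unit : c e = 1 }.

Section unimodal.
Local Open Scope ereal_scope.
Variables (R : realType) (G : zmodType) (c : G -> int) (s : G -> G) (e : G).
Hypothesis csE : reflection c s e.
Implicit Types (f g A : G -> \bar R).

Let cB := reflection_coordB csE.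
Let sB := reflectionB csE.
Let ss := reflectionK csE.
Let sE := reflectionE csE.
Let ce := reflection_unit csE.

Let c0 : c 0%R = 0%R := coord0 cB.
Let cN x : c (- x)%R = (- c x)%R.
Proof. by rewrite -[(- x)%R]add0r cB c0 add0r. Qed.
Let cD x y : c (x + y)%R = (c x + c y)%R.
Proof. by rewrite -{1}[y]opprK cB cN opprK. Qed.
Let cMn n : c (e *+ n)%R = n%:Z.
Proof.
elim: n => [|n IH]; first by rewrite mulr0n c0.
by rewrite mulrS cD ce IH.
Qed.
Let cMz k : c (e *~ k)%R = k.
Proof.
case: k => n; first by rewrite -pmulrn cMn.
by rewrite NegzE mulrNz cN -pmulrn cMn.
Qed.
Let cs x : c (s x) = (- c x)%R.
Proof. by rewrite sE cB cMz mulrDl mul1r opprD addrA subrr add0r. Qed.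

(** Unimodality along the lines directed by [e], with the mode on the mirror.
    *)
Definition unimodal f := (forall x, f (s x) = f x) /\
  (forall x, (0 <= c x)%R -> f (x + e)%R <= f x).

Lemma unimodal_line f : unimodal f ->
  forall x (k : int), (`|c x| <= `|c x + k|)%R -> f (x + e *~ k)%R <= f x.
Proof.
move=> [fs fm].
have pos n x : (0 <= c x)%R -> f (x + e *+ n)%R <= f x.
  move=> x0; elim: n => [|n IH]; first by rewrite mulr0n addr0.
  apply: le_trans IH; rewrite mulrSr addrA; apply: fm.
  by rewrite cD cMn addr_ge0.
have main x (k : int) : (0 <= c x)%R -> (`|c x| <= `|c x + k|)%R ->
    f (x + e *~ k)%R <= f x.
  move=> x0; have [k0|k0] := leP 0%R k.
    by move=> _; rewrite -(gez0_abs k0) -pmulrn; apply: pos.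
  move=> kx; rewrite -fs sE cD cMz -addrA -mulrzBr.
  have n0 : (0 <= k - 2 * (c x + k))%R by lia.
  by rewrite -(gez0_abs n0) -pmulrn; apply: pos.
move=> x k; have [x0|x0] := leP 0%R (c x); first exact: main.
move=> kx; rewrite -fs -[leRHS]fs.
have -> : s (x + e *~ k)%R = (s x + e *~ (- k))%R.
  rewrite !sE cD cMz -!addrA; congr (_ + _)%R.
  by rewrite -!mulrNz -!mulrzDr; congr (_ *~ _)%R; lia.
by apply: main; rewrite cs; lia.
Qed.

Lemma rearrange_ge0 (a a' b b' : \bar R) : 0 <= a' -> a' <= a -> 0 <= b' ->
  b' <= b -> a' * b + a * b' <= a * b + a' * b'.
Proof.
move=> a'0 aa b'0 bb.
have a0 := le_trans a'0 aa; have b0 := le_trans b'0 bb.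
have [a'E|a'E] := eqVneq a' 0.
  by rewrite a'E !mul0e add0e adde0; apply: lee_wpmul2l.
have [b'E|b'E] := eqVneq b' 0.
  by rewrite b'E !mule0 !adde0; apply: lee_wpmul2r.
have a'p : 0 < a' by rewrite lt_neqAle eq_sym a'E.
have b'p : 0 < b' by rewrite lt_neqAle eq_sym b'E.
have ap := lt_le_trans a'p aa; have bp := lt_le_trans b'p bb.
case: a aa a0 ap => [a|aa a0 ap|//]; last first.
  by rewrite (gt0_mulye bp) addye ?leey// gt_eqF// (lt_le_trans ltNy0)// mule_ge0.
case: b bb b0 bp => [b|bb b0 bp aa a0 ap|//]; last first.
  by rewrite (gt0_muley ap) addye ?leey// gt_eqF// (lt_le_trans ltNy0)// mule_ge0.
case: a' a'0 a'E a'p => [a'| |]//; case: b' b'0 b'E b'p => [b'| |]//.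
move=> b'0 _ _ a'0 _ _; rewrite !lee_fin => bb b0 _ aa a0 _.
move: aa bb; rewrite -subr_ge0 -[(b' <= b)%R]subr_ge0 => aa bb.
by have := mulr_ge0 aa bb; rewrite -subr_ge0 => H; rewrite -subr_ge0; lra.
Qed.

(** Wintner's theorem: the convolution of symmetric unimodal functions is
    unimodal. To compare the values at [x + e] and [x], the sums are folded
    along the reflection [tau] in the midpoint between [- e] and [0]; the terms
    are then ordered by the rearrangement inequality. *)
Lemma unimodal_conv f g : nng f -> nng g -> unimodal f -> unimodal g ->
  unimodal (conv f g).
Proof.
move=> f0 g0 uf ug; have [fs fm] := uf; have [gs gm] := ug.
split; first exact: conv_inv.
move=> x x0.
(* [tau] fixes the midpoint between [- e] and [0], so it exchanges the
   half-spaces [c >= 0] and [c < 0] of the integer-valued [c]. *)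
pose tau y := (s y - e)%R.
have se : s e = (- e)%R by rewrite sE ce mulr1 mulrz_nat mulr2n opprD addrA subrr add0r.
have tauK y : tau (tau y) = y by rewrite /tau sB ss se opprK addrK.
have ctau y : c (tau y) = (- c y - 1)%R by rewrite /tau cB cs ce.
have half (h : G -> \bar R) : nng h -> tsum h =
    \tsum_(y) (if (0 <= c y)%R then h y + h (tau y) else 0).
  move=> h0.
  transitivity (\tsum_(y) ((if (0 <= c y)%R then h y else 0) +
                           (if (0 <= c y)%R then 0 else h y))).
    by apply: eq_tsum => y; case: ifP; rewrite ?adde0 ?add0e.
  rewrite tsumD; try by move=> y; case: ifP.
  rewrite [X in _ + X](@tsum_bij _ _ _ tau tau)//.
  rewrite -tsumD; try by move=> y; case: ifP.
  apply: eq_tsum => y; rewrite ctau; case: ifP => yc.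
    by rewrite ifF//; apply/negbTE; rewrite -ltNge; lia.
  rewrite ifT ?adde0//; by move/negbT: yc; rewrite -ltNge; lia.
rewrite /conv [leRHS]half; last by nonneg.
rewrite (@tsum_bij _ _ _ (fun y => y + e)%R (fun y => y - e)%R); first last.
- by move=> y; rewrite subrK.
- by move=> y; rewrite addrK.
rewrite [leLHS]half; last by nonneg.
apply: le_tsum => y; case: ifP => // yc.
have -> : (x + e - (y + e) = x - y)%R by rewrite opprD addrACA subrr addr0.
have -> : (tau y + e = s y)%R by rewrite subrK.
have -> : f (tau y) = f (y + e)%R.
  by rewrite -fs /tau sB ss se opprK.
have -> : (x + e - s y = x - tau y)%R by rewrite /tau opprB addrA addrAC.
rewrite fs; apply: rearrange_ge0 => //; first exact: fm.
have -> : (x - tau y = x - y + e *~ (2 * c y + 1))%R.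
  rewrite /tau sE mulrzDr mulr1z !opprD !opprK -!addrA; congr (_ + (_ + _))%R.
apply: unimodal_line => //; rewrite cB; lia.
Qed.

Lemma unimodal_delta0 : unimodal (@delta0 R G).
Proof.
split; first exact: delta0_inv.
move=> x x0; rewrite /delta0 lee_fin ler_nat; case: eqP => [xe|_]; last exact: leq0n.
by move: (congr1 c xe); rewrite cD ce c0 => h; move: x0; lia.
Qed.

Lemma unimodal_cexp A : nng A -> unimodal A -> unimodal (cexp A).
Proof.
move=> A0 uA.
have H n : unimodal (cpow A n).
  elim: n => [|n IH] /=; first exact: unimodal_delta0.
  by apply: unimodal_conv => //; nonneg.
split => [x|x x0]; first by apply: cexp_inv => //; case: uA.
by apply: le_tsum => n; apply: lee_wpmul2l; [nonneg|apply: (H n).2].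
Qed.

(** The derivation identity at [x], with [y] paired with its mirror image [s
    y]. By unimodality each pair contributes a nonnegative amount, so it is
    enough to keep the pairs in [F]; [d] collects lower bounds for them, which
    avoids subtracting extended reals. *)
Lemma reflected_drift A (a M : R) (F : seq G) (d : G -> \bar R) x :
  nng A -> tsum A = a%:E -> (forall x, wabs R c x * A x <= M%:E) ->
  (forall x, A (s x) = A x) -> unimodal (cexp A) -> (0 <= c x)%R ->
  uniq F -> nng d ->
  (forall y, y \in F -> (0 < c y)%R /\
     (c y)%:~R%:E * A y * cexp A (x - s y)%R + d y <=
     (c y)%:~R%:E * A y * cexp A (x - y)%R) ->
  \sum_(y <- F) d y <= (c x)%:~R%:E * cexp A x.
Proof.
move=> A0 Aa AM As uE x0 uF d0 HF.
have M0 : 0 <= M%:E.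
  by apply: le_trans (AM 0%R); apply: mule_ge0 => //; apply: wabs_ge0.
have wp0 := @wpos_ge0 R G c; have wn0 := @wneg_ge0 R G c.
have := cexp_deriv cB x A0 Aa AM.
have -> : wneg R c x = 0.
  by rewrite /wneg max_r// oppr_le0.
have -> : wpos R c x = (c x)%:~R%:E.
  by rewrite /wpos max_l.
rewrite mul0e add0e.
set B := conv _ _ x; set D := conv _ _ x => HBD.
have BE : B = \tsum_(y) (wpos R c y * A y * cexp A (x - s y)%R).
  rewrite /B /conv (@tsum_bij _ _ _ s s)//; apply: eq_tsum => y.
  by rewrite As /wneg /wpos cs opprK.
have B0 : 0 <= B by rewrite /B; nonneg.
have Bfin : B \is a fin_num.
  rewrite ge0_fin_numE//; apply: (@le_lt_trans _ _ (M%:E * tsum (cexp A))).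
    apply: conv_le_mass => //; try nonneg.
    move=> y; apply: le_trans (AM y); apply: lee_wpmul2r => //.
    by rewrite /wabs leeDr.
  by rewrite (mass_cexp A0 Aa) -EFinM ltry.
suff : \sum_(y <- F) d y + B <= D.
  by rewrite -HBD leeD2rE.
have -> : \sum_(y <- F) d y = \tsum_(y) (if y \in F then d y else 0).
  rewrite (@tsum_fin _ _ _ F)//.
  - by rewrite big_seq [RHS]big_seq; apply: eq_bigr => y ->.
  - by move=> y; case: ifP.
  - by move=> y /negbTE ->.
rewrite BE -tsumD; [|by move=> y; case: ifP|by nonneg].
apply: le_tsum => y; have [yF|yF] := boolP (y \in F).
  have [cy H] := HF _ yF; rewrite addeC.
  by have -> : wpos R c y = (c y)%:~R%:E
    by rewrite /wpos max_l// ltW.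
rewrite add0e; have [cy|cy] := leP (c y) 0%R.
  have -> : wpos R c y = 0 by rewrite /wpos max_r.
  by rewrite !mul0e.
apply: lee_wpmul2l; first by nonneg.
have -> : (x - s y = x - y + e *~ (2 * c y))%R by rewrite sE opprD opprK addrA.
by apply: unimodal_line => //; rewrite cB; lia.
Qed.

End unimodal.

(** * The heat kernel of a symmetric jump kernel *)

Section heat_kernel.
Variables (R : realType) (G : zmodType) (J : G -> R).

Definition scaledE (u : R) (x : G) : \bar R := (u * J x)%:E.

(** The law at time [u] of the walk that jumps at rate 1 according to [J]. *)
Definition heat (u : R) (x : G) : R := expR (- u) * fine (cexp (scaledE u) x).

Hypothesis J_ge0 : forall x, 0 <= J x.
Hypothesis J_mass : \tsum_(x) (J x)%:E = 1%E.

Lemma scaledE_ge0 u : 0 <= u -> nng (scaledE u).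
Proof. by move=> u0 x; rewrite lee_fin mulr_ge0. Qed.

Lemma mass_scaledE u : 0 <= u -> tsum (scaledE u) = u%:E.
Proof.
move=> u0; rewrite /scaledE -[RHS]mule1 -J_mass -tsumZ//.
Qed.

Lemma cexp_scaledE_fin u x : 0 <= u -> cexp (scaledE u) x \is a fin_num.
Proof.
move=> u0; have A0 := scaledE_ge0 u0; rewrite ge0_fin_numE; last by nonneg.
apply: (@le_lt_trans _ _ (tsum (cexp (scaledE u)))).
  by apply: tsum_ge1 => y; nonneg.
by rewrite (mass_cexp A0 (mass_scaledE u0)) ltry.
Qed.

Lemma heatE u x : 0 <= u ->
  (heat u x)%:E = ((expR (- u))%:E * cexp (scaledE u) x)%E.
Proof. by move=> u0; rewrite EFinM fineK// cexp_scaledE_fin. Qed.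

Lemma heat_ge0 u x : 0 <= u -> 0 <= heat u x.
Proof.
move=> u0; rewrite mulr_ge0 ?expR_ge0// fine_ge0//.
by have A0 := scaledE_ge0 u0; nonneg.
Qed.

Lemma heat_mass u : 0 <= u -> \tsum_(x) (heat u x)%:E = 1%E.
Proof.
move=> u0; have A0 := scaledE_ge0 u0.
transitivity (\tsum_(x) ((expR (- u))%:E * cexp (scaledE u) x))%E.
  by apply: eq_tsum => x; rewrite heatE.
rewrite tsumZ; [|by rewrite lee_fin expR_ge0|by nonneg].
by rewrite (mass_cexp A0 (mass_scaledE u0)) -EFinM expRN mulVf// gt_eqF ?expR_gt0.
Qed.

Lemma heat_conv s t x : 0 <= s -> 0 <= t ->
  \tsum_(y) (heat s y * heat t (x - y))%:E = (heat (s + t) x)%:E.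
Proof.
move=> s0 t0; have As := scaledE_ge0 s0; have At := scaledE_ge0 t0.
rewrite heatE ?addr_ge0//.
have -> : scaledE (s + t) = fun y => (scaledE s y + scaledE t y)%E.
  by apply/funext => y; rewrite /scaledE -EFinD mulrDl.
rewrite -cexpD// /conv -tsumZ; [|by rewrite lee_fin expR_ge0|by nonneg].
apply: eq_tsum => y; rewrite EFinM !heatE// opprD expRD EFinM.
by rewrite -!muleA; congr (_ * _)%E; rewrite muleCA.
Qed.

Lemma heat_inv (s : G -> G) u x : 0 <= u ->
  (forall x y, s (x - y) = s x - s y) -> involutive s ->
  (forall x, J (s x) = J x) -> heat u (s x) = heat u x.
Proof.
move=> u0 sB ss Js; rewrite /heat cexp_inv//; first exact: scaledE_ge0.
by move=> y; rewrite /scaledE Js.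
Qed.

Hypothesis J_even : forall x, J (- x) = J x.

Lemma heat_even u x : 0 <= u -> heat u (- x) = heat u x.
Proof.
by move=> u0; apply: heat_inv => //; [move=> y z; rewrite opprD|exact: opprK].
Qed.

Lemma heat_conv0 s t : 0 <= s -> 0 <= t ->
  \tsum_(y) (heat s y * heat t y)%:E = (heat (s + t) 0)%:E.
Proof.
move=> s0 t0; rewrite -heat_conv//; apply: eq_tsum => y.
by rewrite sub0r heat_even.
Qed.

(** [p_u = p_(u/2) * p_(u/2)], and [2 a b <= a^2 + b^2] termwise. *)
Lemma heat_le0 u x : 0 <= u -> heat u x <= heat u 0.
Proof.
move=> u0; have u20 : 0 <= u / 2 by lra.
have E := heat_conv0 u20 u20; rewrite -splitr in E.
have Ex := heat_conv x u20 u20; rewrite -splitr in Ex.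
rewrite -lee_fin -Ex.
suff H : (2%:E * \tsum_(y) (heat (u / 2) y * heat (u / 2) (x - y))%:E <=
         2%:E * (heat u 0)%:E)%E.
  by rewrite -(@lee_pmul2l _ 2%:E)// lte_fin.
have h0 y : (0 <= (heat (u / 2) y * heat (u / 2) y)%:E)%E.
  by rewrite lee_fin mulr_ge0// heat_ge0.
have h1 y : (0 <= (heat (u / 2) (x - y) * heat (u / 2) (x - y))%:E)%E.
  by rewrite lee_fin mulr_ge0// heat_ge0.
have -> : (2%:E * (heat u 0)%:E = (heat u 0)%:E + (heat u 0)%:E)%E.
  by rewrite -EFinM -EFinD; congr EFin; ring.
rewrite -{1}E -E.
rewrite [X in (_ <= _ + X)%E](@tsum_bij _ _ _ (fun y => x - y) (fun y => x - y)); first last.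
- by move=> y; rewrite opprB addrC subrK.
- by move=> y; rewrite opprB addrC subrK.
rewrite -tsumD// -tsumZ//; last by move=> y; rewrite lee_fin mulr_ge0// heat_ge0.
apply: le_tsum => y; rewrite -EFinM -EFinD lee_fin.
by have := sqr_ge0 (heat (u / 2) y - heat (u / 2) (x - y)); rewrite expr2; nra.
Qed.

(** [t |-> p_t(0)] is midpoint convex, for [p_(a+b)(0)] is the scalar product
    of [p_a] and [p_b]. *)
Lemma heat_mid a b : 0 <= a -> 0 <= b ->
  2 * heat (a + b) 0 <= heat (a + a) 0 + heat (b + b) 0.
Proof.
move=> a0 b0; rewrite -lee_fin EFinM [leRHS]EFinD -!heat_conv0//.
have h0 u v y : 0 <= u -> 0 <= v -> (0 <= (heat u y * heat v y)%:E)%E.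
  by move=> *; rewrite lee_fin mulr_ge0// heat_ge0.
rewrite -tsumD; try by move=> y; exact: h0.
rewrite -tsumZ//; last by move=> y; exact: h0.
apply: le_tsum => y; rewrite -EFinM -EFinD lee_fin.
by have := sqr_ge0 (heat a y - heat b y); rewrite expr2; nra.
Qed.

Lemma heat_defect s u : 0 <= s -> 0 <= u ->
  \tsum_(x) (heat s x * (heat u 0 - heat u x))%:E =
  (heat u 0 - heat (u + s) 0)%:E.
Proof.
move=> s0 u0; rewrite EFinB.
have h0 x : (0 <= (heat s x * heat u x)%:E)%E by rewrite lee_fin mulr_ge0// heat_ge0.
have E : (\tsum_(x) (heat s x * (heat u 0 - heat u x))%:E +
          (heat (u + s) 0)%:E = (heat u 0)%:E)%E.
  rewrite [u + s]addrC -heat_conv0// -tsumD//; last first.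
    by move=> x; rewrite lee_fin mulr_ge0 ?heat_ge0// subr_ge0 heat_le0.
  rewrite -[RHS]mul1e -(heat_mass s0) -tsumZr ?lee_fin ?heat_ge0//; last first.
    by move=> x; rewrite lee_fin heat_ge0.
  apply: eq_tsum => x; rewrite -EFinD -EFinM; congr EFin; ring.
by rewrite -E addeK.
Qed.

Lemma heat_decr s u : 0 <= s -> 0 <= u -> heat (u + s) 0 <= heat u 0.
Proof.
move=> s0 u0; rewrite -subr_ge0 -lee_fin -heat_defect//; apply: tsum_ge0 => x.
by rewrite lee_fin mulr_ge0 ?heat_ge0// subr_ge0 heat_le0.
Qed.

Lemma heat_antitone u v : 0 <= u -> u <= v -> heat v 0 <= heat u 0.
Proof. by move=> u0 uv; rewrite -(subrKC u v); apply: heat_decr; lra. Qed.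

(** By convexity the decrements of [t |-> p_t(0)] over intervals of length [s]
    grow as one goes back in time; about [u / (2 s)] of them fit between [u /
    2] and [u], and their sum is at most [p_(u/2)(0)]. *)
Lemma heat_slope s u : 0 < s -> s <= u ->
  heat u 0 - heat (u + s) 0 <= 2 * (s / u) * heat (u / 2) 0.
Proof.
move=> s0 su; have u0 : 0 < u by lra.
set D0 := heat u 0 - heat (u + s) 0.
(* [n] steps of length [s] lead from [u] back to no further than [u / 2]. *)
pose n := Num.truncn (u / (2 * s)).
have us0 : 0 <= u / (2 * s) by rewrite divr_ge0//; lra.
have /andP[nu un] := truncn_itv us0; rewrite -/n in nu un.
have D00 : 0 <= D0 by rewrite subr_ge0 heat_decr; lra.
have key k : (k <= n)%N -> D0 <= heat (u - k%:R * s) 0 - heat (u - k%:R * s + s) 0 /\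
    k.+1%:R * D0 <= heat (u - k%:R * s) 0 - heat (u + s) 0.
  elim: k => [_|k IH kn]; first by rewrite mul0r subr0 mul1r.
  have [IH1 IH2] := IH (ltnW kn).
  have ks : k.+1%:R * s <= u / 2.
    have : k.+1%:R <= u / (2 * s) by apply: le_trans nu; rewrite ler_nat.
    by rewrite ler_pdivlMr; [nra|lra].
  have S : k.+1%:R = k%:R + 1 :> R by rewrite -natr1.
  have k0 : 0 <= k%:R :> R by [].
  set v := u - k.+1%:R * s in ks *.
  have v0 : 0 <= v by rewrite /v; lra.
  have vE : u - k%:R * s = v + s by rewrite /v S; ring.
  have D1 : D0 <= heat v 0 - heat (v + s) 0.
    rewrite vE in IH1.
    have := @heat_mid (v / 2) (v / 2 + s).
    have -> : v / 2 + (v / 2 + s) = v + s by lra.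
    have -> : v / 2 + v / 2 = v by lra.
    have -> : v / 2 + s + (v / 2 + s) = v + s + s by lra.
    move=> H; have := H ltac:(lra) ltac:(lra); lra.
  split => //; rewrite -natr1 mulrDl mul1r.
  by rewrite vE in IH2; lra.
have [_ Hn] := key n (leqnn n).
have nle : heat (u - n%:R * s) 0 <= heat (u / 2) 0.
  apply: heat_antitone; first lra.
  by move: nu; rewrite ler_pdivlMr; [nra|lra].
have hv : 0 <= heat (u + s) 0 by apply: heat_ge0; lra.
have nD : n.+1%:R * D0 <= heat (u / 2) 0 by lra.
have : u / (2 * s) * D0 <= heat (u / 2) 0.
  by apply: le_trans nD; apply: ler_wpM2r => //; exact: ltW.
move=> H; have e : D0 = 2 * (s / u) * (u / (2 * s) * D0) by field; lra.
rewrite e; apply: ler_wpM2l => //; rewrite mulr_ge0// divr_ge0; lra.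
Qed.

Section subadditive.
Variable m : G -> R.
Hypothesis m_ge0 : forall x, 0 <= m x.
Hypothesis m0 : m 0 = 0.
Hypothesis m_par : forall y z, m (y + z) + m (y - z) <= 2 * m y + 2 * m z.

(** The walk makes a Poisson number of jumps of mean [u], and each adds at most
    one mean of [m] under [J] by [tsum_conv_moment]. *)
Lemma heat_moment u : 0 <= u ->
  (\tsum_(x) (heat u x * m x)%:E <= u%:E * \tsum_(x) (J x * m x)%:E)%E.
Proof.
move=> u0; have A0 := scaledE_ge0 u0.
have mn : nng (EFin \o m) by move=> x; rewrite lee_fin.
have H : (\tsum_(x) (cexp (scaledE u) x * (m x)%:E) <=
    (expR u)%:E * \tsum_(x) (scaledE u x * (m x)%:E))%E.
  apply: (@tsum_cexp_moment _ _ (EFin \o m)) => //=.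
  - by rewrite m0.
  - by move=> x; rewrite /scaledE J_even.
  - exact: mass_scaledE.
rewrite [leLHS](_ : _ = (expR (- u))%:E *
    \tsum_(x) (cexp (scaledE u) x * (m x)%:E))%E; last first.
  rewrite -tsumZ; [|by rewrite lee_fin expR_ge0|by nonneg].
  by apply: eq_tsum => x; rewrite EFinM heatE// muleA.
rewrite [leRHS](_ : _ = (expR (- u))%:E * ((expR u)%:E *
    \tsum_(x) (scaledE u x * (m x)%:E)))%E; last first.
  rewrite muleA -EFinM expRN mulVf ?gt_eqF ?expR_gt0// mul1e.
  rewrite -tsumZ//; last by move=> x; rewrite lee_fin mulr_ge0.
  by apply: eq_tsum => x; rewrite /scaledE -!EFinM mulrA.
by apply: lee_wpmul2l => //; rewrite lee_fin expR_ge0.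
Qed.

End subadditive.

Section reflected.
Variables (c : G -> int) (s : G -> G) (e : G).
Hypothesis csE : reflection c s e.
Hypothesis J_refl : forall x, J (s x) = J x.
Variable a : R.
Hypothesis a_ge0 : 0 <= a.
Hypothesis J_lazy : forall x, 0 <= c x ->
  J (x + e) + a * (x + e == 0)%:R <= J x + a * (x == 0)%:R.
Variable M : R.
Hypothesis cJ : forall x, `|c x|%:~R * J x <= M.

(** The simple random walk kernel itself is not unimodal, as it vanishes at the
    origin. Adding mass [a] there makes it so, and only multiplies the
    exponential by a constant. *)
Lemma unimodal_cexp_scaledE u : 0 <= u -> unimodal c s e (cexp (scaledE u)).
Proof.
move=> u0; have A0 := scaledE_ge0 u0.
have ua0 : 0 <= u * a by rewrite mulr_ge0.
pose B := fun x : G => ((u * a)%:E * @delta0 R G x)%E.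
have B0 : nng B by move=> x; apply: mule_ge0; rewrite ?lee_fin//; nonneg.
have uD : unimodal c s e (cexp (fun y => scaledE u y + B y)%E).
  apply: (unimodal_cexp csE); first by nonneg.
  split=> [x|x x0].
    rewrite /scaledE /B J_refl delta0_inv//; [exact: reflectionB csE|].
    exact: reflectionK csE.
  rewrite /scaledE /B /delta0 -!EFinM -!EFinD lee_fin -!mulrA -!mulrDr.
  by apply: ler_wpM2l => //; exact: J_lazy.
have E : cexp (fun y => scaledE u y + B y)%E =
    fun x => ((expR (u * a))%:E * cexp (scaledE u) x)%E.
  rewrite -cexpD// {1}/B cexp_delta0// convC conv_delta0Z//; by nonneg.
move: uD; rewrite E => -[H1 H2]; split.
  have EE (z : \bar R) : (z = (expR (- (u * a)))%:E * ((expR (u * a))%:E * z))%E.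
    by rewrite muleA -EFinM expRN mulVf ?gt_eqF ?expR_gt0// mul1e.
  by move=> x; rewrite [LHS]EE H1 -EE.
move=> x x0; have := H2 x x0; rewrite lee_pmul2l ?lte_fin ?expR_gt0//.
Qed.

Lemma heat_mono u x : 0 <= u -> 0 <= c x -> heat u (x + e) <= heat u x.
Proof.
move=> u0 x0; rewrite -lee_fin !heatE//; apply: lee_wpmul2l.
  by rewrite lee_fin expR_ge0.
exact: (unimodal_cexp_scaledE u0).2.
Qed.

Lemma heat_refl u x : 0 <= u -> heat u (s x) = heat u x.
Proof.
move=> u0; apply: heat_inv => //; [exact: reflectionB csE|].
exact: reflectionK csE.
Qed.

Lemma heat_line u x k : 0 <= u -> `|c x| <= `|c x + k| ->
  heat u (x + e *~ k) <= heat u x.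
Proof.
move=> u0 xk; rewrite -lee_fin !heatE//; apply: lee_wpmul2l.
  by rewrite lee_fin expR_ge0.
exact: (unimodal_line csE (unimodal_cexp_scaledE u0)).
Qed.

(** Differences of [p_u] between a point and a mirror image of it, weighted by
    [J], are controlled by the value at [x]; this is the source of all upper
    bounds on ratios of values of [p_u]. *)
Lemma heat_reflected_drift u (F : seq G) x : 0 <= u -> 0 <= c x -> uniq F ->
  (forall y, y \in F -> 0 < c y) ->
  u * \sum_(y <- F) (c y)%:~R * J y * (heat u (x - y) - heat u (x - s y)) <=
  (c x)%:~R * heat u x.
Proof.
move=> u0 x0 uF Fc; have A0 := scaledE_ge0 u0.
have mono y : y \in F -> heat u (x - s y) <= heat u (x - y).
  move=> /Fc cy.
  have -> : x - s y = x - y + e *~ (2 * c y).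
    by rewrite (reflectionE csE) opprD opprK addrA.
  by apply: heat_line => //; rewrite (reflection_coordB csE); lia.
pose d y := ((expR u) * Num.max 0
   (u * (c y)%:~R * J y * (heat u (x - y) - heat u (x - s y))))%:E.
have d0 : nng d by move=> y; rewrite lee_fin mulr_ge0 ?expR_ge0// le_max lexx.
have cE y : cexp (scaledE u) y = (expR u * heat u y)%:E.
  by rewrite EFinM heatE// muleA -EFinM expRN mulfV ?gt_eqF ?expR_gt0// mul1e.
have wM y : (wabs R c y * scaledE u y <= (u * M)%:E)%E.
  rewrite /wabs /wpos /wneg /scaledE -EFinD -rmorphD/= -EFinM lee_fin mulrCA.
  apply: ler_wpM2l => //; apply: le_trans (cJ y).
  by apply: ler_wpM2r => //; rewrite ler_int; lia.
have := @reflected_drift R G c s e csE (scaledE u) u (u * M) F d x A0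
  (mass_scaledE u0) wM _ (unimodal_cexp_scaledE u0) x0 uF d0.
have Js y : scaledE u (s y) = scaledE u y by rewrite /scaledE J_refl.
have dE y : y \in F -> d y = (expR u * (u * ((c y)%:~R * J y *
     (heat u (x - y) - heat u (x - s y)))))%:E.
  move=> yF; rewrite /d max_r ?mulrA//.
  rewrite !mulr_ge0 ?subr_ge0//; [|exact: mono].
  by rewrite ler0z; apply/ltW/Fc.
move=> /(_ Js) H.
rewrite mulr_sumr -(ler_pM2l (expR_gt0 u)) mulr_sumr -lee_fin -sumEFin.
rewrite big_seq; under eq_bigr => y yF do rewrite -dE//.
rewrite -big_seq; apply: le_trans (H _) _.
  move=> y yF; split; first exact: Fc.
  rewrite dE// !cE /scaledE -!EFinM -EFinD lee_fin le_eqVlt; apply/orP; left.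
  by apply/eqP; ring.
by rewrite cE -EFinM lee_fin mulrCA.
Qed.

End reflected.

End heat_kernel.

(** * The logarithmic bound for the simple random walk *)

(** Inequality (2) above. Positivity of the heat kernel comes with it, since
    the logarithm takes the value 0 on nonpositive reals. *)
Definition log_bound (R : realType) (G : zmodType) (J : G -> R) (K : R) :=
  forall s u, 0 < s -> s <= u -> (forall x, 0 < heat J u x) /\
    (\tsum_(x) (heat J s x * ln (heat J u 0 / heat J u x))%:E <= (K * (s / u))%:E)%E.

Section log_bound_tools.
Variables (R : realType) (G : zmodType) (J : G -> R).
Hypothesis J_ge0 : forall x, 0 <= J x.
Hypothesis J_mass : \tsum_(x) (J x)%:E = 1%E.
Hypothesis J_even : forall x, J (- x) = J x.

Lemma heat_gt0_0 u : 0 <= u -> 0 < heat J u 0.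
Proof.
move=> u0; rewrite lt_neqAle heat_ge0// andbT; apply/negP => /eqP h0.
have := heat_mass J_ge0 J_mass u0; rewrite tsum0.
  by move=> /eqP; rewrite eq_sym onee_eq0.
move=> x; congr EFin; apply/eqP; rewrite eq_le heat_ge0// andbT h0.
exact: heat_le0.
Qed.

End log_bound_tools.

Section srw.
Variables (R : realType) (d : nat).
Local Notation G := 'rV[int]_d.
Local Notation J := (@srw_kernel R d).

Definition coord (i : 'I_d) (x : G) : int := x ord0 i.
Definition unit_vec (i : 'I_d) : G := delta_mx ord0 i.
Definition flip (i : 'I_d) (x : G) : G := x - unit_vec i *~ (2 * coord i x).

Lemma eq_row (x y : G) : (forall j, x ord0 j = y ord0 j) -> x = y.
Proof. by move=> xy; apply/rowP => j; exact: xy. Qed.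

Lemma rowB (x y : G) j : (x - y) ord0 j = x ord0 j - y ord0 j.
Proof. by rewrite !mxE. Qed.

Lemma rowD (x y : G) j : (x + y) ord0 j = x ord0 j + y ord0 j.
Proof. by rewrite !mxE. Qed.

Lemma mulrz_rowE (x : G) k i : (x *~ k) ord0 i = x ord0 i * k.
Proof.
case: k => n.
  by rewrite -pmulrn mulmxnE -[Posz n]natz mulr_natr.
by rewrite NegzE mulrNz mxE -pmulrn mulmxnE mulrN -[Posz n.+1]natz mulr_natr.
Qed.

Lemma flipE i x j : flip i x ord0 j = if j == i then - x ord0 i else x ord0 j.
Proof.
rewrite /flip !mxE mulrz_rowE mxE eqxx /=; case: eqP => [->|_].
  by rewrite mul1r /coord mulrDl mul1r opprD addrA subrr add0r.
by rewrite mul0r subr0.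
Qed.

Lemma flip_reflection i : reflection (coord i) (flip i) (unit_vec i).
Proof.
split => //.
- by move=> x y; rewrite /coord rowB.
- move=> x y; apply: eq_row => j; rewrite flipE [(flip i x - flip i y) _ _]rowB !flipE !rowB.
  by case: ifP => // _; rewrite opprB opprK addrC.
- move=> x; apply: eq_row => j; rewrite !flipE eqxx opprK.
  by case: eqP => // ->.
- by rewrite /coord mxE !eqxx.
Qed.

Definition l1 (x : G) : int := \sum_(i < d) `|x ord0 i|.

Lemma l1_ge0 x : 0 <= l1 x.
Proof. by apply: sumr_ge0. Qed.

Lemma coord_le_l1 (i : 'I_d) (x : G) : `|x ord0 i| <= l1 x.
Proof. by rewrite /l1 (bigD1 i)//= lerDl; apply: sumr_ge0. Qed.

Lemma l1_eq0 x : l1 x = 0 -> x = 0.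
Proof.
move=> x0; apply: eq_row => i; rewrite mxE; apply/eqP.
by rewrite -normr_eq0 eq_le normr_ge0 andbT -x0 coord_le_l1.
Qed.

Lemma srw_ge0 x : 0 <= J x.
Proof. by rewrite /srw_kernel; case: ifP => // _; rewrite invr_ge0 mulr_ge0. Qed.

Lemma srw_even x : J (- x) = J x.
Proof.
rewrite /srw_kernel; congr (if _ == _ then _ else _).
by apply: eq_bigr => i _; rewrite mxE normrN.
Qed.

Lemma srw_flip i x : J (flip i x) = J x.
Proof.
rewrite /srw_kernel; congr (if _ == _ then _ else _).
by apply: eq_bigr => j _; rewrite flipE; case: eqP => // ->; rewrite normrN.
Qed.

Lemma l1_shift (i : 'I_d) (x : G) : l1 (x + unit_vec i) = l1 x - `|x ord0 i| + `|x ord0 i + 1|.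
Proof.
rewrite /l1 (bigD1 i)//= [in RHS](bigD1 i)//=.
rewrite (eq_bigr (fun j => `|x ord0 j|)) => [|j ji].
  by rewrite !mxE !eqxx/= addrC; congr (_ + _); rewrite addrAC subrr add0r.
by rewrite !mxE eqxx/= (negbTE ji) addr0.
Qed.

Lemma srw_unit i : J (unit_vec i) = (2 * d%:R)^-1.
Proof.
rewrite /srw_kernel -[\sum_(j < d) _]/(l1 (unit_vec i)) -[unit_vec i]add0r l1_shift.
by rewrite /l1 big1 ?mxE// => j _; rewrite mxE.
Qed.

Lemma srw_lazy i x : 0 <= coord i x ->
  J (x + unit_vec i) + 1 * (x + unit_vec i == 0)%:R <= J x + 1 * (x == 0)%:R.
Proof.
move=> x0; rewrite [(_ + _ == 0)](_ : _ = false) ?mulr0 ?addr0; last first.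
  apply/eqP => /(congr1 (fun z : G => z ord0 i)); rewrite !mxE !eqxx /= => h.
  by move: x0; rewrite /coord; lia.
have [->|xn0] := eqVneq x 0.
  rewrite add0r srw_unit mul1r.
  have d0 : (0 < d)%N by apply: leq_ltn_trans (ltn_ord i).
  apply: (@le_trans _ _ 1); last by rewrite lerDr srw_ge0.
  rewrite invf_le1; last by rewrite mulr_gt0// ltr0n.
  by rewrite -natrM ler1n muln_gt0.
rewrite mulr0 addr0 {1}/srw_kernel -/(l1 _) l1_shift.
case: eqP => [l1x|_]; last exact: srw_ge0.
have : l1 x = 0 by move: x0 l1x (l1_ge0 x); rewrite /coord; lia.
by move=> /l1_eq0 x00; rewrite x00 eqxx in xn0.
Qed.

Lemma srw_coord i x : `|coord i x|%:~R * J x <= 1.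
Proof.
rewrite /srw_kernel -/(l1 _); case: eqP => [l1x|_]; last by rewrite mulr0.
have d0 : (0 < d)%N by apply: leq_ltn_trans (ltn_ord i).
rewrite ler_pdivrMr ?mulr_gt0 ?ltr0n// mul1r.
apply: (@le_trans _ _ 1); last by rewrite -natrM ler1n muln_gt0.
by rewrite -[1](@mulr1z R) ler_int -l1x coord_le_l1.
Qed.

Definition sqnorm (x : G) : R := \sum_(i < d) (x ord0 i)%:~R ^+ 2.

Hypothesis J_mass : \tsum_(x) (J x)%:E = 1%E.

(** A walk from [x] to the origin along unit steps, one coordinate at a time:
    each step multiplies [p_u] by at most [1 + 2 d x_i / u], and the exponents
    add up to less than [2 d |x|^2 / u]. *)
Lemma srw_heat_ratio u x : 0 < u ->
  heat J u 0 <= heat J u x * expR (2 * d%:R / u * sqnorm x).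
Proof.
move=> u0; have uge0 := ltW u0.
have hpos := heat_ge0 srw_ge0.
move: {2}`|l1 x|%N (erefl `|l1 x|%N) => n; elim: n x => [|n IH] x xn.
  have -> : x = 0 by apply: l1_eq0; apply/eqP; rewrite -absz_eq0 xn.
  rewrite /sqnorm big1 ?mulr0 ?expR0 ?mulr1// => i _.
  by rewrite mxE expr0n.
have [i xi] : exists i, x ord0 i != 0.
  apply/not_existsP => H; move: xn; rewrite /l1 big1// => j _.
  by have /negP := H j; rewrite negbK => /eqP ->; rewrite normr0.
have d0 : (0 < d)%N by apply: leq_ltn_trans (ltn_ord i).
wlog xi0 : x xn xi / 0 < x ord0 i.
  move=> H; have [|xneg] := ltP 0 (x ord0 i); first exact: H.
  have fi : flip i x ord0 i = - x ord0 i by rewrite flipE eqxx.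
  have E (T : pzRingType) (F : int -> T) : (forall k, F (- k) = F k) ->
      \sum_(j < d) F (flip i x ord0 j) = \sum_(j < d) F (x ord0 j).
    move=> FN; apply: eq_bigr => j _; rewrite flipE.
    by case: eqP => // ->; rewrite FN.
  have -> : sqnorm x = sqnorm (flip i x).
    by rewrite /sqnorm (E _ (fun k => k%:~R ^+ 2))// => k; rewrite mulrNz sqrrN.
  rewrite -(heat_refl srw_ge0 (flip_reflection i) (srw_flip i) x uge0).
  apply: H.
  - by rewrite -xn /l1 (E _ (fun k => `|k|))// => k; rewrite normrN.
  - by rewrite fi oppr_eq0.
  - by rewrite fi oppr_gt0 lt_neqAle xi.
have step : heat J u (x - unit_vec i) <=
    heat J u x * (1 + 2 * d%:R / u * (x ord0 i)%:~R).
  have := @heat_reflected_drift R G J srw_ge0 J_mass _ _ _ (flip_reflection i)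
    (srw_flip i) 1 ler01 (@srw_lazy i) 1 (srw_coord i) u [:: unit_vec i] x uge0.
  rewrite /coord ltW// => /(_ isT isT) H.
  have {}H : u * (1 / (2 * d%:R) * (heat J u (x - unit_vec i) -
      heat J u (x + unit_vec i))) <= (x ord0 i)%:~R * heat J u x.
    apply: le_trans (H _); last first.
      by move=> y; rewrite inE => /eqP ->; rewrite mxE !eqxx.
    rewrite big_seq1 srw_unit !mxE !eqxx.
    have -> // : x - flip i (unit_vec i) = x + unit_vec i.
    by rewrite /flip /coord mxE !eqxx mulr1 mulrz_nat mulr2n opprB addrK.
  have hm := heat_mono srw_ge0 J_mass (flip_reflection i) (srw_flip i) ler01
    (@srw_lazy i) uge0 (ltW xi0 : 0 <= coord i x).
  have d0' : 0 < 2 * d%:R :> R by rewrite mulr_gt0// ltr0n.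
  have {}H : heat J u (x - unit_vec i) - heat J u (x + unit_vec i) <=
      (2 * d%:R) / u * ((x ord0 i)%:~R * heat J u x).
    rewrite [leRHS]mulrAC ler_pdivlMr// mulrC.
    have := ler_wpM2l (ltW d0') H.
    rewrite [X in X <= _](_ : _ = u * (heat J u (x - unit_vec i) -
      heat J u (x + unit_vec i)))//.
    by field; rewrite pnatr_eq0 -lt0n.
  lra.
apply: le_trans (IH (x - unit_vec i) _) _.
  have := l1_shift i (x - unit_vec i); rewrite subrK rowB mxE !eqxx /= mulr1n subrK.
  move: xn xi0 (l1_ge0 x) (l1_ge0 (x - unit_vec i)).
  by move: (l1 x) (l1 _) (x ord0 i) => a b k; lia.
have -> : sqnorm (x - unit_vec i) = sqnorm x + 1 - 2 * (x ord0 i)%:~R.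
  rewrite /sqnorm (bigD1 i)//= [in RHS](bigD1 i)//=.
  rewrite (eq_bigr (fun j => (x ord0 j)%:~R ^+ 2)) => [|j ji].
    by rewrite rowB mxE !eqxx /= mulr1n rmorphB/=; ring.
  by rewrite rowB mxE eqxx/= (negbTE ji) subr0.
set k := (x ord0 i)%:~R; have k1 : 1 <= k by rewrite -[1](@mulr1z R) ler_int.
set t := 2 * d%:R / u in step *.
have t0 : 0 <= t by rewrite /t divr_ge0// mulr_ge0.
apply: (@le_trans _ _ (heat J u x * (1 + t * k) * expR (t * (sqnorm x + 1 - 2 * k)))).
  by apply: ler_wpM2r; rewrite ?expR_ge0.
rewrite -mulrA; apply: ler_wpM2l; first exact: hpos.
apply: (@le_trans _ _ (expR (t * k) * expR (t * (sqnorm x + 1 - 2 * k)))).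
  by apply: ler_wpM2r; rewrite ?expR_ge0// expR_ge1Dx.
by rewrite -expRD ler_expR -mulrDr; apply: ler_wpM2l => //; lra.
Qed.

(** [srw_heat_ratio] bounds the logarithm by a quadratic function, whose mean
    under [p_s] is at most that of [s] jumps of length 1. *)
Lemma srw_log_bound : log_bound J (2 * d%:R).
Proof.
move=> s u s0 su; have u0 := lt_le_trans s0 su.
have h0 := heat_gt0_0 srw_ge0 J_mass srw_even (ltW u0).
have hx x : 0 < heat J u x.
  have := lt_le_trans h0 (srw_heat_ratio x u0).
  by rewrite pmulr_lgt0 ?expR_gt0.
split=> //.
have sq0 x : 0 <= sqnorm x by apply: sumr_ge0 => i _; exact: sqr_ge0.
have t0 : 0 <= 2 * d%:R / u :> R by rewrite divr_ge0 ?mulr_ge0// ltW.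
apply: (@le_trans _ _ (\tsum_(x) ((2 * d%:R / u)%:E * (heat J s x * sqnorm x)%:E)))%E.
  apply: le_tsum => x; rewrite -EFinM lee_fin mulrCA.
  apply: ler_wpM2l; first by apply: (heat_ge0 srw_ge0); exact: ltW.
  rewrite -[leRHS]expRK ler_ln ?posrE ?divr_gt0 ?expR_gt0//.
  by rewrite ler_pdivrMr// mulrC srw_heat_ratio.
rewrite tsumZ//; last first.
  move=> x; rewrite lee_fin mulr_ge0//.
  by apply: (heat_ge0 srw_ge0); exact: ltW.
rewrite [(2 * d%:R * (s / u))%R](_ : _ = 2 * d%:R / u * s); last by ring.
rewrite [leRHS]EFinM; apply: lee_wpmul2l; first by rewrite lee_fin.
apply: le_trans (heat_moment srw_ge0 J_mass srw_even sq0 _ _ (ltW s0)) _.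
- by rewrite /sqnorm big1// => i _; rewrite mxE expr0n.
- move=> y z; rewrite /sqnorm !mulr_sumr -!big_split/=; apply: ler_sum => i _.
  by rewrite rowD rowB rmorphD rmorphB/=; lra.
rewrite -[leRHS]mule1; apply: lee_wpmul2l; first by rewrite lee_fin ltW.
rewrite -J_mass; apply: le_tsum => x; rewrite lee_fin.
rewrite -[leRHS]mulr1 /srw_kernel -/(l1 _); case: eqP => [l1x|_]; last by rewrite !mul0r.
apply: ler_wpM2l; first by rewrite invr_ge0 mulr_ge0.
have E1 : 1 = \sum_(i < d) `|x ord0 i|%:~R :> R.
  by transitivity ((l1 x)%:~R : R); [rewrite l1x|rewrite /l1 rmorph_sum].
rewrite [leRHS]E1; apply: ler_sum => i _.
rewrite -rmorphXn/= ler_int; have := coord_le_l1 i x; rewrite l1x.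
by move: (x ord0 i) => k k1; rewrite expr2; nia.
Qed.

End srw.

(** * The logarithmic bound from dyadic scales *)

Section geometric.
Variable R : realType.
Implicit Types a : nat -> R.

(** If the ratios are eventually bounded away from 1, a tail is comparable with
    its first term; the finitely many initial indices only affect the constant.
    *)
Lemma geometric_tail a (t : R) i0 : (forall i, 0 < a i) -> 0 <= t < 1 ->
  (forall i, (i0 <= i)%N -> a i.+1 <= t * a i) ->
  exists2 C, 0 < C & forall j n, \sum_(k < n) a (j + k)%N <= C * a j.
Proof.
move=> + /andP[t0 t1]; elim: i0 a => [|i0 IH] a a0 at_.
  exists (1 - t)^-1; first by rewrite invr_gt0 subr_gt0.
  move=> j n; elim: n j => [|n IH] j.
    by rewrite big_ord0 mulr_ge0 ?invr_ge0 ?subr_ge0// ltW.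
  rewrite big_ord_recl addn0.
  under eq_bigr do rewrite lift0 addnS -addSn.
  apply: le_trans (lerD (lexx _) (IH j.+1)) _.
  rewrite ler_pdivlMl ?subr_gt0//.
  have := at_ j isT; have -> : (1 - t) * (a j + (1 - t)^-1 * a j.+1) =
    (1 - t) * a j + a j.+1 by field; lra.
  lra.
have [C C0 HC] := IH (fun i => a i.+1) (fun i => a0 i.+1) (fun i => at_ i.+1).
have aa0 : 0 < C * (a 1%N / a 0%N) by rewrite mulr_gt0//; exact: divr_gt0.
exists (C + 1 + C * (a 1%N / a 0%N)); first by lra.
have L j : C * a j <= (C + 1 + C * (a 1%N / a 0%N)) * a j.
  by apply: ler_wpM2r; [exact: ltW|lra].
case=> [|j] n; last first.
  apply: le_trans (L j.+1); apply: le_trans (HC j n).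
  by rewrite le_eqVlt; apply/orP; left; apply/eqP/eq_bigr => k _; rewrite addSn.
case: n => [|n]; first by rewrite big_ord0 mulr_ge0 ?addr_ge0 ?(ltW C0) ?(ltW aa0) ?(ltW (a0 _)).
rewrite big_ord_recl addn0.
have := HC 0%N n; under eq_bigr do rewrite add0n; move=> H.
have e : C * (a 1%N / a 0%N) * a 0%N = C * a 1%N.
  by rewrite -mulrA divfK// gt_eqF.
rewrite !mulrDl e mul1r.
have := mulr_gt0 C0 (a0 0%N); lra.
Qed.

Lemma geometric_head a (t : R) i0 : (forall i, 0 < a i) -> 1 < t ->
  (forall i, (i0 <= i)%N -> t * a i <= a i.+1) ->
  exists2 C, 0 < C & forall j, \sum_(k < j.+1) a k <= C * a j.
Proof.
move=> + t1; elim: i0 a => [|i0 IH] a a0 at_.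
  exists (t / (t - 1)); first by rewrite divr_gt0//; lra.
  elim=> [|j IH].
    rewrite big_ord1 ler_peMl ?(ltW (a0 _))// ler_pdivlMr; lra.
  rewrite big_ord_recr /=; apply: le_trans (lerD IH (lexx _)) _.
  have H := at_ j isT; have tt : 0 < t - 1 by lra.
  rewrite -(ler_pM2l tt).
  have -> : (t - 1) * (t / (t - 1) * a j + a j.+1) = t * a j + (t - 1) * a j.+1.
    by field; lra.
  have -> : (t - 1) * (t / (t - 1) * a j.+1) = t * a j.+1 by field; lra.
  lra.
have [C C0 HC] := IH (fun i => a i.+1) (fun i => a0 i.+1) (fun i => at_ i.+1).
have q0 : 0 < a 0%N / a 1%N by rewrite divr_gt0.
exists (C + 1 + C * (a 0%N / a 1%N)).
  by have := mulr_gt0 C0 q0; lra.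
case=> [|j].
  rewrite big_ord1 ler_peMl ?(ltW (a0 _))//.
  by have := mulr_gt0 C0 q0; lra.
rewrite big_ord_recl; under eq_bigr do rewrite lift0.
have a1j : a 1%N <= C * a j.+1.
  apply: le_trans (HC j); rewrite big_ord_recl lerDl.
  by apply: sumr_ge0 => k _; exact: ltW.
have : a 0%N <= C * (a 0%N / a 1%N) * a j.+1.
  have := ler_wpM2l (ltW q0) a1j; rewrite divfK ?gt_eqF//; lra.
have := HC j; have := a0 j.+1; lra.
Qed.

End geometric.

Lemma tsum_nat_le (R : realType) (f : nat -> R) (M : R) : (forall n, 0 <= f n) ->
  (forall n, \sum_(k < n) f k <= M) -> (\tsum_(n) (f n)%:E <= M%:E)%E.
Proof.
move=> f0 fM; rewrite tsum_nat//; apply: lime_le.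
  by apply: is_cvg_nneseries => n _; rewrite lee_fin.
by apply: nearW => n; rewrite big_mkord sumEFin lee_fin.
Qed.

Section dyadic.
Variables (R : realType) (J : int -> R).
Hypothesis J_gt0 : forall x, 0 < J x.
Hypothesis J_mass : \tsum_(x) (J x)%:E = 1%E.
Hypothesis J_mono : forall x y : int, `|x| <= `|y| -> J y <= J x.

Let J_ge0 x : 0 <= J x. Proof. exact: ltW. Qed.

Let J_even x : J (- x) = J x.
Proof. by apply/eqP; rewrite eq_le !J_mono ?normrN. Qed.

(** Comparable with the mass that [J] gives to the annulus at scale [2^i]. *)
Definition dyad (i : nat) : R := 2 ^+ i * J (2 ^ i)%N%:Z.

Lemma dyad_gt0 i : 0 < dyad i.
Proof. by rewrite mulr_gt0// exprn_gt0. Qed.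

(** At least [|x|] points carry as much mass as [x], and the total mass is 1.
    *)
Lemma int_coord x : `|x|%:~R * J x <= 1.
Proof.
rewrite -lee_fin -J_mass.
pose F := [seq k%:Z | k <- iota 0 `|x|%N].
have uF : uniq F by rewrite map_inj_uniq ?iota_uniq// => i j [].
apply: le_trans (tsum_ge_fin _ uF) => [|y]; last by rewrite lee_fin.
rewrite sumEFin lee_fin big_map.
apply: (@le_trans _ _ (\sum_(k <- iota 0 `|x|%N) J x)).
  rewrite big_const_seq count_predT size_iota iter_addr addr0 -mulr_natl.
  by rewrite -abszE.
rewrite big_seq [leRHS]big_seq; apply: ler_sum => k; rewrite mem_iota => /andP[_].
by rewrite add0n => kx; apply: J_mono; rewrite -[`|x|]abszE; lia.
Qed.

Lemma int_reflection : reflection (fun x : int => x) -%R 1.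
Proof.
split=> //.
- by move=> x y; rewrite opprD.
- exact: opprK.
- by move=> x; rewrite -mulrzr mul1r intz mulrDl mul1r opprD addrA subrr add0r.
Qed.

Let J_lazy (x : int) : 0 <= x ->
  J (x + 1) + 0 * (x + 1 == 0)%:R <= J x + 0 * (x == 0)%:R.
Proof. by move=> x0; rewrite !mul0r !addr0; apply: J_mono; lia. Qed.

Lemma heat_le (u : R) (x y : int) : 0 <= u -> `|x| <= `|y| ->
  heat J u y <= heat J u x.
Proof.
move=> u0 xy.
have := heat_line J_ge0 J_mass int_reflection J_even (lexx 0) J_lazy u0 (x := x) (k := y - x).
by rewrite mulrzz mul1r subrKC; apply.
Qed.

(** [heat_reflected_drift] at [x = 2^(i+1)], keeping the points [y] in [[2^i, 3
    2^i[]: there [|x - y| <= 2^i] and [x + y >= x], and [J y] is at least [J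
    (2^(i+2))]. *)
Lemma heat_step_dyad (u : R) i : 0 <= u ->
  u * dyad i.+2 * (heat J u (2 ^ i)%N%:Z - heat J u (2 ^ i.+1)%N%:Z) <=
  4 * heat J u (2 ^ i.+1)%N%:Z.
Proof.
move=> u0; set x := (2 ^ i.+1)%N%:Z.
pose F := [seq (2 ^ i + k)%N%:Z | k <- iota 0 (2 ^ i.+1)].
have uF : uniq F by rewrite map_inj_uniq ?iota_uniq// => a b [] /addnI.
have p2 : (0 < 2 ^ i)%N by rewrite expn_gt0.
have := heat_reflected_drift J_ge0 J_mass int_reflection J_even (lexx 0) J_lazy
  int_coord u0 (isT : 0 <= x) uF.
move=> H; have {H} := H _.
move=> H; have {}H : u * \sum_(y <- F) y%:~R * J y *
    (heat J u (x - y) - heat J u (x - - y)) <= x%:~R * heat J u x.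
  by apply: H => y /mapP[k _ ->]; lia.
have D0 : 0 <= heat J u (2 ^ i)%N%:Z - heat J u x.
  by rewrite subr_ge0; apply: heat_le => //; rewrite /x expnS; lia.
have {}H : u * \sum_(y <- F) ((2 ^+ i * J (2 ^ i.+2)%N%:Z) *
    (heat J u (2 ^ i)%N%:Z - heat J u x)) <= x%:~R * heat J u x.
  apply: le_trans H; apply: ler_wpM2l => //.
  rewrite big_seq [leRHS]big_seq; apply: ler_sum => y /mapP[k].
  rewrite mem_iota add0n => /andP[_ kx] ->{y}.
  apply: ler_pM => //; first by rewrite mulr_ge0// exprn_ge0.
    apply: ler_pM => //.
      by rewrite -natrX -pmulrn ler_nat leq_addr.
    by apply: J_mono; rewrite !expnS in kx *; lia.
  apply: lerB; apply: heat_le => //; rewrite /x !expnS in kx *; lia.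
move: H; rewrite big_const_seq count_predT size_map size_iota iter_addr addr0.
rewrite -[_ *+ (2 ^ i.+1)%N]mulr_natl natrX => H.
have xE : x%:~R = 2 ^+ i.+1 :> R by rewrite /x -pmulrn natrX.
rewrite xE in H.
have p0 : 0 < 2 ^+ i.+1 :> R by rewrite exprn_gt0.
rewrite -(ler_pM2l p0) /dyad; move: H; rewrite !exprS; lra.
Qed.

Local Notation h := dyad.
Local Notation rt i := (Num.sqrt (dyad i)).
Let h_gt0 i : 0 < h i := dyad_gt0 i.
Let rt_gt0 i : 0 < rt i. Proof. by rewrite sqrtr_gt0. Qed.
Let rtrt i : rt i * rt i = h i.
Proof. by rewrite -expr2 sqr_sqrtr// ltW. Qed.

Let heat_ge0 u x : 0 <= u -> 0 <= heat J u x := fun u0 => heat_ge0 J_ge0 x u0.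

Lemma heat_step0 (u : R) : 0 <= u -> u * h 0 * (heat J u 0 - heat J u 1) <= heat J u 1.
Proof.
move=> u0.
have := heat_reflected_drift J_ge0 J_mass int_reflection J_even (lexx 0) J_lazy
  int_coord u0 (isT : 0 <= 1 :> int) (isT : uniq [:: 1 : int]).
move=> H; have {H} := H _; rewrite big_seq1 subrr opprK.
move=> H; have {}H : u * (1%:~R * J 1 * (heat J u 0 - heat J u (1 + 1))) <=
  1%:~R * heat J u 1 by apply: H => y; rewrite inE => /eqP ->.
rewrite mulr1z !mul1r in H; rewrite /dyad expr0 mul1r; apply: le_trans H.
rewrite mulrA; apply: ler_wpM2l; first by rewrite mulr_ge0.
by rewrite lerD2l lerN2; apply: heat_le.
Qed.

(** Turns a ratio [1 + 4 z^2] into the exponential of [4 z]; with [z = (u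
    h_i)^(-1/2)] the exponents form a geometric series in [i]. *)
Lemma quadratic_le_expR (z : R) : 0 <= z -> 1 + 4 * (z * z) <= expR (4 * z).
Proof.
move=> z0; have := expR_ge1Dx (2 * z).
have -> : 4 * z = 2 * z + 2 * z by ring.
rewrite expRD => H; have z1 : 0 <= 1 + 2 * z by lra.
by have := ler_pM z1 z1 H H; nra.
Qed.

Lemma ratio_expR (w A a b : R) (z : R) : 0 < w -> 0 < A -> 0 <= b -> 0 <= z ->
  w * A * (a - b) <= 4 * b -> z * z * (w * A) = 1 -> a <= b * expR (4 * z).
Proof.
move=> w0 A0 b0 z0 H zE.
apply: le_trans (ler_wpM2l b0 (quadratic_le_expR z0)).
have wA : 0 < w * A by rewrite mulr_gt0.
rewrite -(ler_pM2l wA).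
have -> : w * A * (b * (1 + 4 * (z * z))) = w * A * b + 4 * b * (z * z * (w * A)) by ring.
by rewrite zE mulr1; lra.
Qed.

Let zE u i : 0 < u -> ((Num.sqrt u * rt i)^-1 * (Num.sqrt u * rt i)^-1) * (u * h i) = 1.
Proof.
move=> u0; have -> : u * h i = (Num.sqrt u * rt i) * (Num.sqrt u * rt i).
  by rewrite mulrACA rtrt -expr2 sqr_sqrtr// ltW.
by rewrite mulrACA mulVf ?mulr1// mulf_neq0// gt_eqF ?sqrtr_gt0.
Qed.

Let z_ge0 u i : 0 <= (Num.sqrt u * rt i)^-1.
Proof. by rewrite invr_ge0 mulr_ge0 ?sqrtr_ge0. Qed.

(** The product over scales of the ratios given by [heat_step_dyad]. *)
Lemma heat_ratio_dyad u j : 0 < u -> heat J u 0 <=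
  heat J u (2 ^ j)%N%:Z * expR (\sum_(k < j.+2) 4 * (Num.sqrt u * rt k)^-1).
Proof.
move=> u0; elim: j => [|j IH].
  have H := heat_step0 (ltW u0).
  have b0 := heat_ge0 1 (ltW u0).
  apply: (@le_trans _ _ (heat J u 1 * expR (4 * (Num.sqrt u * rt 0)^-1))).
    apply: (ratio_expR u0 (h_gt0 0) b0 (z_ge0 _ _)); last exact: zE.
    lra.
  apply: ler_wpM2l => //; rewrite ler_expR big_ord_recl/= lerDl.
  by apply: sumr_ge0 => k _; rewrite mulr_ge0.
have b0 := heat_ge0 (2 ^ j.+1)%N%:Z (ltW u0).
have H := heat_step_dyad j (ltW u0).
apply: le_trans IH _; rewrite [in leRHS]big_ord_recr/= expRD [leRHS]mulrA [leRHS]mulrAC.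
apply: ler_wpM2r; first exact: expR_ge0.
exact: (ratio_expR u0 (h_gt0 _) b0 (z_ge0 _ _) H (zE _ _)).
Qed.

Variable C : R.
Hypothesis C_gt0 : 0 < C.
Hypothesis S1 : forall j n, \sum_(k < n) h (j + k)%N <= C * h j.
Hypothesis S2 : forall j, \sum_(k < j.+1) 2 ^+ k * h k <= C * (2 ^+ j * h j).
Hypothesis S4 : forall j, \sum_(k < j.+1) (rt k)^-1 <= C * (rt j)^-1.
Hypothesis S5 : forall j n, \sum_(k < n) rt (j + k)%N <= C * rt j.

(** [S2] includes the statement that [h] decreases by at most a constant factor
    from one scale to the next. *)
Lemma dyad_le_next i : h i <= 2 * C * h i.+1.
Proof.
have p0 : 0 < 2 ^+ i :> R by rewrite exprn_gt0.
rewrite -(ler_pM2l p0).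
have -> : 2 ^+ i * (2 * C * h i.+1) = C * (2 ^+ i.+1 * h i.+1) by rewrite exprS; ring.
apply: le_trans (S2 i.+1); rewrite big_ord_recr big_ord_recr /=.
rewrite -addrA addrCA lerDl addr_ge0//.
  by apply: sumr_ge0 => k _; rewrite mulr_ge0 ?exprn_ge0// ltW.
by rewrite mulr_ge0 ?exprn_ge0// ltW.
Qed.

Let c2 := Num.sqrt (2 * C).
Let c2_ge0 : 0 <= c2. Proof. exact: sqrtr_ge0. Qed.

Lemma rt_inv_next i : (rt i.+1)^-1 <= c2 * (rt i)^-1.
Proof.
have : rt i <= c2 * rt i.+1.
  by rewrite /c2 -sqrtrM ?mulr_ge0 ?(ltW C_gt0)// ler_wsqrtr// dyad_le_next.
by rewrite ler_pdivlMr// ler_pdivrMl// [_ * c2]mulrC.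
Qed.

Let B := 4 * C * c2.
Let B_ge0 : 0 <= B.
Proof. by rewrite !mulr_ge0// ltW. Qed.

Lemma heat_ratio u j x : 0 < u -> `|x| <= (2 ^ j)%N%:Z ->
  heat J u 0 <= heat J u x * expR (B * (Num.sqrt u * rt j)^-1).
Proof.
move=> u0 xj; apply: le_trans (heat_ratio_dyad j u0) _.
have u0' := ltW u0.
apply: ler_pM => //; [exact: heat_ge0|exact: heat_le|].
rewrite ler_expR.
have -> : \sum_(k < j.+2) 4 * (Num.sqrt u * rt k)^-1 =
    4 * (Num.sqrt u)^-1 * \sum_(k < j.+2) (rt k)^-1.
  by rewrite mulr_sumr; apply: eq_bigr => k _; rewrite invfM mulrA.
have -> : B * (Num.sqrt u * rt j)^-1 =
    4 * (Num.sqrt u)^-1 * (C * (c2 * (rt j)^-1)).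
  by rewrite /B invfM; ring.
apply: ler_wpM2l; first by rewrite mulr_ge0// invr_ge0 sqrtr_ge0.
apply: le_trans (S4 j.+1) _; apply: ler_wpM2l; first exact: ltW.
exact: rt_inv_next.
Qed.

(** A continuous majorant of the indicator of [|x| >= 2^j] that is subadditive,
    as [heat_moment] requires. *)
Definition cutoff (j : nat) (x : int) : R := Num.min 1 (`|x|%:~R / 2 ^+ j).

Lemma cutoff_ge0 j x : 0 <= cutoff j x.
Proof. by rewrite le_min ler01 divr_ge0 ?exprn_ge0// ler0z. Qed.

Lemma cutoff0 j : cutoff j 0 = 0.
Proof. by rewrite /cutoff normr0 mul0r min_r. Qed.

Lemma cutoff_sub j x y z : `|x| <= `|y| + `|z| -> cutoff j x <= cutoff j y + cutoff j z.
Proof.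
move=> H; rewrite /cutoff.
have p0 : 0 < (2 ^+ j)^-1 :> R by rewrite invr_gt0 exprn_gt0.
have : `|x|%:~R / 2 ^+ j <= `|y|%:~R / 2 ^+ j + `|z|%:~R / 2 ^+ j :> R.
  by rewrite -mulrDl ler_pM2r// -rmorphD/= ler_int.
have : 0 <= `|y|%:~R / 2 ^+ j :> R by rewrite mulr_ge0 ?ler0z// ltW.
have : 0 <= `|z|%:~R / 2 ^+ j :> R by rewrite mulr_ge0 ?ler0z// ltW.
move: (`|x|%:~R / _) (`|y|%:~R / _) (`|z|%:~R / _) => a b c b0 c0 abc.
rewrite /Num.min; case: ifP => ?; case: ifP => ?; case: ifP => ?; lra.
Qed.

Lemma cutoff_par j y z :
  cutoff j (y + z) + cutoff j (y - z) <= 2 * cutoff j y + 2 * cutoff j z.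
Proof.
have := @cutoff_sub j (y + z) y z (ler_normD _ _).
have := @cutoff_sub j (y - z) y z (ler_normB _ _); lra.
Qed.

Lemma cutoff1 j x : (2 ^ j)%N%:Z <= `|x| -> cutoff j x = 1.
Proof.
move=> jx; rewrite /cutoff min_l// ler_pdivlMr ?exprn_gt0// mul1r.
by rewrite -natrX pmulrn ler_int.
Qed.

Lemma int_dyadic (x : int) : x != 0 ->
  exists i, ((2 ^ i)%N%:Z <= `|x|) /\ (`|x| <= (2 ^ i.+1)%N%:Z).
Proof.
move=> x0; exists (trunc_log 2 `|x|%N).
have xp : (0 < `|x|)%N by rewrite absz_gt0.
have := trunc_log_bounds (isT : (1 < 2)%N) xp; rewrite -[`|x|%R]abszE.
by move=> /andP[H1 H2]; split; rewrite lez_nat// ltnW.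
Qed.

Definition in_ball (N : nat) (x : int) : R := (`|x| <= N%:Z)%R%:R.

Lemma ball_count (N : nat) :
  (\tsum_(x) (in_ball N x)%:E <= (2 * N%:R + 1 : R)%:E)%E.
Proof.
pose s := [seq k%:Z - N%:Z | k <- iota 0 (2 * N).+1].
rewrite (@tsum_fin _ _ _ s).
- rewrite big_map sumEFin lee_fin.
  apply: (@le_trans _ _ (\sum_(k <- iota 0 (2 * N).+1) 1)).
    by apply: ler_sum => k _; rewrite /in_ball lern1 leq_b1.
  by rewrite big_const_seq count_predT size_iota iter_addr addr0 -[(2 * N).+1%:R]natr1 natrM.
- by move=> x; rewrite lee_fin.
- by rewrite map_inj_uniq ?iota_uniq// => a b /addIr [].
- move=> y ys; have H (x : int) : x \notin s -> in_ball N x = 0; last by rewrite H.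
  move=> xs; rewrite /in_ball (_ : (`|x| <= N%:Z) = false)//; apply/negbTE.
  apply: contra xs => xN; apply/mapP; exists (absz (x + N%:Z)); last by lia.
  by rewrite mem_iota; lia.
Qed.

(** The points of the annulus at scale [i] contribute [h i] times the value of
    the cutoff there; the scales up to [j] are handled by [S2] and the others
    by [S1]. *)
Lemma cutoff_tail j : (\tsum_(x) (J x * cutoff j x)%:E <= (15 * C * h j)%:E)%E.
Proof.
pose b i := J (2 ^ i)%N%:Z * Num.min 1 (2 ^+ i.+1 / 2 ^+ j).
have b0 i : 0 <= b i.
  by rewrite mulr_ge0// le_min ler01 divr_ge0 ?exprn_ge0.
apply: (@le_trans _ _ (\tsum_(x) \tsum_(i)
    (b i * in_ball (2 ^ i.+1) x)%:E))%E.
  apply: le_tsum => x; have [->|x0] := eqVneq x 0.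
    by rewrite cutoff0 mulr0; apply: tsum_ge0 => i; rewrite lee_fin mulr_ge0.
  have [i [ix xi]] := int_dyadic x0.
  apply: le_trans (@tsum_ge1 _ _ _ i _); last first.
    by move=> k; rewrite lee_fin mulr_ge0.
  rewrite /in_ball xi mulr1 lee_fin; apply: ler_pM => //.
  - exact: cutoff_ge0.
  - by apply: J_mono; lia.
  - rewrite /cutoff le_min ge_min lexx /= ge_min; apply/orP; right.
    rewrite ler_pM2r ?invr_gt0 ?exprn_gt0// -natrX pmulrn ler_int//.
rewrite tsum_exchange; last by move=> x i; rewrite lee_fin mulr_ge0.
apply: (@le_trans _ _ (\tsum_(i) (5 * (h i * Num.min 1 (2 ^+ i.+1 / 2 ^+ j)))%:E)%E).
  apply: le_tsum => i.
  rewrite (_ : (\tsum_(x) _) = ((b i)%:E *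
     \tsum_(x) (in_ball (2 ^ i.+1) x)%:E)%E); last first.
    rewrite -tsumZ ?lee_fin//; first by move=> x; rewrite lee_fin.
  apply: le_trans (lee_wpmul2l _ (ball_count _)) _; first by rewrite lee_fin.
  rewrite -EFinM lee_fin /b /dyad natrX.
  have p1 : 1 <= 2 ^+ i :> R by rewrite exprn_ege1 ?ler1n.
  have -> : 5 * (2 ^+ i * J (2 ^ i)%N * Num.min 1 (2 ^+ i.+1 / 2 ^+ j)) =
    b i * (5 * 2 ^+ i) by rewrite /b; ring.
  by rewrite -/(b i); apply: ler_wpM2l => //; rewrite exprS; lra.
have m0 i : 0 <= 5 * (h i * Num.min 1 (2 ^+ i.+1 / 2 ^+ j)).
  apply: mulr_ge0 => //; apply: mulr_ge0; first exact: ltW.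
  by rewrite le_min ler01 divr_ge0 ?exprn_ge0.
apply: tsum_nat_le => // n.
apply: (@le_trans _ _ (\sum_(i < n + j.+1) 5 * (h i * Num.min 1 (2 ^+ i.+1 / 2 ^+ j)))).
  by rewrite big_split_ord /= lerDl; apply: sumr_ge0.
rewrite addnC big_split_ord /=.
have -> : 15 * C * h j = 10 * (C * h j) + 5 * (C * h j) by ring.
have pj : 0 < 2 ^+ j :> R by rewrite exprn_gt0.
apply: lerD.
  apply: (@le_trans _ _ (\sum_(i < j.+1) 10 / 2 ^+ j * (2 ^+ i * h i))).
    apply: ler_sum => i _.
    have -> : 10 / 2 ^+ j * (2 ^+ i * h i) = 5 * (h i * (2 ^+ i.+1 / 2 ^+ j)).
      by rewrite exprS; ring.
    by rewrite ler_pM2l// ler_pM2l// ge_min lexx orbT.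
  rewrite -mulr_sumr -mulrA ler_pM2l// ler_pdivrMl//.
  by rewrite [leRHS]mulrCA; exact: S2.
rewrite -mulr_sumr ler_pM2l//; apply: le_trans (S1 j n.+1).
rewrite big_ord_recl -[leLHS]add0r; apply: lerD; first exact: ltW.
apply: ler_sum => i _; rewrite lift0 addnS addSn.
by rewrite ler_piMr ?(ltW (h_gt0 _))// ge_min lexx.
Qed.

Let C2 := 15 * C.
Let C2_gt0 : 0 < C2. Proof. by rewrite mulr_gt0. Qed.

Lemma heat_cutoff v i : 0 <= v ->
  (\tsum_(x) (heat J v x * cutoff i x)%:E <= (v * (C2 * h i))%:E)%E.
Proof.
move=> v0.
apply: le_trans (heat_moment J_ge0 J_mass J_even (@cutoff_ge0 i) (cutoff0 i) (cutoff_par i) v0) _.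
by rewrite EFinM; apply: lee_wpmul2l; [rewrite lee_fin|exact: cutoff_tail].
Qed.

Lemma dyad_small (e : R) : 0 < e -> exists i, h i <= e.
Proof.
move=> e0; apply/not_existsP => H.
have L i : e <= h i by rewrite leNgt; apply/negP => /ltW; exact: H.
pose n := (Num.truncn (C * h 0 / e)).+1.
have Ce0 : 0 <= C * h 0 / e by rewrite divr_ge0 ?mulr_ge0 ?ltW.
have /andP[_ H2] := truncn_itv Ce0.
have : n%:R * e <= C * h 0.
  apply: le_trans (S1 0 n); rewrite mulr_natl -[n in e *+ n]card_ord -sumr_const.
  by apply: ler_sum => k _; exact: L.
rewrite leNgt => /negP; apply.
by rewrite -ltr_pdivrMr.
Qed.

Let C3 := Num.sqrt (2 * C2 * (2 * C)).
Let D := 2 * expR (B * C3).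

(** Let [i] be the first scale such that the bound of [heat_cutoff] on the mass
    of [p_v] outside it is at most 1/2. By minimality [v h_(i-1)] is bounded
    below, so by [heat_ratio] the values of [p_v] inside that scale are
    comparable with [p_v(0)]. Hence [p_(2v)(0) = sum_x p_v(x)^2] is at least a
    constant times [p_v(0)]. *)
Lemma heat_doubling v : 0 < v -> heat J v 0 <= D * heat J (v + v) 0.
Proof.
move=> v0; have v0' := ltW v0.
have [|i0 Hi0] := @dyad_small (2 * v * C2)^-1; first by rewrite invr_gt0 !mulr_gt0.
have Pe x : (x <= (2 * v * C2)^-1) = (v * (C2 * x) <= 2^-1).
  rewrite -[(2 * v * C2)^-1]mul1r ler_pdivlMr ?mulr_gt0//.
  by rewrite -[RHS](ler_pM2l (ltr0n R 2)) divff//; congr (_ <= _); ring.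
(* [P i] bounds by 1/2 the mass that [p_v] puts outside scale [i]. *)
pose P i := v * (C2 * h i) <= 2^-1.
have exP : exists i, P i by exists i0; rewrite /P -Pe.
have [i Pi imin] := ex_minnP exP.
pose L := heat J v 0 * expR (- (B * C3)).
have L0 : 0 <= L by rewrite mulr_ge0 ?heat_ge0 ?expR_ge0.
have BC3 : 0 <= B * C3 by rewrite mulr_ge0// sqrtr_ge0.
have HL x : cutoff i x < 1 -> L <= heat J v x.
  move=> xi1; have xi : `|x| < (2 ^ i)%N%:Z.
    by rewrite ltNge; apply/negP => /cutoff1 E; rewrite E ltxx in xi1.
  case: i Pi imin xi {xi1} => [_ _ x1|k Pk imin xk].
    have -> : x = 0 by clear -x1; lia.
    by rewrite /L ler_piMr ?heat_ge0// -expR0 ler_expR oppr_le0.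
  have nPk : 2^-1 < v * (C2 * h k).
    by rewrite ltNge; apply/negP => Pk'; have := imin k Pk'; rewrite ltnn.
  have := heat_ratio v0 (ltW xk).
  rewrite /L expRN ler_pdivrMr ?expR_gt0// => H.
  apply: le_trans H _; apply: ler_wpM2l; first exact: heat_ge0.
  rewrite ler_expR; apply: ler_wpM2l => //.
  rewrite -sqrtrM// -[leLHS]mul1r ler_pdivrMr ?sqrtr_gt0 ?mulr_gt0//.
  rewrite -sqrtrM ?mulr_ge0 ?(ltW C_gt0) ?(ltW C2_gt0)//.
  rewrite -[leLHS]sqrtr1 ler_wsqrtr//.
  have := dyad_le_next k; have v2 : 0 < v * C2 by rewrite mulr_gt0.
  by move=> /(ler_wpM2l (ltW v2)); nra.
have c10 x : 0 <= 1 - cutoff i x by rewrite subr_ge0 /cutoff ge_min lexx.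
have half : ((2^-1 : R)%:E <= \tsum_(x) (heat J v x * (1 - cutoff i x))%:E)%E.
  have E : (\tsum_(x) (heat J v x * (1 - cutoff i x))%:E +
            \tsum_(x) (heat J v x * cutoff i x)%:E = 1)%E.
    rewrite -(heat_mass J_ge0 J_mass v0') -tsumD.
    - by apply: eq_tsum => x; rewrite -EFinD; congr EFin; ring.
    - by move=> x; rewrite lee_fin mulr_ge0// heat_ge0.
    - by move=> x; rewrite lee_fin mulr_ge0 ?heat_ge0// cutoff_ge0.
  have := heat_cutoff i v0'; move: E.
  move: (\tsum_(x) (heat J v x * (1 - cutoff i x))%:E)%E => X.
  have : (0 <= \tsum_(x) (heat J v x * cutoff i x)%:E)%E.
    by apply: tsum_ge0 => x; rewrite lee_fin mulr_ge0 ?heat_ge0// cutoff_ge0.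
  move: (\tsum_(x) (heat J v x * cutoff i x)%:E)%E => Y.
  case: Y => [y| |]//; case: X => [x| |]//.
  move=> _ [] xy; rewrite !lee_fin; move: Pi; rewrite /P; lra.
(* The mass 1/2 near the origin sits where [p_v >= L]. *)
have main : ((L * 2^-1)%:E <= (heat J (v + v) 0)%:E)%E.
  rewrite -(heat_conv0 J_ge0 J_mass J_even)// EFinM.
  apply: le_trans (lee_wpmul2l _ half) _; first by rewrite lee_fin.
  rewrite -tsumZ ?lee_fin//; last by move=> x; rewrite lee_fin mulr_ge0 ?heat_ge0.
  apply: le_tsum => x; rewrite -EFinM lee_fin mulrCA; apply: ler_wpM2l; first exact: heat_ge0.
  have [c1|c1] := ltP (cutoff i x) 1.
    apply: le_trans (HL x c1); rewrite ler_piMr// lerBlDr lerDl; exact: cutoff_ge0.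
  have -> : cutoff i x = 1 by apply/eqP; rewrite eq_le c1 /cutoff ge_min lexx.
  by rewrite subrr mulr0 heat_ge0.
rewrite lee_fin in main.
have e0 := expR_gt0 (B * C3).
have -> : heat J v 0 = 2 * expR (B * C3) * (L * 2^-1).
  by rewrite /L expRN; field; rewrite gt_eqF.
by apply: ler_wpM2l => //; rewrite mulr_ge0// ltW.
Qed.

(** [sqrt (h i)] decreases geometrically, and is at most [v^(-1/2)] at the
    first scale of the sum. *)
Lemma sum_far v : 0 < v ->
  (\tsum_(i) ((v * h i < 1)%R%:R * rt i)%:E <= (C * (Num.sqrt v)^-1)%:E)%E.
Proof.
move=> v0; have sv0 : 0 < Num.sqrt v by rewrite sqrtr_gt0.
apply: tsum_nat_le => [n|n]; first by rewrite mulr_ge0.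
have [[i Pi]|nP] := pselect (exists i, v * h i < 1); last first.
  rewrite big1 ?mulr_ge0 ?invr_ge0 ?(ltW C_gt0) ?(ltW sv0)// => k _.
  by rewrite (_ : (v * h k < 1) = false) ?mul0r//; apply/negP => H; apply: nP; exists k.
have exP : exists i, (fun i => v * h i < 1) i by exists i.
have [l Pl lmin] := ex_minnP exP.
apply: (@le_trans _ _ (\sum_(k < l + n) (v * h k < 1)%R%:R * rt k)).
  by rewrite addnC big_split_ord /= lerDl; apply: sumr_ge0 => k _; rewrite mulr_ge0.
rewrite big_split_ord /= big1 ?add0r; last first.
  move=> k _; rewrite (_ : (v * h k < 1) = false) ?mul0r//; apply/negP => H.
  by have := lmin k H; rewrite leqNgt ltn_ord.
apply: (@le_trans _ _ (C * rt l)).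
  apply: le_trans (S5 l n); apply: ler_sum => k _.
  by case: (_ < _); rewrite ?mul1r// mul0r ltW.
apply: ler_wpM2l; first exact: ltW.
rewrite -[leRHS]mul1r ler_pdivlMr// -sqrtrM ?(ltW (h_gt0 _))//.
by rewrite -[leRHS]sqrtr1 ler_wsqrtr// mulrC ltW.
Qed.

Let B1 := B * c2.
Let B1_ge0 : 0 <= B1. Proof. by rewrite mulr_ge0. Qed.

(** Near points, with [u h_i >= 1]: the ratio is bounded, and [ln r <= r - 1].
    Far points: [heat_ratio] bounds the logarithm, and the cutoff at their own
    scale equals 1. *)
Lemma log_ratio_le u x : 0 < u ->
  ((ln (heat J u 0 / heat J u x))%:E <=
  (expR B1 * ((heat J u 0 - heat J u x) / heat J u 0))%:E +
  \tsum_(i) ((u * h i < 1)%R%:R * (B1 * (Num.sqrt u * rt i)^-1) * cutoff i x)%:E)%E.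
Proof.
move=> u0; have u0' := ltW u0.
have h00 := heat_gt0_0 J_ge0 J_mass J_even u0'.
have le0 : heat J u x <= heat J u 0 by exact: heat_le0.
have t0 i : 0 <= (u * h i < 1)%R%:R * (B1 * (Num.sqrt u * rt i)^-1) * cutoff i x.
  by rewrite mulr_ge0 ?cutoff_ge0// mulr_ge0// mulr_ge0.
have a0 : 0 <= expR B1 * ((heat J u 0 - heat J u x) / heat J u 0).
  by rewrite mulr_ge0 ?expR_ge0// divr_ge0 ?subr_ge0// ltW.
have s0 : (0 <= \tsum_(i) ((u * h i < 1)%R%:R * (B1 * (Num.sqrt u * rt i)^-1) * cutoff i x)%:E)%E.
  by apply: tsum_ge0 => i; rewrite lee_fin.
have [->|x0] := eqVneq x 0.
  rewrite divff ?gt_eqF// ln1; apply: adde_ge0; last first.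
    apply: tsum_ge0 => i; rewrite lee_fin mulr_ge0 ?cutoff_ge0// mulr_ge0// mulr_ge0//.
  by rewrite subrr mul0r mulr0.
have [i [ix xi]] := int_dyadic x0.
have Hr : heat J u 0 <= heat J u x * expR (B1 * (Num.sqrt u * rt i)^-1).
  apply: le_trans (heat_ratio u0 xi) _; apply: ler_wpM2l; first exact: heat_ge0.
  rewrite ler_expR /B1 -mulrA; apply: ler_wpM2l => //.
  rewrite !invfM mulrCA; apply: ler_wpM2l; first by rewrite invr_ge0 sqrtr_ge0.
  exact: rt_inv_next.
have hx : 0 < heat J u x.
  by have := lt_le_trans h00 Hr; rewrite pmulr_lgt0 ?expR_gt0.
have Hln : ln (heat J u 0 / heat J u x) <= B1 * (Num.sqrt u * rt i)^-1.
  rewrite -[leRHS]expRK ler_ln ?posrE ?divr_gt0 ?expR_gt0//.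
  by rewrite ler_pdivrMr// mulrC.
have [ui|ui] := ltP (u * h i) 1.
  apply: le_trans (leeDr _ _); last by rewrite lee_fin.
  apply: le_trans (@tsum_ge1 _ _ _ i _); last by move=> k; rewrite lee_fin.
  by rewrite lee_fin ui mul1r cutoff1// mulr1.
apply: le_trans (leeDl _ s0); rewrite lee_fin.
have w1 : (Num.sqrt u * rt i)^-1 <= 1.
  rewrite invf_le1 ?mulr_gt0 ?sqrtr_gt0//.
  by rewrite -sqrtrM// -[leLHS]sqrtr1 ler_wsqrtr.
have Hr1 : heat J u 0 / heat J u x <= expR B1.
  rewrite ler_pdivrMr// mulrC; apply: le_trans Hr _; apply: ler_wpM2l; first exact: ltW.
  by rewrite ler_expR ler_piMr.
have q0 : 0 < heat J u 0 / heat J u x by rewrite divr_gt0.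
apply: (@le_trans _ _ (heat J u 0 / heat J u x - 1)).
  by have := expR_ge1Dx (ln (heat J u 0 / heat J u x)); rewrite lnK ?posrE//; lra.
have -> : heat J u 0 / heat J u x - 1 =
  heat J u 0 / heat J u x * ((heat J u 0 - heat J u x) / heat J u 0).
  by field; rewrite !gt_eqF.
by apply: ler_wpM2r => //; rewrite divr_ge0 ?subr_ge0// ltW.
Qed.

Let K := 2 * D * expR B1 + B1 * C2 * C.

(** Integrating [log_ratio_le] against [p_s]: the first term gives [p_u(0) -
    p_(u+s)(0)] by [heat_defect], the second a sum over the far scales of [s
    sqrt (h_i / u)]. *)
Lemma dyadic_log_bound : log_bound J K.
Proof.
move=> s u s0 su; have u0 := lt_le_trans s0 su.
have u0' := ltW u0; have s0' := ltW s0.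
have h00 := heat_gt0_0 J_ge0 J_mass J_even u0'.
have hpos x : 0 < heat J u x.
  have := heat_ratio (x := x) (j := (trunc_log 2 `|x|%N).+1) u0.
  have [->|x0] := eqVneq x 0 => //.
  have xp : (0 < `|x|)%N by rewrite absz_gt0.
  have /andP[_ H2] := trunc_log_bounds (isT : (1 < 2)%N) xp.
  have xi : `|x| <= (2 ^ (trunc_log 2 `|x|%N).+1)%N%:Z.
    by rewrite -[`|x|%R]abszE lez_nat ltnW.
  by move=> /(_ xi) /(lt_le_trans h00); rewrite pmulr_lgt0 ?expR_gt0.
split=> //.
have hs x : 0 <= heat J s x by exact: heat_ge0.
pose f x := heat J s x * (expR B1 * ((heat J u 0 - heat J u x) / heat J u 0)).
pose g i x := (u * h i < 1)%R%:R * (B1 * (Num.sqrt u * rt i)^-1) * cutoff i x.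
have le0 x : heat J u x <= heat J u 0 by exact: heat_le0.
have f0 x : 0 <= f x.
  by rewrite mulr_ge0// mulr_ge0 ?expR_ge0// divr_ge0 ?subr_ge0// ltW.
have g0 i x : 0 <= g i x.
  by rewrite mulr_ge0 ?cutoff_ge0// mulr_ge0// mulr_ge0.
apply: (@le_trans _ _ (\tsum_(x) (f x)%:E + \tsum_(x) \tsum_(i) (heat J s x * g i x)%:E)%E).
  rewrite -tsumD//; last first.
    by move=> x; apply: tsum_ge0 => i; rewrite lee_fin mulr_ge0.
  apply: le_tsum => x; rewrite EFinM.
  apply: le_trans (lee_wpmul2l _ (log_ratio_le x u0)) _; first by rewrite lee_fin.
  rewrite ge0_muleDr; last 2 first.
  - by rewrite lee_fin mulr_ge0 ?expR_ge0// divr_ge0 ?subr_ge0// ltW.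
  - by apply: tsum_ge0 => i; rewrite lee_fin; exact: g0.
  rewrite -tsumZ; last 2 first.
  - by rewrite lee_fin.
  - by move=> i; rewrite lee_fin; exact: g0.
  by rewrite lexx.
rewrite /K mulrDl EFinD; apply: leeD.
  pose c := expR B1 / heat J u 0.
  have c0 : 0 <= c by rewrite divr_ge0 ?expR_ge0// ltW.
  rewrite (_ : (\tsum_(x) (f x)%:E) =
     (c%:E * \tsum_(x) (heat J s x * (heat J u 0 - heat J u x))%:E)%E); last first.
    rewrite -tsumZ ?lee_fin//; last by move=> x; rewrite lee_fin mulr_ge0// subr_ge0.
    by apply: eq_tsum => x; rewrite -EFinM /f /c; congr EFin; field; rewrite gt_eqF.
  rewrite (heat_defect J_ge0 J_mass J_even s0' u0') -EFinM lee_fin.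
  have := heat_slope J_ge0 J_mass J_even s0 su.
  move=> /(ler_wpM2l c0)/le_trans; apply.
  have u2 : 0 < u / 2 by lra.
  have := heat_doubling u2; rewrite -splitr => H.
  have sc : 0 <= c * (2 * (s / u)) by rewrite mulr_ge0// mulr_ge0// divr_ge0.
  rewrite [leLHS]mulrA; apply: le_trans (ler_wpM2l sc H) _.
  by rewrite le_eqVlt; apply/orP; left; apply/eqP; rewrite /c; field; rewrite !gt_eqF.
rewrite tsum_exchange; last by move=> *; rewrite lee_fin mulr_ge0.
have su0 : 0 < Num.sqrt u by rewrite sqrtr_gt0.
have cc0 : 0 <= B1 * C2 * s / Num.sqrt u.
  by rewrite divr_ge0 ?sqrtr_ge0// mulr_ge0// mulr_ge0// ltW.
apply: (@le_trans _ _ (\tsum_(i) ((B1 * C2 * s / Num.sqrt u)%:E *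
    ((u * h i < 1)%R%:R * rt i)%:E))%E).
  apply: le_tsum => i.
  pose c := (u * h i < 1)%R%:R * (B1 * (Num.sqrt u * rt i)^-1).
  have c0 : 0 <= c by rewrite mulr_ge0// mulr_ge0.
  rewrite (_ : (\tsum_(x) _) = (c%:E * \tsum_(x) (heat J s x * cutoff i x)%:E)%E); last first.
    rewrite -tsumZ ?lee_fin//; last by move=> x; rewrite lee_fin mulr_ge0// cutoff_ge0.
    by apply: eq_tsum => x; rewrite -EFinM /g -/c mulrCA.
  apply: le_trans (lee_wpmul2l _ (heat_cutoff i s0')) _; first by rewrite lee_fin.
  rewrite -!EFinM lee_fin le_eqVlt; apply/orP; left; apply/eqP.
  rewrite /c; move: (rtrt i) (rt_gt0 i); move: (rt i) => r <- r0.
  by move: (_ < _) => b; field; rewrite !gt_eqF.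
rewrite tsumZ ?lee_fin//; try by move=> i; rewrite lee_fin mulr_ge0// ltW.
apply: le_trans (lee_wpmul2l _ (sum_far u0)) _; first by rewrite lee_fin.
rewrite -EFinM lee_fin le_eqVlt; apply/orP; left; apply/eqP.
move: (sqr_sqrtr u0') su0; move: (Num.sqrt u) => r <- r0.
by field; rewrite gt_eqF.
Qed.

End dyadic.

(** * The logarithmic bound for stable kernels *)

Section stable.
Variables (R : realType) (gamma : R) (J : int -> R).
Hypothesis g01 : 0 < gamma < 1.
Hypothesis Jst : stable_kernel gamma J.

Lemma stable_gt0 x : 0 < J x.
Proof.
case: Jst => _ [phi [phi0 _ JE]] _; rewrite JE mulr_gt0 ?powR_gt0//.
by apply: phi0; rewrite ler0z.
Qed.

(** [1 + 2 x] lies between [(1 + e)^(-1) 2 (1 + x)] and [2 (1 + x)]. *)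
Lemma powR_shift (x e : R) : 0 < e -> e <= 1 -> e^-1 <= x ->
  2 `^ (- (1 + gamma)) * (1 + x) `^ (- (1 + gamma)) <= (1 + 2 * x) `^ (- (1 + gamma))
  <= (1 + e) ^+ 2 * (2 `^ (- (1 + gamma)) * (1 + x) `^ (- (1 + gamma))).
Proof.
move=> e0 e1 xe; have /andP[g0 g1] := g01.
have x0 : 0 < x by apply: lt_le_trans xe; rewrite invr_gt0.
have xe1 : 1 <= x * e by rewrite -ler_pdivrMr// div1r.
rewrite -powRM; [|lra|lra].
rewrite !powRN; apply/andP; split.
  rewrite lef_pV2 ?posrE ?powR_gt0//; [|lra|lra].
  by apply: ge0_ler_powR; rewrite ?nnegrE; lra.
rewrite -[leLHS]div1r ler_pdivrMr ?powR_gt0//; last by lra.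
rewrite mulrAC ler_pdivlMr ?powR_gt0//; last by lra.
rewrite mul1r.
apply: (@le_trans _ _ (((1 + e) * (1 + 2 * x)) `^ (1 + gamma))).
  by apply: ge0_ler_powR; rewrite ?nnegrE; nra.
rewrite powRM; [|lra|lra].
apply: ler_wpM2r; first exact: powR_ge0.
rewrite -powR_mulrn; last by lra.
apply: ler_powR; lra.
Qed.

(** The ratios tend to [2^(- gamma)] because [phi] varies slowly; that limit is
    in the open interval from 1/2 to 1, so nearby [t1] and [t2] exist there. *)
Lemma stable_dyad_ratio : exists (t1 t2 : R) i0, [/\ 2^-1 < t1, 0 <= t2 < 1 &
  forall i, (i0 <= i)%N -> t1 * dyad J i <= dyad J i.+1 <= t2 * dyad J i].
Proof.
have /andP[g0 g1] := g01.
pose t := 2 `^ (- gamma) : R.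
have P r : 0 < r -> 1 < 2 `^ r :> R.
  move=> r0; have E : 1 `^ r = 1 :> R by rewrite powR1.
  by rewrite -[ltLHS]E; apply: gt0_ltr_powR; rewrite ?nnegrE//; lra.
have two0 : (2 == 0 :> R) = false by rewrite pnatr_eq0.
have t_half : 2^-1 < t.
  have := P (1 - gamma); rewrite subr_gt0 => /(_ g1).
  rewrite powRD ?two0 ?implybT// powRr1// -/t; lra.
have t_one : t < 1.
  by rewrite /t powRN invf_lt1 ?P// powR_gt0.
have t0 : 0 < t by apply: lt_trans t_half; rewrite invr_gt0.
(* [(1 + e)^3 <= 1 + 7 e] for [e <= 1], and [t + 7 e] has to stay below 1. *)
pose e := Num.min ((1 - t) / 16) ((t - 2^-1) / 2).
have e0 : 0 < e by rewrite /e lt_min; apply/andP; split; lra.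
have e1 : e <= (1 - t) / 16 by rewrite /e ge_min lexx.
have e2 : e <= (t - 2^-1) / 2 by rewrite /e ge_min lexx orbT.
case: Jst => _ [phi [phi0 [_ sv] JE]] _.
have := sv 2 (ltr0n R 2).
move=> /cvgrPdist_lt /(_ e e0) [M [Mreal HM]].
(* [2^i] exceeds [i] and hence [M] and [1 / e]; the latter makes [1 + 2^i]
   close to [2^i]. *)
pose i0 := Num.truncn (Num.max M e^-1).
exists (t - e), (t + 7 * e), i0.+1; split; [lra|lra|].
move=> i ii0.
pose x : R := 2 ^+ i.
have xi : (i0.+1)%:R <= x.
  rewrite /x -natrX ler_nat; apply: leq_trans ii0 _; exact: ltnW (ltn_expl _ _).
have mx : Num.max M e^-1 < x.
  apply: lt_le_trans xi; have [m0|m0] := leP 0 (Num.max M e^-1).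
    by have /andP[] := truncn_itv m0.
  by apply: lt_le_trans m0 _.
have xM : M < x by apply: le_lt_trans mx; rewrite le_max lexx.
have xe : e^-1 <= x by apply: le_trans (ltW mx); rewrite le_max lexx orbT.
have x0 : 0 < x by rewrite exprn_gt0.
have p1 := phi0 x (ltW x0).
have := HM x xM; rewrite distrC ltr_norml => /andP[H1 H2].
have p2 : (1 - e) * phi x <= phi (2 * x) <= (1 + e) * phi x.
  by apply/andP; split;
    [rewrite -ler_pdivlMr//|rewrite -ler_pdivrMr//]; lra.
have JxE k : J (2 ^ k)%N%:Z = phi (2 ^+ k) * (1 + 2 ^+ k) `^ (- (1 + gamma)).
  by rewrite JE ger0_norm// -pmulrn natrX.
rewrite /dyad !JxE !exprS -/x.
have e1' : e <= 1 by lra.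
have /andP[L U] := powR_shift e0 e1' xe.
have tE : t = 2 * 2 `^ (- (1 + gamma)).
  rewrite /t opprD powRD; last by rewrite (_ : (2 == 0 :> R) = false) ?implybT// pnatr_eq0.
  by rewrite powR_inv1// mulrA divff// mul1r.
set q := 2 `^ (- (1 + gamma)) in tE L U.
set a := (1 + x) `^ _ in L U *; set b := (1 + 2 * x) `^ _ in L U *.
have a0 : 0 <= a by exact: powR_ge0.
have q0 : 0 <= q by exact: powR_ge0.
have /andP[P1 P2] := p2.
have b0 : 0 <= b by exact: powR_ge0.
have fa : 0 <= phi x * a by rewrite mulr_ge0// ltW.
have F1 : (1 - e) * (phi x * (q * a)) <= phi (2 * x) * b.
  have A1 : 0 <= (1 - e) * phi x by apply: mulr_ge0; [lra|exact: ltW].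
  rewrite [leLHS]mulrA; apply: ler_pM => //; exact: mulr_ge0.
have F2 : phi (2 * x) * b <= (1 + e) * (phi x * ((1 + e) ^+ 2 * (q * a))).
  rewrite [leRHS]mulrA; apply: ler_pM => //; apply: ltW; apply: phi0; lra.
apply/andP; split.
  have -> : 2 * x * (phi (2 * x) * b) = x * (2 * (phi (2 * x) * b)) by ring.
  rewrite mulrCA ler_pM2l//.
  apply: (@le_trans _ _ (2 * ((1 - e) * (phi x * (q * a))))); last by rewrite ler_pM2l.
  have -> : 2 * ((1 - e) * (phi x * (q * a))) = (1 - e) * t * (phi x * a) by rewrite tE; ring.
  by apply: ler_wpM2r => //; nra.
have -> : 2 * x * (phi (2 * x) * b) = x * (2 * (phi (2 * x) * b)) by ring.
rewrite [leRHS]mulrCA ler_pM2l//.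
apply: (@le_trans _ _ (2 * ((1 + e) * (phi x * ((1 + e) ^+ 2 * (q * a)))))); first by rewrite ler_pM2l.
have -> : 2 * ((1 + e) * (phi x * ((1 + e) ^+ 2 * (q * a)))) =
  (1 + e) ^+ 3 * t * (phi x * a) by rewrite tE; ring.
apply: ler_wpM2r => //.
have ee : e * e <= e by nra.
have eee : e * (e * e) <= e by nra.
have : (1 + e) ^+ 3 <= 1 + 7 * e by rewrite !exprS expr0; nra.
have te : t * e <= e by nra.
nra.
Qed.

(** The sums over scales needed for [dyadic_log_bound] are all geometric: [h]
    and [sqrt h] decay, [2^k h] and [1 / sqrt h] grow. *)
Lemma stable_log_bound : exists K, log_bound J K.
Proof.
have [t1 [t2 [i0 [t1h /andP[t20 t21] Hr]]]] := stable_dyad_ratio.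
have J0 := stable_gt0.
case: Jst => mass _ mono.
have h0 i := dyad_gt0 J0 i.
have rt0 i : 0 < Num.sqrt (dyad J i) by rewrite sqrtr_gt0.
have [C1 C10 S1] : exists2 C, 0 < C &
    forall j n, \sum_(k < n) dyad J (j + k)%N <= C * dyad J j.
  apply: (@geometric_tail _ _ t2 i0) => //; first by rewrite t20.
  by move=> i ii; have /andP[] := Hr i ii.
have [C2 C20 S2] : exists2 C, 0 < C &
    forall j, \sum_(k < j.+1) 2 ^+ k * dyad J k <= C * (2 ^+ j * dyad J j).
  apply: (@geometric_head _ (fun k => 2 ^+ k * dyad J k) (2 * t1) i0).
  - by move=> i; rewrite mulr_gt0// exprn_gt0.
  - by lra.
  - move=> i ii; have /andP[H _] := Hr i ii.
    have -> : 2 * t1 * (2 ^+ i * dyad J i) = 2 ^+ i.+1 * (t1 * dyad J i).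
      by rewrite exprS; ring.
    by rewrite ler_pM2l// exprn_gt0.
have sq i : (i0 <= i)%N ->
    Num.sqrt (dyad J i.+1) <= Num.sqrt t2 * Num.sqrt (dyad J i).
  move=> ii; rewrite -sqrtrM// ler_wsqrtr//.
  by have /andP[] := Hr i ii.
have t21' : Num.sqrt t2 < 1 by rewrite -sqrtr1 ltr_sqrt.
have t2p : 0 < t2.
  have /andP[H1 H2] := Hr i0 (leqnn _).
  by have := lt_le_trans (h0 i0.+1) H2; rewrite pmulr_lgt0.
have [C4 C40 S4] : exists2 C, 0 < C & forall j,
    \sum_(k < j.+1) (Num.sqrt (dyad J k))^-1 <= C * (Num.sqrt (dyad J j))^-1.
  apply: (@geometric_head _ (fun k => (Num.sqrt (dyad J k))^-1) (Num.sqrt t2)^-1 i0).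
  - by move=> i; rewrite invr_gt0.
  - by rewrite invf_gt1// sqrtr_gt0.
  - move=> i ii; rewrite -invfM lef_pV2 ?posrE ?mulr_gt0 ?sqrtr_gt0//.
    by rewrite -sqrtrM// ; have := sq i ii; rewrite -sqrtrM.
have [C5 C50 S5] : exists2 C, 0 < C & forall j n,
    \sum_(k < n) Num.sqrt (dyad J (j + k)) <= C * Num.sqrt (dyad J j).
  apply: (@geometric_tail _ (fun k => Num.sqrt (dyad J k)) (Num.sqrt t2) i0) => //.
  by rewrite sqrtr_ge0.
(* One constant for the four sums. *)
pose C := C1 + C2 + C4 + C5.
have C0 : 0 < C by rewrite /C; lra.
have up c y z : 0 < c -> c <= C -> 0 <= y -> z <= c * y -> z <= C * y.
  by move=> c0 cC y0 /le_trans; apply; apply: ler_wpM2r.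
eexists; apply: (@dyadic_log_bound _ J J0 mass mono C C0).
- by move=> j n; apply: up (S1 j n) => //; [rewrite /C; lra|exact: ltW].
- move=> j; apply: up (S2 j) => //; [rewrite /C; lra|].
  by rewrite mulr_ge0 ?exprn_ge0// ltW.
- by move=> j; apply: up (S4 j) => //; rewrite /C; lra.
- by move=> j n; apply: up (S5 j n) => //; rewrite /C; lra.
Qed.

End stable.

(** * Discrete random variables *)

Section discrete.
Context (disp : measure_display) (T : measurableType disp).

(** Measurability for the discrete sigma-algebra on the target, for maps into a
    countable type that carries no measurable structure. *)
Definition dmeasurable (U : Type) (f : T -> U) :=
  forall A : set U, measurable (f @^-1` A).

Lemma dmeasurableP (U : Type) (f : T -> U) : countable [set: U] ->
  (forall y, measurable (f @^-1` [set y])) -> dmeasurable f.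
Proof.
move=> /countable_injP[g ginj] mf A.
have -> : f @^-1` A = \bigcup_n (\bigcup_(y in [set y | A y /\ g y = n]) f @^-1` [set y]).
  apply/seteqP; split=> [w Afw|w [n _ [y [Ay _] /= ->]]//].
  by exists (g (f w)) => //; exists (f w).
apply: bigcup_measurable => n _.
have [[y [Ay gy]]|ny] := pselect (exists y, A y /\ g y = n).
  rewrite (_ : [set _ | _ /\ _] = [set y]); first by rewrite bigcup_set1.
  apply/seteqP; split=> z; last by move=> ->.
  by move=> [_ gz]; apply: ginj; rewrite ?inE// gz.
rewrite (_ : [set _ | _ /\ _] = set0) ?bigcup_set0//.
by apply/seteqP; split=> z // [Az gz]; case: ny; exists z.
Qed.

Lemma dmeasurable_pair (U V : Type) (f : T -> U) (g : T -> V) :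
  countable [set: U] -> countable [set: V] ->
  dmeasurable f -> dmeasurable g -> dmeasurable (fun w => (f w, g w)).
Proof.
move=> cU cV mf mg; apply: dmeasurableP.
  by rewrite -setXTT; exact: countableX.
move=> [x y].
rewrite (_ : _ @^-1` _ = f @^-1` [set x] `&` g @^-1` [set y]).
  exact: measurableI.
by apply/seteqP; split=> w /= => [[-> ->]|[-> ->]].
Qed.

Lemma dmeasurable_case (U : Type) (M : T -> nat) (g : nat -> T -> U) :
  dmeasurable M -> (forall n, dmeasurable (g n)) ->
  dmeasurable (fun w => g (M w) w).
Proof.
move=> mM mg A.
rewrite (_ : _ @^-1` _ = \bigcup_n (M @^-1` [set n] `&` g n @^-1` A)).
  by apply: bigcup_measurable => n _; apply: measurableI; [exact: mM|exact: mg].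
apply/seteqP; split=> [w Aw|w [n _ [/= <-]]//].
by exists (M w).
Qed.

Lemma integral_fibers (R : realType) (P : probability T R) (U : choiceType)
    (f : T -> U) (F : T -> \bar R) : countable [set: U] -> dmeasurable f ->
  measurable_fun setT F -> (forall w, (0 <= F w)%E) ->
  (\int[P]_w F w = \tsum_(y) \int[P]_(w in f @^-1` [set y]) F w)%E.
Proof.
move=> /countable_injP[g ginj] mf mF F0.
pose A n := (g \o f) @^-1` [set n].
have TE : [set: T] = \bigcup_n A n.
  by apply/seteqP; split=> w // _; exists (g (f w)).
rewrite [X in integral _ X _]TE ge0_integral_bigcup//; first last.
- apply/trivIsetP => i j _ _ ij; apply/seteqP; split=> w //= [gi gj].
  by rewrite /A /= in gi gj; rewrite -gi -gj eqxx in ij.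
- by rewrite -TE.
- by move=> n; exact: (mf (g @^-1` [set n])).
have I0 D : (0 <= \int[P]_(w in D) F w)%E by exact: integral_ge0.
rewrite (@tsum_fiber _ _ _ g)// -tsum_nat//.
apply: eq_tsum => n.
have [[y gy]|ny] := pselect (exists y, g y = n).
  rewrite (@tsum1 _ _ _ y) ?gy ?eqxx//.
  - congr (integral _ _ _); apply/seteqP; split=> w /=; last by rewrite /A /= => ->.
    by move=> gfw; apply: ginj; rewrite ?inE// gy.
  - by move=> z; case: ifP.
  - move=> z zy; rewrite ifN//; apply: contra zy => /eqP gz.
    by apply/eqP/ginj; rewrite ?inE// gz gy.
rewrite tsum0; last first.
  by move=> y; rewrite ifN//; apply/eqP => gy; apply: ny; exists y.
rewrite (_ : A n = set0) ?integral_set0//.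
by apply/seteqP; split=> w // gw; case: ny; exists (f w).
Qed.

Lemma measure_fibers (R : realType) (P : probability T R) (U : choiceType)
    (f : T -> U) (A : set T) : countable [set: U] -> dmeasurable f ->
  measurable A -> P A = \tsum_(y) P (A `&` f @^-1` [set y]).
Proof.
move=> cU mf mA; rewrite -(setIT A) -integral_indic// setIT.
rewrite (integral_fibers _ cU mf)//; last first.
  by apply/measurable_EFinP; exact: measurable_indic.
by apply: eq_tsum => y; rewrite integral_indic//; exact: (mf [set y]).
Qed.

Lemma dmeasurable_fun (R : realType) (U : Type) (f : T -> U) (h : U -> R) :
  dmeasurable f -> measurable_fun setT (h \o f).
Proof. by move=> mf _ Y mY; rewrite setTI; exact: (mf (h @^-1` Y)). Qed.

Lemma integral_discrete (R : realType) (P : probability T R) (U : choiceType)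
    (f : T -> U) (h : U -> R) :
  countable [set: U] -> dmeasurable f -> (forall y, 0 <= h y) ->
  (\int[P]_w (h (f w))%:E = \tsum_(y) ((h y)%:E * P (f @^-1` [set y])))%E.
Proof.
move=> cU mf h0; rewrite (integral_fibers _ cU mf); last 2 first.
- by apply/measurable_EFinP; exact: dmeasurable_fun.
- by move=> w; rewrite lee_fin.
apply: eq_tsum => y; transitivity (\int[P]_(w in f @^-1` [set y]) (cst (h y)%:E) w)%E.
  by apply: eq_integral => w; rewrite inE /= => ->.
by rewrite integral_cst//; exact: (mf [set y]).
Qed.

End discrete.

(** * Independent increments of the walk *)

Section series.
Variables (R : realType) (G : zmodType) (J : G -> R).
Hypothesis J_ge0 : forall x, 0 <= J x.
Hypothesis J_mass : \tsum_(x) (J x)%:E = 1%E.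

Let EJ_ge0 : nng (EFin \o J). Proof. by move=> x; rewrite lee_fin. Qed.

(** The law of the sum of [n] increments. *)
Definition step_law (n : nat) (x : G) : R := fine (cpow (EFin \o J) n x).

Lemma step_lawE n x : (step_law n x)%:E = cpow (EFin \o J) n x.
Proof.
rewrite fineK// ge0_fin_numE; last exact: cpow_ge0.
apply: (@le_lt_trans _ _ (tsum (cpow (EFin \o J) n))).
  by apply: tsum_ge1; exact: cpow_ge0.
by rewrite (mass_cpow _ EJ_ge0 J_mass) ltry.
Qed.

Lemma step_law_ge0 n x : 0 <= step_law n x.
Proof. by rewrite -lee_fin step_lawE; exact: cpow_ge0. Qed.

Lemma step_law0 x : step_law 0 x = (x == 0)%:R.
Proof. by []. Qed.

Lemma step_lawS n x : \tsum_(y) (J y * step_law n (x - y))%:E = (step_law n.+1 x)%:E.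
Proof.
rewrite step_lawE /= /conv; apply: eq_tsum => y.
by rewrite EFinM step_lawE.
Qed.

(** A walk at time [u] has made a Poisson number of jumps. *)
Lemma heat_series u x : 0 < u ->
  \tsum_(n) (poisson_pmf u n * step_law n x)%:E = (heat J u x)%:E.
Proof.
move=> u0; have u0' := ltW u0.
have E n : cpow (scaledE J u) n = fun x => ((u ^+ n)%:E * cpow (EFin \o J) n x)%E.
  elim: n => [|n IH] /=; first by apply/funext => y; rewrite expr0 mul1e.
  have un : (0 <= (u ^+ n)%:E)%E by rewrite lee_fin exprn_ge0.
  have c0 : nng (cpow (EFin \o J) n) by exact: cpow_ge0.
  rewrite IH (_ : scaledE J u = fun x => (u%:E * (EFin \o J) x)%E)// convZl//; last first.
    by move=> y; exact: mule_ge0.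
  rewrite convZr//.
  by apply/funext => y; rewrite muleA -EFinM -exprS.
rewrite heatE// /cexp -tsumZ ?lee_fin ?expR_ge0//; last first.
  by move=> n; apply: dpow_ge0; exact: scaledE_ge0.
apply: eq_tsum => n; rewrite /dpow E -step_lawE -!EFinM /poisson_pmf u0.
congr EFin; ring.
Qed.

End series.

Section jump.
Variables (R : realType) (disp : measure_display) (T : measurableType disp).
Variables (P : probability T R) (G : zmodType) (J : G -> R).
Variables (N : R -> T -> nat) (xi : nat -> T -> G).
Hypothesis jd : jump_data P J N xi.
Hypothesis cG : countable [set: G].

Let cnat : countable [set: nat]. Proof. exact: countableP. Qed.

Lemma clock_dmeasurable t : 0 <= t -> dmeasurable (N t).
Proof. by move=> t0; apply: dmeasurableP => // n; exact: (measurable_clock jd). Qed.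

Lemma increment_dmeasurable n : dmeasurable (xi n).
Proof. by apply: dmeasurableP => // x; exact: (measurable_increment jd). Qed.

Definition partial_sum (m l : nat) (w : T) : G := \sum_(i < l) xi (m + i)%N w.

Lemma partial_sum_dmeasurable m l : dmeasurable (partial_sum m l).
Proof.
elim: l => [|l IH] A.
  rewrite /partial_sum; under eq_fun do rewrite big_ord0.
  have [A0|A0] := pselect (A 0).
    by rewrite (_ : _ @^-1` _ = setT)//; apply/seteqP; split.
  by rewrite (_ : _ @^-1` _ = set0)//; apply/seteqP; split.
have := @dmeasurable_pair _ T G G _ _ cG cG IH (@increment_dmeasurable (m + l)%N).
move=> /(_ ((fun k => k.1 + k.2) @^-1` A)); congr (measurable _).
by apply/seteqP; split=> w; rewrite /partial_sum /= big_ord_recr.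
Qed.

Lemma partial_sumS m l w : partial_sum m l.+1 w = xi m w + partial_sum m.+1 l w.
Proof.
rewrite /partial_sum big_ord_recl addn0; congr (_ + _).
by apply: eq_bigr => i _; rewrite lift0 addnS addSn.
Qed.

Lemma law_increment y : P (xi 0%N @^-1` [set y]) = (J y)%:E.
Proof.
have tlt i : (fun k => k%:R : R) i < (fun k => k%:R) i.+1 by rewrite ltr_nat.
have := @joint_law _ _ _ _ _ _ _ _ jd 0 1 (fun i => i%:R) (fun=> 0%N) (fun=> y)
  (lexx _) tlt.
rewrite big_ord0 big_ord1 mul1r => /= <-; congr (P _); apply/seteqP.
by split=> w /= => [xw|[_]]; [split=> // -[]|apply].
Qed.

Lemma kernel_ge0 y : 0 <= J y.
Proof. by rewrite -lee_fin -law_increment. Qed.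

Lemma kernel_mass : \tsum_(y) (J y)%:E = 1%E.
Proof.
rewrite -(@probability_setT _ _ _ P).
rewrite (measure_fibers P cG (@increment_dmeasurable 0%N) measurableT).
by apply: eq_tsum => y; rewrite setTI law_increment.
Qed.

Let J0 := kernel_ge0.
Let J1 := kernel_mass.
Local Notation sl := (step_law J).

Lemma measurable_forall_lt (A : nat -> set T) k :
  (forall i, measurable (A i)) -> measurable [set w | forall i, (i < k)%N -> A i w].
Proof.
move=> mA; rewrite (_ : [set _ | _] = \bigcap_(i in [set i | (i < k)%N]) A i).
  by apply: bigcap_measurableType => // i _; exact: mA.
by apply/seteqP; split=> w.
Qed.

Fixpoint blocks (m : nat) (ls : seq (nat * G)) (w : T) : Prop :=
  if ls is (l, z) :: ls' then
    partial_sum m l w = z /\ blocks (m + l) ls' w else True.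

Lemma measurable_blocks m ls : measurable [set w | blocks m ls w].
Proof.
elim: ls m => [|[l z] ls IH] m /=; first exact: measurableT.
by apply: measurableI; [exact: (@partial_sum_dmeasurable m l [set z])|exact: IH].
Qed.

Variable t : nat -> R.
Hypothesis t0 : 0 <= t 0%N.
Hypothesis t_lt : forall i, t i < t i.+1.

Lemma times_ge0 i : 0 <= t i.
Proof. by elim: i => // i IH; apply: le_trans IH (ltW (t_lt i)). Qed.

Lemma measurable_clock_eq i n :
  measurable [set w | N (t i.+1) w = (N (t i) w + n)%N].
Proof.
have := @dmeasurable_pair _ T nat nat _ _ cnat cnat
  (clock_dmeasurable (times_ge0 i.+1)) (clock_dmeasurable (times_ge0 i)).
by move=> /(_ [set k | k.1 = (k.2 + n)%N]).
Qed.

(** The increments outside the first [m] are revealed one at a time, by summing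
    over the value of the increment [m]. *)
Lemma block_law k (n : nat -> nat) (x : nat -> G) m (ls : seq (nat * G)) :
  P [set w | (forall i, (i < k)%N -> N (t i.+1) w = (N (t i) w + n i)%N) /\
             (forall j, (j < m)%N -> xi j w = x j) /\ blocks m ls w] =
  ((\prod_(i < k) poisson_pmf (t i.+1 - t i) (n i)) * (\prod_(j < m) J (x j)) *
   \prod_(lz <- ls) sl lz.1 lz.2)%:E.
Proof.
elim: ls m x => [|[l z] ls IH] m x.
  rewrite big_nil mulr1 -(joint_law jd k m n x t0 t_lt).
  by congr (P _); apply/seteqP; split=> w /= => [[? []]|[]].
rewrite big_cons /=; elim: l m x z => [|l IHl] m x z.
  rewrite step_law0; have [->|z0] := eqVneq z 0.
    rewrite mul1r -IH; congr (P _).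
    apply/seteqP; split=> w /=; rewrite addn0 /partial_sum big_ord0.
      by move=> [? [? []]].
    by move=> [? []].
  rewrite mul0r mulr0 (_ : [set _ | _] = set0) ?measure0//.
  apply/seteqP; split=> w //= [_ [_ [+ _]]].
  by rewrite /partial_sum big_ord0 => /esym/eqP; rewrite (negbTE z0).
rewrite (measure_fibers P cG (@increment_dmeasurable m)); last first.
  apply: measurableI; first exact: (measurable_forall_lt k (fun i => measurable_clock_eq i (n i))).
  apply: measurableI; last exact: (measurable_blocks m ((l.+1, z) :: ls)).
  exact: (measurable_forall_lt m (fun j => @increment_dmeasurable j [set x j])).
pose C := (\prod_(i < k) poisson_pmf (t i.+1 - t i) (n i)) * (\prod_(j < m) J (x j)).
pose D := \prod_(lz <- ls) sl lz.1 lz.2.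
rewrite -/D -/C.
have C0 : 0 <= C.
  rewrite mulr_ge0//; apply: prodr_ge0 => i _; [exact: poisson_pmf_ge0|exact: J0].
have D0 : 0 <= D by apply: prodr_ge0 => i _; exact: (step_law_ge0 J0 J1).
transitivity (\tsum_(y) ((C * D)%:E * (J y * sl l (z - y))%:E)); last first.
  rewrite tsumZ; last 2 first.
  - by rewrite lee_fin; exact: (mulr_ge0 C0 D0).
  - by move=> y; rewrite lee_fin mulr_ge0// (step_law_ge0 J0 J1).
  by rewrite (step_lawS J0 J1) -EFinM; congr EFin; ring.
apply: eq_tsum => y.
pose x' j := if j == m then y else x j.
have E : \prod_(j < m.+1) J (x' j) = \prod_(j < m) J (x j) * J y.
  rewrite big_ord_recr /=; congr (_ * J _); last by rewrite /x' eqxx.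
  by apply: eq_bigr => j _; rewrite /x' ltn_eqF.
have := IHl m.+1 x' (z - y); rewrite E.
rewrite -EFinM (_ : C * D * _ = \prod_(i < k) poisson_pmf (t i.+1 - t i) (n i) *
   (\prod_(j < m) J (x j) * J y) * (sl l (z - y) * D)); last by rewrite /C; ring.
move=> <-; congr (P _); apply/seteqP; split=> w /=; rewrite addSn addnS partial_sumS.
  move=> [[cN [cx [<- cb]] xy]]; split=> //; split; last first.
    by split=> //; rewrite -xy addrAC subrr add0r.
  move=> j; rewrite ltnS leq_eqVlt /x' => /orP[/eqP ->|jm]; first by rewrite eqxx.
  by rewrite ltn_eqF//; exact: cx.
move=> [cN [cx [bz cb]]]; have xy : xi m w = y by rewrite cx// /x' eqxx.
split=> //; split=> //; split.
  by move=> j jm; rewrite cx ?ltnS 1?ltnW// /x' ltn_eqF.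
by split=> //; rewrite xy bz addrC subrK.
Qed.

Definition walk (s : R) (w : T) : G := partial_sum 0 (N s w) w.

Lemma walk_dmeasurable s : 0 <= s -> dmeasurable (walk s).
Proof.
move=> s0; apply: (dmeasurable_case (clock_dmeasurable s0)) => n.
exact: partial_sum_dmeasurable.
Qed.

Lemma walk_increment i (w : T) (v : nat) : N (t i.+1) w = (N (t i) w + v)%N ->
  walk (t i.+1) w - walk (t i) w = partial_sum (N (t i) w) v w.
Proof.
rewrite /walk /partial_sum => ->; rewrite big_split_ord /=.
by rewrite addrAC subrr add0r; apply: eq_bigr.
Qed.

Hypothesis t00 : t 0%N = 0.

(** The numbers of jumps in the [k] intervals are revealed from the first to
    the last. Once all are known, the increments of the walk are the sums over
    disjoint blocks of jumps, and [block_law] applies; summing a Poisson weight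
    against the law of the block gives [heat_series]. *)
Lemma increment_law k (z : nat -> G) :
  P [set w | forall i, (i < k)%N -> walk (t i.+1) w - walk (t i) w = z i] =
  (\prod_(i < k) heat J (t i.+1 - t i) (z i))%:E.
Proof.
pose dt i := t i.+1 - t i.
have dt0 i : 0 < dt i by rewrite subr_gt0.
have minc i : measurable [set w | walk (t i.+1) w - walk (t i) w = z i].
  have := @dmeasurable_pair _ T G G _ _ cG cG (walk_dmeasurable (times_ge0 i.+1))
    (walk_dmeasurable (times_ge0 i)).
  by move=> /(_ [set q | q.1 - q.2 = z i]).
suff H d r (n : nat -> nat) : (r + d)%N = k ->
  P [set w | (forall i, (i < r)%N -> N (t i.+1) w = (N (t i) w + n i)%N) /\
             (forall i, (i < k)%N -> walk (t i.+1) w - walk (t i) w = z i)] =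
  ((\prod_(i < r) (poisson_pmf (dt i) (n i) * sl (n i) (z i))) *
   (\prod_(i < d) heat J (dt (r + i)%N) (z (r + i)%N)))%:E.
  have := H k 0%N (fun=> 0%N) (add0n k); rewrite big_ord0 mul1r => <-.
  by congr (P _); apply/seteqP; split=> w /= => [|[]].
elim: d r n => [|d IH] r n rk.
  rewrite addn0 in rk; rewrite rk big_ord0 mulr1.
  have := block_law k n (fun=> 0) 0 [seq (n i, z i) | i <- iota 0 k].
  have -> : \prod_(lz <- [seq (n i, z i) | i <- iota 0 k]) sl lz.1 lz.2 =
      \prod_(i < k) sl (n i) (z i).
    by rewrite big_map -{1}(subn0 k) -/(index_iota 0 k) big_mkord.
  rewrite big_ord0 mulr1 big_split /= => <-; congr (P _); apply/seteqP.
  have key w : (forall i, (i < k)%N -> N (t i.+1) w = (N (t i) w + n i)%N) ->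
      forall d r, (r + d)%N = k ->
      blocks (N (t r) w) [seq (n i, z i) | i <- iota r d] w <->
      (forall i, (r <= i < k)%N -> walk (t i.+1) w - walk (t i) w = z i).
    move=> cN; elim=> [|d' IH] r' rk' /=.
      by rewrite addn0 in rk'; split=> // _ i; rewrite rk' leqNgt; case: ltnP.
    have rk'' : (r' < k)%N by rewrite -rk' -addSnnS leq_addr.
    rewrite -(cN _ rk'') -(walk_increment (cN _ rk'')) IH ?addSnnS//.
    split=> [[zr H] i /andP[]|H].
      rewrite leq_eqVlt => /orP[/eqP <-//|ri ik]; apply: H; by rewrite ri.
    split=> [|i /andP[ri ik]]; first by apply: H; rewrite leqnn.
    by apply: H; rewrite ik (ltnW ri).
  have N0 w : N (t 0%N) w = 0%N by rewrite t00 (clock0 jd).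
  split=> w /= [cN H]; have K := key w cN k 0%N (add0n k); rewrite N0 in K;
    split=> //.
    by split=> //; apply: K.2 => i /andP[_ ik]; exact: H.
  by move=> i ik; apply: K.1 => //; exact: H.2.
rewrite (measure_fibers P cnat (f := fun w => (N (t r.+1) w - N (t r) w)%N)); first last.
- apply: measurableI; first exact: (measurable_forall_lt r (fun i => measurable_clock_eq i (n i))).
  exact: (measurable_forall_lt k minc).
- have := @dmeasurable_pair _ T nat nat _ _ cnat cnat
    (clock_dmeasurable (times_ge0 r.+1)) (clock_dmeasurable (times_ge0 r)).
  by move=> H A; have := H ((fun q => (q.1 - q.2)%N) @^-1` A).
pose C := \prod_(i < r) (poisson_pmf (dt i) (n i) * sl (n i) (z i)).
pose D := \prod_(i < d) heat J (dt (r.+1 + i)%N) (z (r.+1 + i)%N).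
have C0 : 0 <= C.
  by apply: prodr_ge0 => i _; rewrite mulr_ge0 ?poisson_pmf_ge0// (step_law_ge0 J0 J1).
have D0 : 0 <= D by apply: prodr_ge0 => i _; apply: (heat_ge0 J0); exact: ltW.
transitivity (\tsum_(v) ((C * D)%:E * (poisson_pmf (dt r) v * sl v (z r))%:E)); last first.
  rewrite tsumZ; last 2 first.
  - by rewrite lee_fin; exact: (mulr_ge0 C0 D0).
  - by move=> y; rewrite lee_fin mulr_ge0 ?poisson_pmf_ge0// (step_law_ge0 J0 J1).
  rewrite (heat_series J0 J1)// -EFinM big_ord_recl addn0 -/C; congr EFin.
  rewrite (eq_bigr (fun i : 'I_d => heat J (dt (r.+1 + i)%N) (z (r.+1 + i)%N))) -/D; first by ring.
  by move=> i _; rewrite lift0 addnS addSn.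
apply: eq_tsum => v.
(* [v] jumps in the interval number [r]. *)
pose n' i := if i == r then v else n i.
have := IH r.+1 n'; rewrite addSnnS => /(_ rk).
have -> : \prod_(i < r.+1) (poisson_pmf (dt i) (n' i) * sl (n' i) (z i)) =
    C * (poisson_pmf (dt r) v * sl v (z r)).
  rewrite big_ord_recr /=; congr (_ * _); last by rewrite /n' eqxx.
  by apply: eq_bigr => i _; rewrite /n' ltn_eqF.
rewrite -/D.
rewrite -EFinM mulrAC => <-; congr (P _); apply/seteqP; split=> w /=.
  move=> [[cN cz] rv]; split=> // i; rewrite ltnS leq_eqVlt => /orP[/eqP ->|ir].
    rewrite /n' eqxx -rv subnKC//.
    by apply: (clock_nondecreasing jd); [exact: times_ge0|exact: ltW].
  by rewrite /n' ltn_eqF//; exact: cN.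
move=> [cN cz]; split; last by rewrite cN// /n' eqxx addKn.
by split=> // i ir; rewrite cN ?ltnS 1?ltnW// /n' ltn_eqF.
Qed.

End jump.

(** * Jensen's inequality for chains of contacts *)

Section linear_recursion.
Variable R : realType.
Implicit Types (a : nat -> nat -> R) (b : nat -> R).

(** The solution of a linear recursion in which the value at [j] depends on all
    earlier ones; the list of the values already computed makes the recursion
    structural. *)
Fixpoint lrec_seq a b n : seq R :=
  if n is m.+1 then
    let s := lrec_seq a b m in
    rcons s (b m.+1 + \sum_(i < m.+1) a i m.+1 * s`_i)
  else [:: b 0%N].

Definition lrec a b n : R := (lrec_seq a b n)`_n.

Lemma size_lrec_seq a b n : size (lrec_seq a b n) = n.+1.
Proof. by elim: n => //= n IH; rewrite size_rcons IH. Qed.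

Lemma lrec_seq_nth a b n i : (i <= n)%N -> (lrec_seq a b n)`_i = lrec a b i.
Proof.
elim: n => [|n IH]; first by rewrite leqn0 => /eqP ->.
rewrite leq_eqVlt => /orP[/eqP -> //|]; rewrite ltnS => ni /=.
by rewrite nth_rcons size_lrec_seq ltnS ni IH.
Qed.

Lemma lrecE a b j : lrec a b j = b j + \sum_(i < j) a i j * lrec a b i.
Proof.
case: j => [|j]; first by rewrite big_ord0 addr0.
rewrite {1}/lrec /= nth_rcons size_lrec_seq ltnn eqxx; congr (_ + _).
by apply: eq_bigr => i _; rewrite lrec_seq_nth// -ltnS.
Qed.

Lemma lrec_ge0 a b j : (forall i j, (i < j)%N -> 0 <= a i j) ->
  (forall j, 0 <= b j) -> 0 <= lrec a b j.
Proof.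
move=> a0 b0; elim/ltn_ind: j => j IH; rewrite lrecE addr_ge0//.
by apply: sumr_ge0 => i _; rewrite mulr_ge0 ?a0 ?IH.
Qed.

(** The tangent of [ln] at the mean lies above it. *)
Lemma jensen_ln n (w x : 'I_n -> R) : (forall i, 0 <= w i) -> \sum_i w i = 1 ->
  (forall i, 0 < x i) -> \sum_i w i * ln (x i) <= ln (\sum_i w i * x i).
Proof.
move=> w0 w1 x0; set A := \sum_i w i * x i.
have A0 : 0 < A.
  have A0' : 0 <= A by apply: sumr_ge0 => i _; rewrite mulr_ge0// ltW.
  rewrite lt_neqAle A0' andbT eq_sym; apply/eqP => AE.
  have H i : w i = 0.
    have := psumr_eq0P (fun i _ => mulr_ge0 (w0 i) (ltW (x0 i))) AE (i := i) isT.
    by move/eqP; rewrite mulf_eq0 (gt_eqF (x0 i)) orbF => /eqP.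
  by move/eqP: w1; rewrite big1 ?(eq_sym 0) ?oner_eq0// => i _; exact: H.
apply: (@le_trans _ _ (\sum_i w i * (x i / A - 1 + ln A))).
  apply: ler_sum => i _; apply: ler_wpM2l => //.
  have xA : 0 < x i / A by rewrite divr_gt0.
  have := expR_ge1Dx (ln (x i / A)); rewrite lnK ?posrE// lnM ?posrE ?invr_gt0//.
  rewrite lnV ?posrE//; lra.
rewrite [leLHS](_ : _ = (A / A - 1) + ln A); first by rewrite divff ?gt_eqF// subrr add0r.
have -> : A / A = \sum_i w i * (x i / A).
  by rewrite {1}/A mulr_suml; apply: eq_bigr => i _; rewrite mulrA.
rewrite -[X in _ = _ - X + _]w1 -sumrB -[ln A in RHS]mul1r -[X in _ = _ + X * _]w1.
by rewrite mulr_suml -big_split /=; apply: eq_bigr => i _; ring.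
Qed.

Section polymer.
Variables (q0 qY g : nat -> nat -> R) (e e' : R).
Hypothesis e0 : 0 < e.
Hypothesis e'0 : 0 < e'.
Hypothesis q0_gt0 : forall i j, (i < j)%N -> 0 < q0 i j.
Hypothesis qY_gt0 : forall i j, (i < j)%N -> 0 < qY i j.
Hypothesis g_ge : forall i j, (i < j)%N -> ln (q0 i j) - ln (qY i j) <= g i j.

(** The total weight of the chains [0 = j_0 < ... < j_k = j], a step from [i]
    to [j] having weight [eps * q i j]. *)
Definition pinned (q : nat -> nat -> R) (eps : R) : nat -> R :=
  lrec (fun i j => eps * q i j) (fun j => (j == 0%N)%:R).

Lemma pinnedS q eps j : pinned q eps j.+1 =
  \sum_(i < j.+1) eps * q i j.+1 * pinned q eps i.
Proof. by rewrite /pinned lrecE add0r. Qed.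

Lemma pinned0 q eps : pinned q eps 0 = 1.
Proof. by rewrite /pinned lrecE big_ord0 addr0. Qed.

Lemma pinned_gt0 q eps j : 0 < eps -> (forall i j, (i < j)%N -> 0 < q i j) ->
  0 < pinned q eps j.
Proof.
move=> eps0 qp; case: j => [|j]; first by rewrite pinned0.
have p0 i : 0 <= pinned q eps i.
  apply: lrec_ge0 => // k l kl; by rewrite mulr_ge0// ltW// qp.
rewrite pinnedS big_ord_recl pinned0 mulr1 ltr_wpDr ?mulr_gt0 ?qp//.
apply: sumr_ge0 => i _; rewrite mulr_ge0// mulr_ge0 ?(ltW eps0)// ltW// qp//.
Qed.

Let z0 := pinned q0 e.
Let zY := pinned qY e'.
Let z0_gt0 j : 0 < z0 j. Proof. exact: pinned_gt0. Qed.
Let zY_gt0 j : 0 < zY j. Proof. exact: pinned_gt0. Qed.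

(** The chain with the law given by its weight is a Markov chain when read
    backwards; this is its probability of going from [j] to [i]. *)
Definition transit (i j : nat) : R := e * q0 i j * z0 i / z0 j.
Let k := ln (e' / e).

Lemma transit_ge0 i j : (i < j)%N -> 0 <= transit i j.
Proof.
move=> ij; apply: divr_ge0; last exact: ltW.
by apply: mulr_ge0; [apply: mulr_ge0; apply: ltW => //; exact: q0_gt0|exact: ltW].
Qed.

Lemma transit_sum j : (0 < j)%N -> \sum_(i < j) transit i j = 1.
Proof.
case: j => // j _; rewrite -mulr_suml /z0 -pinnedS divff//.
by rewrite gt_eqF.
Qed.

(** The mean, under the probability on chains that end at [j], of the sum of
    [h] over the steps of the chain; the mean number of steps when [h] is 1. *)
Definition cost (h : nat -> nat -> R) : nat -> R :=
  lrec transit (fun j => \sum_(i < j) transit i j * h i j).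

(** [pinned] for [qY] relative to that for [q0] is a [transit]-mean of its
    values at earlier indices; Jensen's inequality at each step propagates the
    bound along the recursion. *)
Lemma pinned_ln_ge j : ln (z0 j) - ln (zY j) <= cost g j - k * cost (fun _ _ => 1) j.
Proof.
elim/ltn_ind: j => j IH; case: j IH => [|j] IH.
  by rewrite /z0 /zY !pinned0 subrr /cost !lrecE !big_ord0 addr0 mulr0 subrr.
rewrite /cost !lrecE -/(cost g) -/(cost (fun _ _ => 1)) -!big_split /=.
rewrite mulr_sumr -sumrB.
pose r (i : 'I_j.+1) := e' / e * (zY i / z0 i) * (qY i j.+1 / q0 i j.+1).
have r0 i : 0 < r i.
  by apply: mulr_gt0; [apply: mulr_gt0|]; apply: divr_gt0 => //; [exact: qY_gt0|exact: q0_gt0].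
have := @jensen_ln j.+1 (fun i => transit i j.+1) r (fun i => transit_ge0 (ltn_ord i))
  (transit_sum (ltn0Sn j)) r0.
have -> : \sum_(i < j.+1) transit i j.+1 * r i = zY j.+1 / z0 j.+1.
  rewrite /zY pinnedS mulr_suml; apply: eq_bigr => i _.
  have qi : q0 i j.+1 != 0 by rewrite gt_eqF// q0_gt0.
  have zi : z0 i != 0 by rewrite gt_eqF.
  have zj : z0 j.+1 != 0 by rewrite gt_eqF.
  have en : e != 0 by rewrite gt_eqF.
  by rewrite /transit /r -/zY; field; rewrite qi zi zj en.
rewrite lnM ?posrE ?invr_gt0// lnV ?posrE// => H.
rewrite -lerN2 opprB; apply: le_trans H; rewrite -sumrN; apply: ler_sum => i _.
have -> : - (transit i j.+1 * g i j.+1 + transit i j.+1 * cost g i -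
    k * (transit i j.+1 * 1 + transit i j.+1 * cost (fun _ _ => 1) i)) =
  transit i j.+1 * (k - g i j.+1 - (cost g i - k * cost (fun _ _ => 1) i)) by ring.
apply: ler_wpM2l; first exact: transit_ge0.
have q1 := qY_gt0 (ltn_ord i); have q2 := q0_gt0 (ltn_ord i).
rewrite /r !lnM ?posrE ?invr_gt0 ?mulr_gt0 ?divr_gt0 ?invr_gt0//.
rewrite !lnV ?posrE// /k lnM ?posrE ?invr_gt0// lnV ?posrE//.
have := IH i (ltn_ord i); have := g_ge (ltn_ord i).
by rewrite /k lnM ?posrE ?invr_gt0// lnV ?posrE//; lra.
Qed.

(** The mean of [cost] over the last contact of the chain. *)
Definition total_cost (h : nat -> nat -> R) (M : nat) : R :=
  \sum_(j < M.+1) z0 j / (\sum_(j < M.+1) z0 j) * cost h j.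

Let Z0_gt0 M : 0 < \sum_(j < M.+1) z0 j.
Proof.
rewrite big_ord_recl ltr_wpDr//; apply: sumr_ge0 => i _; exact: ltW.
Qed.

(** [g] may exceed the true loss [ln q0 - ln qY]; taking it nonnegative makes
    all the averages over the environment integrals of nonnegative functions.
    *)
Lemma polymer_ln_ge M : ln (\sum_(j < M.+1) z0 j) - ln (\sum_(j < M.+1) zY j) <=
  total_cost g M - k * total_cost (fun _ _ => 1) M.
Proof.
set Z0 := \sum_(j < M.+1) z0 j.
have Z00 : 0 < Z0 by exact: Z0_gt0.
pose w (j : 'I_M.+1) := z0 j / Z0.
have w0 j : 0 <= w j by rewrite divr_ge0// ltW.
have w1 : \sum_j w j = 1 by rewrite -mulr_suml divff// gt_eqF.
have r0 (j : 'I_M.+1) : 0 < zY j / z0 j by rewrite divr_gt0.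
have := jensen_ln w0 w1 r0.
have -> : \sum_j w j * (zY j / z0 j) = (\sum_(j < M.+1) zY j) / Z0.
  rewrite mulr_suml; apply: eq_bigr => j _; rewrite /w.
  have zj : z0 j != 0 by rewrite gt_eqF.
  have Zn : Z0 != 0 by rewrite gt_eqF.
  by move: (Z0) Zn => Z Zn; field; rewrite zj Zn.
have ZY0 : 0 < \sum_(j < M.+1) zY j.
  by rewrite big_ord_recl ltr_wpDr//; apply: sumr_ge0 => i _; exact: ltW.
have -> : ln ((\sum_(j < M.+1) zY j) / Z0) = ln (\sum_(j < M.+1) zY j) - ln Z0.
  by rewrite lnM ?posrE ?invr_gt0// lnV ?posrE.
move=> H; rewrite -lerN2 [leRHS]opprB; apply: le_trans H.
rewrite /total_cost mulr_sumr -sumrB -sumrN; apply: ler_sum => j _.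
have -> : - (z0 j / Z0 * cost g j - k * (z0 j / Z0 * cost (fun _ _ => 1) j)) =
  w j * - (cost g j - k * cost (fun _ _ => 1) j) by rewrite /w; ring.
apply: ler_wpM2l => //; rewrite lnM ?posrE ?invr_gt0// lnV ?posrE//.
have := pinned_ln_ge j; lra.
Qed.

End polymer.

End linear_recursion.

(** * The discretised partition function *)

Section chain.
Variables (R : realType) (disp : measure_display) (T : measurableType disp).
Variables (P : probability T R) (G : zmodType) (J : G -> R).
Variables (N : R -> T -> nat) (xi : nat -> T -> G).
Hypothesis jd : jump_data P J N xi.
Hypothesis cG : countable [set: G].
Variables (a : R) (y : nat -> G).
Hypothesis a_gt0 : 0 < a.
Hypothesis y0 : y 0%N = 0.

Local Notation W := (walk N xi).

(** The probability, for a walk observed at the multiples of [a], of being at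
    [y j] at index [j] when it is at [y i] at index [i]. *)
Definition contact_kernel (i j : nat) : R := heat J (a * (j - i)%N%:R) (y j - y i).
Local Notation q := contact_kernel.

Fixpoint chain_weight (i : nat) (l : seq nat) : R :=
  if l is j :: l' then q i j * chain_weight j l' else 1.

Lemma chain_weight_prod i l : chain_weight i l =
  \prod_(k < size l) q (nth 0%N (i :: l) k) (nth 0%N l k).
Proof.
elim: l i => [|j l IH] i; first by rewrite big_ord0.
by rewrite /= big_ord_recl IH.
Qed.

Lemma chain_law l : path ltn 0 l ->
  P [set w | forall j, j \in l -> W (a * j%:R) w = y j] = (chain_weight 0 l)%:E.
Proof.
move=> pl.
(* [increment_law] asks for an infinite increasing sequence of times: beyond
   [l] the indices go on one by one. *)
pose idx k := if (k < (size l).+1)%N then nth 0%N (0%N :: l) k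
              else (last 0%N l + (k - size l))%N.
have idxS k : (idx k < idx k.+1)%N.
  rewrite /idx; case: (ltnP k (size l).+1) => k1; case: (ltnP k.+1 (size l).+1) => k2.
  - by have /(pathP 0%N) H := pl; exact: (H k k2).
  - have -> : k = size l by lia.
    have E : nth 0%N (0%N :: l) (size l) = last 0%N l by exact: (nth_last 0%N (0%N :: l)).
    by rewrite E; lia.
  - lia.
  - lia.
pose t k := a * (idx k)%:R.
have tS k : t k < t k.+1 by rewrite /t ltr_pM2l// ltr_nat.
have t0 : t 0%N = 0 by rewrite /t /idx /= mulr0.
have := increment_law jd cG (eq_ind_r (fun x => 0 <= x) (lexx 0) t0) tS t0 (size l)
  (fun i => y (idx i.+1) - y (idx i)).
have idxE k : (k <= size l)%N -> idx k = nth 0%N (0%N :: l) k.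
  by rewrite /idx ltnS => ->.
have -> : \prod_(i < size l) heat J (t i.+1 - t i) (y (idx i.+1) - y (idx i)) =
    chain_weight 0 l.
  rewrite chain_weight_prod; apply: eq_bigr => i _.
  rewrite /q -[nth 0%N l i]/(nth 0%N (0%N :: l) i.+1) -!idxE//; last by rewrite ltnW.
  by rewrite /t -mulrBr natrB// ltnW.
move=> <-; congr (P _); apply/seteqP.
have W0 w : W (t 0%N) w = 0.
  by rewrite /walk t0 (clock0 jd) /partial_sum big_ord0.
split=> w /= H.
  have key k : (k <= size l)%N -> W (t k) w = y (idx k).
    case: k => [_|k kl]; first by rewrite W0 /idx /= y0.
    by rewrite {1}/t idxE//; apply: H; exact: mem_nth.
  by move=> i il; rewrite !key// ltnW.
have key k : (k <= size l)%N -> W (t k) w = y (idx k).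
  elim: k => [_|k IH kl]; first by rewrite W0 /idx /= y0.
  have := H k kl; rewrite IH ?(ltnW kl)// => /eqP.
  by rewrite (inj_eq (addIr _)) => /eqP.
move=> j jl; have := key (index j l).+1; rewrite index_mem => /(_ jl).
by rewrite /t idxE ?index_mem//= nth_index.
Qed.

Definition contact (j : nat) (w : T) : R := (W (a * j%:R) w == y j)%:R.

Lemma contact_ge0 j w : 0 <= contact j w. Proof. exact: ler0n. Qed.

Lemma measurable_contact j : measurable_fun setT (contact j).
Proof.
apply: (@dmeasurable_fun _ _ _ _ (W (a * j%:R)) (fun x => (x == y j)%:R)).
by apply: (walk_dmeasurable jd cG); rewrite mulr_ge0// ltW.
Qed.

Variable e : R.
Hypothesis e_ge0 : 0 <= e.

Definition reward (n : nat) (w : T) : R := \prod_(i < n) (1 + e * contact i.+1 w).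
Definition contacts (l : seq nat) (w : T) : R := \prod_(i <- l) contact i w.

Lemma rewardS n w : reward n.+1 w = reward n w * (1 + e * contact n.+1 w).
Proof. by rewrite /reward big_ord_recr. Qed.

Lemma reward_ge0 n w : 0 <= reward n w.
Proof.
by apply: prodr_ge0 => i _; rewrite addr_ge0// mulr_ge0// contact_ge0.
Qed.

Lemma contacts_ge0 l w : 0 <= contacts l w.
Proof. by apply: prodr_ge0 => i _; exact: contact_ge0. Qed.

Lemma measurable_reward n : measurable_fun setT (reward n).
Proof.
elim: n => [|n IH].
  by rewrite (_ : reward 0 = cst 1)//; apply/funext => w; rewrite /reward big_ord0.
rewrite (_ : reward n.+1 = fun w => reward n w * (1 + e * contact n.+1 w)); last first.
  by apply/funext => w; rewrite rewardS.
apply: measurable_funM => //; apply: measurable_funD => //.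
by apply: measurable_funM => //; exact: measurable_contact.
Qed.

Lemma measurable_contacts l : measurable_fun setT (contacts l).
Proof.
elim: l => [|j l IH].
  by rewrite (_ : contacts [::] = cst 1)//; apply/funext => w; rewrite /contacts big_nil.
rewrite (_ : contacts _ = fun w => contact j w * contacts l w); last first.
  by apply/funext => w; rewrite /contacts big_cons.
by apply: measurable_funM => //; exact: measurable_contact.
Qed.

Lemma integral_contacts l : path ltn 0 l ->
  (\int[P]_w (contacts l w)%:E = (chain_weight 0 l)%:E)%E.
Proof.
move=> pl; rewrite -(chain_law pl).
set A := [set w | _].
have mA : measurable A.
  have mj j : measurable [set w | W (a * j%:R) w = y j].
    have a0 : 0 <= a * j%:R by rewrite mulr_ge0// ltW.
    exact: ((walk_dmeasurable jd cG a0) [set y j]).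
  rewrite (_ : A = \bigcap_(j in [set` l]) [set w | W (a * j%:R) w = y j]).
    by apply: bigcap_measurableType.
  by apply/seteqP; split=> w.
have := integral_indic P measurableT mA; rewrite setIT => <-.
apply: eq_integral => w _.
rewrite indicE; congr EFin.
have [wA|wA] := boolP (w \in A).
  rewrite /contacts big_seq big1// => j jl.
  by move: wA; rewrite inE => /(_ j jl) /eqP; rewrite /contact => ->.
have [j jl Wj] : exists2 j, j \in l & W (a * j%:R) w != y j.
  apply: contrapT => H; move/negP: wA; apply; rewrite inE => j jl.
  by apply/eqP/negPn/negP => ?; apply: H; exists j.
by rewrite /contacts (big_rem j)//= /contact (negbTE Wj) mul0r.
Qed.

(** The induction appends contacts: the last factor of the reward is either 1,
    or a contact that joins the prescribed ones. *)
Lemma integral_reward_contacts n l : path ltn n l ->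
  (\int[P]_w (reward n w * contacts l w)%:E =
   (\sum_(i < n.+1) pinned q e i * chain_weight i l)%:E)%E.
Proof.
elim: n l => [|n IH] l pl.
  rewrite big_ord1 pinned0 mul1r -integral_contacts//.
  by apply: eq_integral => w _; rewrite /reward big_ord0 mul1r.
have F0 k l' w : (0 <= (reward k w * contacts l' w)%:E)%E.
  by rewrite lee_fin mulr_ge0 ?reward_ge0 ?contacts_ge0.
have mF k l' : measurable_fun setT (fun w => (reward k w * contacts l' w)%:E).
  apply/measurable_EFinP; apply: measurable_funM; first exact: measurable_reward.
  exact: measurable_contacts.
have pnl : path ltn n l.
  by case: l pl => //= j l /andP[nj ->]; rewrite (ltn_trans _ nj).
transitivity (\int[P]_w ((reward n w * contacts l w)%:E +
    e%:E * (reward n w * contacts (n.+1 :: l) w)%:E))%E.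
  apply: eq_integral => w _; rewrite -EFinM -EFinD; congr EFin.
  by rewrite rewardS {3}/contacts big_cons -/(contacts l w); ring.
rewrite ge0_integralD//; last 2 first.
- by move=> w _; rewrite mule_ge0// lee_fin.
- exact: measurable_funeM.
rewrite ge0_integralZl// IH// IH /=; last by rewrite ltnSn.
rewrite -EFinM -EFinD [in RHS]big_ord_recr /=; congr EFin; congr (_ + _).
rewrite pinnedS mulr_suml mulr_sumr; apply: eq_bigr => i _; ring.
Qed.

(** The expansion of the discretised partition function over chains of
    contacts. *)
Lemma integral_reward M :
  (\int[P]_w (reward M w)%:E = (\sum_(j < M.+1) pinned q e j)%:E)%E.
Proof.
have := @integral_reward_contacts M [::] isT.
under eq_bigr do rewrite mulr1.
by move=> <-; apply: eq_integral => w _; rewrite /contacts big_nil mulr1.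
Qed.

End chain.

(** * The mean cost of the environment *)

Lemma integral_prob_cst (disp : measure_display) (T : measurableType disp)
    (R : realType) (P : probability T R) (c : R) : (\int[P]_w c%:E = c%:E)%E.
Proof.
rewrite integral_cst// -[RHS]mule1; congr (_ * _)%E; exact: probability_setT.
Qed.

Lemma measurable_lrec (disp : measure_display) (T : measurableType disp)
    (R : realType) (a : T -> nat -> nat -> R) (b : T -> nat -> R) j :
  (forall i k, (i < k)%N -> measurable_fun setT (fun w => a w i k)) ->
  (forall k, measurable_fun setT (fun w => b w k)) ->
  measurable_fun setT (fun w => lrec (a w) (b w) j).
Proof.
move=> ma mb; elim/ltn_ind: j => j IH.
rewrite (_ : (fun w => _) = fun w => b w j + \sum_(i < j) a w i j * lrec (a w) (b w) i); last first.
  by apply/funext => w; rewrite lrecE.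
apply: measurable_funD => //; apply: measurable_sum => i.
by apply: measurable_funM; [exact: ma|exact: IH].
Qed.

Section environment.
Variables (R : realType) (disp : measure_display) (T : measurableType disp).
Variables (P : probability T R) (G : zmodType) (J : G -> R).
Variables (N : R -> T -> nat) (xi : nat -> T -> G).
Hypothesis jd : jump_data P J N xi.
Hypothesis cG : countable [set: G].
Variables (K a b : R).
Hypothesis J_even : forall x, J (- x) = J x.
Hypothesis b_gt0 : 0 < b.
Hypothesis b_lt_a : b < a.
Hypothesis JK : log_bound J K.

Let J0 := kernel_ge0 jd.
Let J1 := kernel_mass jd cG.
Let a_gt0 : 0 < a. Proof. exact: lt_trans b_lt_a. Qed.

Local Notation W := (walk N xi).

Definition displacement i j w : G := W (b * j%:R) w - W (b * i%:R) w.

Lemma grid_ge0 (i : nat) : 0 <= b * i%:R. Proof. by rewrite mulr_ge0// ltW. Qed.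

Lemma displacement_dmeasurable i j : dmeasurable (displacement i j).
Proof.
have := @dmeasurable_pair _ T G G _ _ cG cG (walk_dmeasurable jd cG (grid_ge0 j))
  (walk_dmeasurable jd cG (grid_ge0 i)).
by move=> H A; have := H ((fun q => q.1 - q.2) @^-1` A).
Qed.

(** The position at the first of the two times is summed out. *)
Lemma displacement_law i j z : (i < j)%N ->
  P (displacement i j @^-1` [set z]) = (heat J (b * (j - i)%N%:R) z)%:E.
Proof.
have W0 w : W (b * 0%:R) w = 0.
  by rewrite mulr0 /walk (clock0 jd) /partial_sum big_ord0.
case: i => [|i] ij.
  have := @chain_law _ _ _ _ _ _ _ _ jd cG b (fun k => if k == 0%N then 0 else z)
    b_gt0 erefl [:: j].
  rewrite /= ij /contact_kernel mulr1 eqxx gtn_eqF// subr0 => <- //.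
  congr (P _); apply/seteqP; split=> w /=; rewrite /displacement W0 subr0.
    by move=> Wz k; rewrite inE => /eqP ->; rewrite gtn_eqF.
  by move/(_ j); rewrite inE eqxx gtn_eqF//; apply.
rewrite (measure_fibers P cG (walk_dmeasurable jd cG (grid_ge0 i.+1))); last first.
  exact: displacement_dmeasurable.
have h0 k x : (0 <= (heat J (b * k%:R) x)%:E)%E.
  by rewrite lee_fin (heat_ge0 J0)// grid_ge0.
transitivity (\tsum_(x) ((heat J (b * i.+1%:R) x)%:E * (heat J (b * (j - i.+1)%N%:R) z)%:E)); last first.
  by rewrite tsumZr// (heat_mass J0 J1) ?grid_ge0// mul1e.
apply: eq_tsum => x.
have := @chain_law _ _ _ _ _ _ _ _ jd cG b
  (fun k => if k == 0%N then 0 else if k == i.+1 then x else x + z)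
    b_gt0 erefl [:: i.+1; j].
rewrite /= ij /contact_kernel mulr1 !eqxx !gtn_eqF//; last first.
  exact: leq_trans ij.
rewrite subr0 subn0 addrAC subrr add0r -EFinM => <- //.
congr (P _); apply/seteqP; split=> w /=; rewrite /displacement.
  move=> [Wz Wx] k; rewrite !inE => /orP[]/eqP -> /=; first by rewrite eqxx.
  by rewrite !gtn_eqF//; [rewrite -Wx -Wz addrC subrK|exact: leq_trans ij].
move=> H.
have Wi : W (b * i.+1%:R) w = x by have := H i.+1; rewrite mem_head eqxx => /(_ isT).
have Wj : W (b * j%:R) w = x + z.
  have := H j; rewrite !inE eqxx orbT => /(_ isT).
  by rewrite !gtn_eqF//; exact: leq_trans ij.
by rewrite Wi Wj addrAC subrr add0r.
Qed.

(** With [p_u(0)] in place of [p_(u+s)(0)] the loss is nonnegative. *)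
Definition log_loss w i j : R :=
  ln (heat J (a * (j - i)%N%:R) 0 / heat J (a * (j - i)%N%:R) (displacement i j w)).

Lemma lag_gt0 (c : R) i j : 0 < c -> (i < j)%N -> 0 < c * (j - i)%N%:R.
Proof. by move=> c0 ij; rewrite mulr_gt0// ltr0n subn_gt0. Qed.

Let heat_gt0 i j x : (i < j)%N -> 0 < heat J (a * (j - i)%N%:R) x.
Proof.
move=> ij; have a0 := lag_gt0 a_gt0 ij.
by have [+ _] := JK a0 (lexx _); apply.
Qed.

Lemma log_loss_ge0 w i j : (i < j)%N -> 0 <= log_loss w i j.
Proof.
move=> ij; rewrite ln_ge0// ler_pdivlMr ?heat_gt0// mul1r.
by apply: (heat_le0 J0 J1 J_even); apply: ltW; exact: lag_gt0.
Qed.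

Lemma measurable_log_loss i j : measurable_fun setT (fun w => log_loss w i j).
Proof.
exact: (@dmeasurable_fun _ _ _ _ (displacement i j) (fun x =>
  ln (heat J (a * (j - i)%N%:R) 0 / heat J (a * (j - i)%N%:R) x))
  (displacement_dmeasurable i j)).
Qed.

Lemma integral_log_loss i j : (i < j)%N ->
  (\int[P]_w (log_loss w i j)%:E <= (K * (b / a))%:E)%E.
Proof.
move=> ij; have a0 := lag_gt0 a_gt0 ij; have b0 := lag_gt0 b_gt0 ij.
rewrite (@integral_discrete _ _ _ _ _ (displacement i j) (fun x =>
  ln (heat J (a * (j - i)%N%:R) 0 / heat J (a * (j - i)%N%:R) x)) cG
  (displacement_dmeasurable i j)); last first.
  move=> x; rewrite ln_ge0// ler_pdivlMr ?heat_gt0// mul1r.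
  by apply: (heat_le0 J0 J1 J_even); exact: ltW.
have ba : b * (j - i)%N%:R <= a * (j - i)%N%:R by apply: ler_wpM2r => //; exact: ltW.
have [_] := JK b0 ba.
have -> : b * (j - i)%:R / (a * (j - i)%:R) = b / a.
  have d0 : (j - i)%:R != 0 :> R by rewrite pnatr_eq0 -lt0n subn_gt0.
  have an0 : a != 0 by rewrite gt_eqF.
  by move: ((j - i)%:R) d0 => d d0; field; rewrite an0 d0.
apply: le_trans; rewrite le_eqVlt; apply/orP; left; apply/eqP.
by apply: eq_tsum => x; rewrite displacement_law// -EFinM mulrC.
Qed.

Variables (e e' : R).
Hypothesis e_gt0 : 0 < e.
Hypothesis e'_gt0 : 0 < e'.
Hypothesis gain : K * (b / a) <= ln (e' / e).

(** The contact kernel for a walk of total rate [a + b] and the path 0. *)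
Definition free_kernel i j : R := heat J ((a + b) * (j - i)%N%:R) 0.
Definition env_kernel w := contact_kernel J a (fun j => W (b * j%:R) w).

Lemma free_kernel_gt0 i j : (i < j)%N -> 0 < free_kernel i j.
Proof.
move=> ij; apply: (heat_gt0_0 J0 J1 J_even); apply: ltW; apply: lag_gt0 => //.
exact: addr_gt0.
Qed.

Lemma env_kernel_gt0 w i j : (i < j)%N -> 0 < env_kernel w i j.
Proof. by move=> ij; exact: heat_gt0. Qed.

Lemma log_loss_ge w i j : (i < j)%N ->
  ln (free_kernel i j) - ln (env_kernel w i j) <= log_loss w i j.
Proof.
move=> ij; have a0 := lag_gt0 a_gt0 ij; have b0 := lag_gt0 b_gt0 ij.
rewrite /log_loss /env_kernel /contact_kernel -/(displacement i j w).
rewrite lnM ?posrE ?invr_gt0 ?heat_gt0// lnV ?posrE ?heat_gt0//.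
apply: lerB => //; rewrite ler_ln ?posrE; last 2 first.
- exact: free_kernel_gt0.
- exact: heat_gt0.
by rewrite /free_kernel mulrDl; apply: (heat_decr J0 J1 J_even); exact: ltW.
Qed.

Local Notation transit := (transit free_kernel e).
Local Notation cost := (cost free_kernel e).
Local Notation unit := (fun _ _ : nat => 1 : R).

Lemma env_cost_ge0 (h : nat -> nat -> R) j :
  (forall i j, (i < j)%N -> 0 <= h i j) -> 0 <= cost h j.
Proof.
move=> h0; apply: lrec_ge0 => [i k|k].
  by move=> ik; exact: (transit_ge0 e_gt0 free_kernel_gt0).
by apply: sumr_ge0 => i _; rewrite mulr_ge0 ?h0// (transit_ge0 e_gt0 free_kernel_gt0).
Qed.

Lemma measurable_cost j : measurable_fun setT (fun w => cost (log_loss w) j).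
Proof.
apply: measurable_lrec => // k; apply: measurable_sum => i.
by apply: measurable_funM => //; exact: measurable_log_loss.
Qed.

(** The probability on chains does not depend on the environment, so the mean
    loss of a step can be integrated before the chain is averaged. *)
Lemma integral_cost j :
  (\int[P]_w (cost (log_loss w) j)%:E <= (ln (e' / e) * cost unit j)%:E)%E.
Proof.
set k := ln _; elim/ltn_ind: j => j IH.
have t0 (i : 'I_j) := transit_ge0 e_gt0 free_kernel_gt0 (ltn_ord i).
have c0 w (i : 'I_j) : 0 <= log_loss w i j + cost (log_loss w) i.
  by rewrite addr_ge0 ?log_loss_ge0// env_cost_ge0// => *; exact: log_loss_ge0.
have mc (i : 'I_j) : measurable_fun setT (fun w => log_loss w i j + cost (log_loss w) i).
  by apply: measurable_funD; [exact: measurable_log_loss|exact: measurable_cost].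
have E h : cost h j = \sum_(i < j) transit i j * (h i j + cost h i).
  by rewrite /cost lrecE -big_split; apply: eq_bigr => i _; rewrite mulrDr.
rewrite (_ : (\int[P]_w _)%E =
  (\int[P]_w \sum_(i < j) ((transit i j)%:E * (log_loss w i j + cost (log_loss w) i)%:E))%E); last first.
  by apply: eq_integral => w _; rewrite E -sumEFin; apply: eq_bigr => i _; rewrite EFinM.
rewrite ge0_integral_sum//; last 2 first.
- move=> i; apply: measurable_funeM; exact/measurable_EFinP.
- by move=> i w _; rewrite mule_ge0// lee_fin; [exact: t0|exact: c0].
rewrite E mulr_sumr -sumEFin; apply: lee_sum => i _.
rewrite ge0_integralZl//; last 3 first.
- exact/measurable_EFinP.
- by move=> w _; rewrite lee_fin.
- by rewrite lee_fin.
rewrite mulrCA [leRHS]EFinM; apply: lee_wpmul2l; first by rewrite lee_fin.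
rewrite (_ : (\int[P]_w _)%E =
  (\int[P]_w ((log_loss w i j)%:E + (cost (log_loss w) i)%:E))%E)//.
rewrite ge0_integralD//; first last.
- by apply/measurable_EFinP; exact: measurable_cost.
- move=> w _; rewrite lee_fin env_cost_ge0// => *; exact: log_loss_ge0.
- by apply/measurable_EFinP; exact: measurable_log_loss.
- by move=> w _; rewrite lee_fin log_loss_ge0.
rewrite mulrDr mulr1 EFinD; apply: leeD; last exact: IH.
by apply: (le_trans (integral_log_loss (ltn_ord i))); rewrite lee_fin.
Qed.

Definition free_Z M : R := \sum_(j < M.+1) pinned free_kernel e j.
Definition env_Z M w : R := \sum_(j < M.+1) pinned (env_kernel w) e' j.

Lemma env_Z_ge1 M w : 1 <= env_Z M w.
Proof.
rewrite /env_Z big_ord_recl pinned0 lerDl; apply: sumr_ge0 => i _; apply: ltW.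
by apply: pinned_gt0 => // k l; exact: env_kernel_gt0.
Qed.

Lemma measurable_env_Z M : measurable_fun setT (env_Z M).
Proof.
apply: measurable_sum => j; apply: measurable_lrec => // i k ik.
apply: measurable_funM => //.
exact: (@dmeasurable_fun _ _ _ _ (displacement i k) (heat J (a * (k - i)%N%:R))
  (displacement_dmeasurable i k)).
Qed.

(** The integrated form of [polymer_ln_ge]: the cost of the environment is paid
    by the gain [ln (e' / e)] per contact. Terms are moved so that only
    nonnegative functions are integrated. *)
Lemma grid_comparison M : ((ln (free_Z M))%:E <= \int[P]_w (ln (env_Z M w))%:E)%E.
Proof.
set k := ln (e' / e).
pose tc := total_cost free_kernel e.
have z0 j : 0 <= pinned free_kernel e j.
  by apply: ltW; apply: pinned_gt0 => //; exact: free_kernel_gt0.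
have wt0 (j : 'I_M.+1) : 0 <= pinned free_kernel e j / \sum_(j < M.+1) pinned free_kernel e j.
  by rewrite divr_ge0 ?sumr_ge0.
have c0 w (j : nat) : 0 <= cost (log_loss w) j.
  by rewrite env_cost_ge0// => *; exact: log_loss_ge0.
have mtc : measurable_fun setT (fun w => tc (log_loss w) M).
  by apply: measurable_sum => j; apply: measurable_funM => //; exact: measurable_cost.
have tc0 w : 0 <= tc (log_loss w) M.
  by apply: sumr_ge0 => j _; rewrite mulr_ge0.
have Itc : (\int[P]_w (tc (log_loss w) M)%:E <= (k * tc unit M)%:E)%E.
  rewrite (_ : (\int[P]_w _)%E =
    (\int[P]_w \sum_(j < M.+1) ((pinned free_kernel e j / \sum_(j < M.+1) pinned free_kernel e j)%:E
       * (cost (log_loss w) j)%:E))%E); last first.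
    by apply: eq_integral => w _; rewrite -sumEFin.
  rewrite ge0_integral_sum//; last 2 first.
  - by move=> j; apply: measurable_funeM; apply/measurable_EFinP; exact: measurable_cost.
  - by move=> j w _; rewrite mule_ge0// lee_fin.
  rewrite /tc /total_cost mulr_sumr -sumEFin; apply: lee_sum => j _.
  rewrite ge0_integralZl//; last 3 first.
  - by apply/measurable_EFinP; exact: measurable_cost.
  - by move=> w _; rewrite lee_fin.
  - by rewrite lee_fin.
  rewrite mulrCA [leRHS]EFinM; apply: lee_wpmul2l; first by rewrite lee_fin.
  exact: integral_cost.
have key w : ln (free_Z M) + k * tc unit M <= ln (env_Z M w) + tc (log_loss w) M.
  have := @polymer_ln_ge _ _ _ _ _ _ e_gt0 e'_gt0 free_kernel_gt0
    (@env_kernel_gt0 w) (@log_loss_ge w) M.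
  rewrite -/k -/(tc _ _) -/(tc _ _) -/(free_Z M) -/(env_Z M w); lra.
have mlnZ : measurable_fun setT (fun w => ln (env_Z M w)).
  exact: measurableT_comp (measurable_env_Z M).
have lnZ0 w : 0 <= ln (env_Z M w) by rewrite ln_ge0// env_Z_ge1.
have I1 : ((ln (free_Z M) + k * tc unit M)%:E <=
    \int[P]_w (ln (env_Z M w))%:E + \int[P]_w (tc (log_loss w) M)%:E)%E.
  rewrite -ge0_integralD//; last 4 first.
  - by move=> w _; rewrite lee_fin.
  - exact/measurable_EFinP.
  - by move=> w _; rewrite lee_fin.
  - exact/measurable_EFinP.
  have F0 : 0 <= ln (free_Z M).
    rewrite ln_ge0// /free_Z big_ord_recl pinned0 lerDl.
    by apply: sumr_ge0 => i _; exact: z0.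
  have k0 : 0 <= k * tc unit M.
    rewrite -lee_fin; apply: le_trans Itc; apply: integral_ge0 => w _.
    by rewrite lee_fin.
  have -> : (ln (free_Z M) + k * tc unit M)%:E = (\int[P]__ (ln (free_Z M) + k * tc unit M)%:E)%E.
    by rewrite integral_prob_cst.
  apply: ge0_le_integral => //.
  - by move=> w _; rewrite lee_fin addr_ge0.
  - by apply/measurable_EFinP; apply: measurable_funD.
  - by move=> w _; rewrite -EFinD lee_fin.
have := le_trans I1 (leeD (lexx _) Itc).
by rewrite EFinD leeD2rE.
Qed.

End environment.

(** * Riemann sums of right-continuous step functions *)

Section bounded_convergence.
Variables (disp : measure_display) (T : measurableType disp) (R : realType).
Variables (mu : {measure set T -> \bar R}) (D : set T) (B : R).
Variables (f_ : nat -> T -> R) (f : T -> R).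
Hypothesis mD : measurable D.
Hypothesis muD : (mu D < +oo)%E.
Hypothesis mf_ : forall n, measurable_fun D (f_ n).
Hypothesis f_f : forall x, D x -> f_ n x @[n --> \oo] --> f x.
Hypothesis f_B : forall n x, D x -> `|f_ n x| <= B.

Lemma bounded_cvg_measurable : measurable_fun D f.
Proof. exact: measurable_fun_cvg mf_ f_f. Qed.

Let fB x : D x -> `|f x| <= B.
Proof.
move=> Dx; have H : `|f_ n x| @[n --> \oo] --> `|f x| by apply: cvg_norm; exact: f_f.
have <- : lim (`|f_ n x| @[n --> \oo]) = `|f x| by apply/cvg_lim.
by apply: limr_le; [apply/cvg_ex; exists `|f x| | apply: nearW => n; exact: f_B].
Qed.

Let iB : mu.-integrable D (EFin \o cst B).
Proof.
apply/integrableP; split; first by apply/measurable_EFinP.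
by rewrite /= integral_cst// lte_mul_pinfty// lee_fin.
Qed.

Lemma bounded_cvg_integrable : mu.-integrable D (EFin \o f).
Proof.
apply: (le_integrable mD) iB => /=.
  by apply/measurable_EFinP; exact: bounded_cvg_measurable.
by move=> x Dx; rewrite lee_fin (le_trans (fB Dx))// ler_norm.
Qed.

Lemma bounded_cvg :
  \int[mu]_(x in D) f_ n x @[n --> \oo] --> \int[mu]_(x in D) f x.
Proof.
apply: fine_cvg; rewrite fineK; last first.
  exact: integrable_fin_num bounded_cvg_integrable.
apply: (@dominated_cvg _ _ _ mu D mD (fun n x => (f_ n x)%:E) _ (EFin \o cst B)) => //.
- by move=> n; apply/measurable_EFinP.
- by move=> x Dx; apply: cvg_EFin; [exact: nearW|exact: f_f].
Qed.

End bounded_convergence.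

Section riemann.
Variables (R : realType) (c : R -> R) (S : R).
Hypothesis S_gt0 : 0 < S.
Hypothesis c01 : forall t, 0 <= c t <= 1.

(** Right-continuity for the discrete topology of the target. *)
Definition right_step (U : Type) (f : R -> U) :=
  forall t, 0 <= t -> exists2 d, 0 < d & forall s, t <= s < t + d -> f s = f t.

Hypothesis c_step : right_step c.

Definition mesh M : R := S / M.+1%:R.

Lemma mesh_gt0 M : 0 < mesh M. Proof. by rewrite divr_gt0. Qed.

Lemma mesh_cvg : mesh M @[M --> \oo] --> 0.
Proof.
rewrite -[X in _ --> X](mulr0 S); apply: cvgM; first exact: cvg_cst.
exact: cvg_harmonic.
Qed.

Definition cell M i : set R := `[mesh M * i%:R, mesh M * i.+1%:R[.

(** On each cell, the value of [c] at the right end: the grid points at which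
    the discretised partition function looks, and the side on which [c] is
    continuous. *)
Definition step M (t : R) : R := \sum_(i < M.+1) c (mesh M * i.+1%:R) * \1_(cell M i) t.

Lemma measurable_step M D : measurable_fun D (step M).
Proof.
apply: measurable_sum => i; apply: measurable_funM => //.
by apply: measurable_funTS; apply: measurable_indic; exact: measurable_itv.
Qed.

Lemma cell_uniq M i k t : cell M i t -> cell M k t -> i = k.
Proof.
have m0 := mesh_gt0 M; rewrite /cell /= !in_itv /= => /andP[i1 i2] /andP[k1 k2].
have := le_lt_trans i1 k2; have := le_lt_trans k1 i2.
by rewrite !ltr_pM2l// !ltr_nat; lia.
Qed.

Lemma stepE M i t : (i < M.+1)%N -> cell M i t -> step M t = c (mesh M * i.+1%:R).
Proof.
move=> iM ti; rewrite /step (bigD1 (Ordinal iM))//= big1 ?addr0 => [|k ki].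
  by rewrite indicE mem_set// mulr1.
rewrite indicE memNset ?mulr0// => tk; move/eqP: ki; apply; apply: val_inj => /=.
exact: cell_uniq tk ti.
Qed.

Lemma cell_exists M t : 0 <= t < S -> exists2 i, (i < M.+1)%N & cell M i t.
Proof.
move=> /andP[t0 tS]; have m0 := mesh_gt0 M.
have := truncn_itv (divr_ge0 t0 (ltW m0)); set i := Num.truncn _ => /andP[i1 i2].
exists i; last first.
  by rewrite /cell /= in_itv /= mulrC -ler_pdivlMr// i1 mulrC -ltr_pdivrMr.
rewrite -(ltr_nat R); apply: (le_lt_trans i1).
by rewrite ltr_pdivrMr// /mesh mulrC divfK.
Qed.

Lemma step_bound M t : 0 <= t < S -> `|step M t| <= 1.
Proof.
move=> /(cell_exists M)[i iM /(stepE iM) ->].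
by have /andP[c0 c1] := c01 (mesh M * i.+1%:R); rewrite ger0_norm.
Qed.

Lemma step_cvg t : 0 <= t < S -> step M t @[M --> \oo] --> c t.
Proof.
move=> tS; have /andP[t0 _] := tS; have [d d0 cd] := c_step t0.
apply: cvg_near_cst.
have dM : \forall M \near \oo, mesh M < d by apply: (cvgr_lt (0:R)) => //; exact: mesh_cvg.
apply: filterS dM => M Md.
have [i iM ti] := cell_exists M tS; rewrite (stepE iM ti); apply: cd.
move: ti; rewrite /cell /= in_itv /= => /andP[i1 i2]; rewrite (ltW i2) /=.
by move: i1; rewrite -natr1 mulrDr mulr1; lra.
Qed.

Local Notation m := (@lebesgue_measure R).

Lemma cell_measure M i : m (cell M i) = (mesh M)%:E.
Proof.
rewrite /cell lebesgue_measure_itv /= lte_fin ltr_pM2l ?mesh_gt0// ltr_nat ltnSn.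
by rewrite -EFinB -natr1; congr EFin; ring.
Qed.

Lemma integral_step M : \int[m]_(t in `[0, S[) step M t =
  \sum_(i < M.+1) mesh M * c (mesh M * i.+1%:R).
Proof.
have cS (i : 'I_M.+1) : cell M i `&` `[0, S[ = cell M i.
  apply/setIidPl => t; rewrite /cell /= !in_itv /= => /andP[i1 i2].
  rewrite (le_trans _ i1)/=; last exact: mulr_ge0 (ltW (mesh_gt0 M)) (ler0n _ _).
  apply: (lt_le_trans i2); rewrite /mesh -mulrA ger_pMr// mulrC ler_pdivrMr//.
  by rewrite mul1r ler_nat ltn_ord.
rewrite /Rintegral.
have -> : (\int[m]_(t in `[0%R, S[) (step M t)%:E)%E = (\int[m]_(t in `[0%R, S[)
   \sum_(i < M.+1) ((c (mesh M * i.+1%:R))%:E * (\1_(cell M i) t)%:E))%E.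
  by apply: eq_integral => t _; rewrite -sumEFin.
have mi (i : 'I_M.+1) : measurable_fun `[0, S[ (EFin \o (\1_(cell M i) : R -> R)).
  apply/measurable_EFinP; apply: measurable_funTS; apply: measurable_indic.
  exact: measurable_itv.
have mci (i : 'I_M.+1) : measurable_fun `[0, S[
    (EFin \o (fun t : R => c (mesh M * i.+1%:R) * \1_(cell M i) t)).
  by apply/measurable_EFinP; apply: measurable_funM => //; apply/measurable_EFinP; exact: mi.
rewrite ge0_integral_sum//; last first.
  move=> i t _; rewrite mule_ge0// lee_fin//.
  by have /andP[] := c01 (mesh M * i.+1%:R).
rewrite (eq_bigr (fun i : 'I_M.+1 => (mesh M * c (mesh M * i.+1%:R))%:E)).
  by rewrite sumEFin.
move=> i _; rewrite ge0_integralZl//; last 2 first.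
- exact: mi.
- by rewrite lee_fin; have /andP[] := c01 (mesh M * i.+1%:R).
rewrite integral_indic//; last exact: measurable_itv.
by rewrite cS [in RHS]mulrC EFinM; congr (_ * _)%E; exact: cell_measure.
Qed.

Lemma riemann_cvg : \sum_(i < M.+1) mesh M * c (mesh M * i.+1%:R) @[M --> \oo] -->
  \int[m]_(t in `[0, S]) c t.
Proof.
have muS : (m `[0%R, S[%classic < +oo)%E.
  by rewrite lebesgue_measure_itv /=; case: ifP => _; rewrite ?ltry// -EFinB ltry.
have H0 t : `[0%R, S[%classic t -> step M t @[M --> \oo] --> c t.
  by rewrite /= in_itv /=; exact: step_cvg.
have H1 M t : `[0%R, S[%classic t -> `|step M t| <= 1.
  by rewrite /= in_itv /=; exact: step_bound.
have mS : measurable (`[0%R, S[%classic : set R) by exact: measurable_itv.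
rewrite -Rintegral_itv_bndo_bndc; last first.
  exact: (@bounded_cvg_integrable _ (measurableTypeR R) R m `[0%R, S[%classic 1 step c
    mS muS (fun M => @measurable_step M _) H0 H1).
under eq_fun do rewrite -integral_step.
exact: (@bounded_cvg _ (measurableTypeR R) R m `[0%R, S[%classic 1 step c
    mS muS (fun M => @measurable_step M _) H0 H1).
Qed.

End riemann.

(** * The limit of a vanishing mesh *)

Section right_step_theory.
Variable R : realType.

Lemma right_step_comp (U V : Type) (f : R -> U) (h : U -> V) :
  right_step f -> right_step (h \o f).
Proof. by move=> fs t /fs[d d0 H]; exists d => // s /H /= ->. Qed.

Lemma right_step_pair (U V : Type) (f : R -> U) (g : R -> V) :
  right_step f -> right_step g -> right_step (fun t => (f t, g t)).
Proof.
move=> fs gs t t0; have [d d0 H] := fs t t0; have [d' d'0 H'] := gs t t0.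
exists (Num.min d d'); first by rewrite lt_min d0.
move=> s /andP[ts st]; rewrite H ?H'// ts /= (lt_le_trans st)// lerD2l ge_min lexx ?orbT//.
Qed.

Lemma right_step_scale (U : Type) (f : R -> U) (v : R) : 0 < v ->
  right_step f -> right_step (fun t => f (v * t)).
Proof.
move=> v0 fs t t0; have [d d0 H] := fs (v * t) (mulr_ge0 (ltW v0) t0).
exists (d / v); first exact: divr_gt0.
move=> s /andP[ts st]; apply: H; rewrite ler_pM2l// ts /=.
have -> : v * t + d = v * (t + d / v) by field; rewrite gt_eqF.
by rewrite ltr_pM2l.
Qed.

Lemma right_step_walk (disp : measure_display) (T : measurableType disp)
    (P : probability T R) (G : zmodType) (J : G -> R) (N : R -> T -> nat)
    (xi : nat -> T -> G) (w : T) :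
  jump_data P J N xi -> right_step (fun t => walk N xi t w).
Proof.
move=> jd; apply: (@right_step_comp nat G (fun t => N t w) (fun n => partial_sum xi 0 n w)).
move=> t t0; have [e /= e0 He] := clock_right_continuous jd w t0.
exists e => // s /andP[]; rewrite le_eqVlt => /orP[/eqP <-//|ts] st.
apply: He => //=; rewrite ltr_distlC; lra.
Qed.

End right_step_theory.

Lemma cvg_expR (R : realType) (f : nat -> R) (l : R) :
  f n @[n --> \oo] --> l -> expR (f n) @[n --> \oo] --> expR l.
Proof. by move=> fl; apply: (cvg_comp _ _ fl); exact: continuous_expR. Qed.

Lemma cvg_ln (R : realType) (f : nat -> R) (l : R) : 0 < l ->
  f n @[n --> \oo] --> l -> ln (f n) @[n --> \oo] --> ln l.
Proof. by move=> l0 fl; apply: (cvg_comp _ _ fl); exact: continuous_ln. Qed.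

(** [expR (x / (1 + x)) <= 1 + x <= expR x], the first inequality being [1 - t
    <= expR (- t)] at [t = x / (1 + x)]. *)
Lemma one_plus_bounds (R : realType) (I : Type) (s : seq I) (e : R) (c : I -> R) :
  0 <= e -> (forall i, 0 <= c i <= 1) ->
  expR ((\sum_(i <- s) e * c i) / (1 + e)) <= \prod_(i <- s) (1 + e * c i) <=
  expR (\sum_(i <- s) e * c i).
Proof.
move=> e0 c01; rewrite mulr_suml !expR_sum.
have ec i : 0 <= e * c i <= e.
  have /andP[? ?] := c01 i; rewrite mulr_ge0//=; exact: ler_piMr.
apply/andP; split; apply: ler_prod => i _; have /andP[x0 xe] := ec i; last first.
  by rewrite addr_ge0//= expR_ge1Dx.
rewrite expR_ge0 /=; set x := e * c i in x0 xe *.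
have le1 : expR (x / (1 + e)) <= expR (x / (1 + x)).
  rewrite ler_expR; apply: ler_wpM2l => //; rewrite lef_pV2 ?posrE; lra.
apply: (le_trans le1).
have := expR_ge1Dx (- (x / (1 + x))); rewrite expRN.
have -> : 1 + - (x / (1 + x)) = (1 + x)^-1 by field; apply: lt0r_neq0; lra.
by rewrite lef_pV2 ?posrE ?expR_gt0//; lra.
Qed.

Section partition.
Variables (R : realType) (disp : measure_display) (T : measurableType disp).
Variables (P : probability T R) (G : zmodType) (J : G -> R).
Variables (N : R -> T -> nat) (xi : nat -> T -> G).
Hypothesis jd : jump_data P J N xi.
Hypothesis cG : countable [set: G].
Variables (v beta S : R) (y : R -> G).
Hypothesis v_gt0 : 0 < v.
Hypothesis beta_ge0 : 0 <= beta.
Hypothesis S_gt0 : 0 < S.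
Hypothesis y_step : right_step y.
Hypothesis y0 : y 0 = 0.

Local Notation X t w := (walk N xi (v * t) w).
Local Notation h M := (mesh S M).

Definition meeting w t : R := (X t w == y t)%:R.

Lemma meeting01 w t : 0 <= meeting w t <= 1.
Proof. by rewrite /meeting; case: (_ == _); rewrite lexx ler01. Qed.

Lemma right_step_meeting w : right_step (meeting w).
Proof.
have := right_step_comp (fun q => (q.1 == q.2)%:R : R)
  (right_step_pair (right_step_scale v_gt0 (right_step_walk w jd)) y_step).
exact.
Qed.

Definition grid_reward M w : R :=
  reward N xi (v * h M) (fun j => y (h M * j%:R)) (beta * h M) M.+1 w.

(** There are [M.+1] steps, so that [M = 0] is a grid; the contact at time 0
    has weight 1 and accounts for the further index. *)
Definition grid_Z M : R :=
  \sum_(j < M.+2) pinned (contact_kernel J (v * h M) (fun j => y (h M * j%:R)))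
    (beta * h M) j.

Let h_gt0 M : 0 < h M. Proof. exact: mesh_gt0. Qed.
Let e_ge0 M : 0 <= beta * h M. Proof. by rewrite mulr_ge0// ltW. Qed.
Let vh_gt0 M : 0 < v * h M. Proof. by rewrite mulr_gt0. Qed.
Let yh0 M : (fun j => y (h M * j%:R)) 0%N = 0. Proof. by rewrite /= mulr0. Qed.

Lemma grid_rewardE M w : grid_reward M w =
  \prod_(i < M.+1) (1 + beta * h M * meeting w (h M * i.+1%:R)).
Proof. by apply: eq_bigr => i _; rewrite /contact /meeting mulrA. Qed.

Lemma measurable_grid_reward M : measurable_fun setT (grid_reward M).
Proof. by apply: (measurable_reward jd cG); exact: vh_gt0. Qed.

Lemma integral_grid_reward M : (\int[P]_w (grid_reward M w)%:E = (grid_Z M)%:E)%E.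
Proof. exact: (integral_reward jd cG (vh_gt0 M) (yh0 M) (e_ge0 M)). Qed.

Definition occupation w : R :=
  \int[@lebesgue_measure R]_(t in `[0, S]) meeting w t.

Let riem M w : R := \sum_(i < M.+1) h M * meeting w (h M * i.+1%:R).

Lemma grid_reward_bounds M w :
  expR (beta * riem M w / (1 + beta * h M)) <= grid_reward M w <= expR (beta * riem M w).
Proof.
rewrite grid_rewardE.
have -> : beta * riem M w = \sum_(i < M.+1) beta * h M * meeting w (h M * i.+1%:R).
  by rewrite mulr_sumr; apply: eq_bigr => i _; rewrite mulrA.
exact: (one_plus_bounds (index_enum 'I_M.+1) (e_ge0 M)
  (fun i : 'I_M.+1 => meeting01 w (h M * i.+1%:R))).
Qed.

Lemma grid_reward_cvg w : grid_reward M w @[M --> \oo] --> expR (beta * occupation w).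
Proof.
have r : riem M w @[M --> \oo] --> occupation w.
  exact: (riemann_cvg S_gt0 (meeting01 w) (right_step_meeting w)).
have br : beta * riem M w @[M --> \oo] --> beta * occupation w.
  by apply: cvgM => //; exact: cvg_cst.
have hi : expR (beta * riem M w) @[M --> \oo] --> expR (beta * occupation w).
  exact: cvg_expR br.
have lo : expR (beta * riem M w / (1 + beta * h M)) @[M --> \oo] -->
    expR (beta * occupation w).
  apply: cvg_expR.
  rewrite -[L in _ --> L]divr1; apply: cvgM => //; apply: cvgV => //.
  rewrite -[L in _ --> L]addr0; apply: cvgD; first exact: cvg_cst.
  by rewrite -[L in _ --> L](mulr0 beta); apply: cvgM; [exact: cvg_cst|exact: mesh_cvg].
apply: squeeze_cvgr lo hi.
by apply: nearW => M; exact: grid_reward_bounds.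
Qed.

Lemma grid_reward_le M w : 1 <= grid_reward M w <= expR (beta * S).
Proof.
have /andP[_ rle] := grid_reward_bounds M w; apply/andP; split; last first.
  apply: (le_trans rle); rewrite ler_expR; apply: ler_wpM2l => //.
  apply: (@le_trans _ _ (\sum_(i < M.+1) h M)).
    apply: ler_sum => i _; apply: ler_piMr; first exact: ltW.
    by have /andP[] := meeting01 w (h M * i.+1%:R).
  by rewrite sumr_const card_ord -mulr_natr /mesh divfK.
rewrite grid_rewardE.
apply: (@le_trans _ _ (\prod_(i < M.+1) (1 : R))); first by rewrite big1.
apply: ler_prod => i _; rewrite ler01 /= lerDl mulr_ge0//.
Qed.

Lemma grid_Z_le M : 1 <= grid_Z M <= expR (beta * S).
Proof.
have mr : measurable_fun setT (EFin \o grid_reward M).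
  by apply/measurable_EFinP; exact: measurable_grid_reward.
have g0 w : 0 <= grid_reward M w.
  by apply: le_trans (proj1 (andP (grid_reward_le M w))).
rewrite -!lee_fin -integral_grid_reward -[1%:E](integral_prob_cst P).
rewrite -(integral_prob_cst P (expR _)); apply/andP; split.
  apply: ge0_le_integral => //.
  by move=> w _; rewrite lee_fin; have /andP[] := grid_reward_le M w.
apply: ge0_le_integral => //.
- by move=> w _; rewrite lee_fin.
- by move=> w _; rewrite lee_fin; have /andP[] := grid_reward_le M w.
Qed.

Local Notation Z := (partition_function P (fun t w => X t w) y beta S).

Lemma grid_Z_cvg : grid_Z M @[M --> \oo] --> Z.
Proof.
have mr M : measurable_fun setT (grid_reward M).
  exact: measurable_grid_reward.
have PT : (P setT < +oo)%E by rewrite probability_setT ltry.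
have B M w : setT w -> `|grid_reward M w| <= expR (beta * S).
  have /andP[r1 rS] := grid_reward_le M w.
  by rewrite ger0_norm// (le_trans _ r1).
have := bounded_cvg measurableT PT mr (fun w _ => @grid_reward_cvg w) B.
have -> : (fun M => \int[P]_w grid_reward M w) = grid_Z.
  by apply/funext => M; rewrite /Rintegral integral_grid_reward.
by rewrite /partition_function unlock.
Qed.

Lemma partition_function_le : 1 <= Z <= expR (beta * S).
Proof.
have Zc : cvgn grid_Z by apply/cvg_ex; exists Z; exact: grid_Z_cvg.
have <- : lim (grid_Z M @[M --> \oo]) = Z by apply/cvg_lim => //; exact: grid_Z_cvg.
apply/andP; split.
  by apply: limr_ge => //; apply: nearW => M; have /andP[] := grid_Z_le M.
by apply: limr_le => //; apply: nearW => M; have /andP[] := grid_Z_le M.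
Qed.

End partition.

Section comparison.
Variables (R : realType) (G : zmodType) (J : G -> R).
Variables (d1 d2 : measure_display) (T1 : measurableType d1) (T2 : measurableType d2).
Variables (P1 : probability T1 R) (P2 : probability T2 R).
Variables (N1 : R -> T1 -> nat) (xi1 : nat -> T1 -> G).
Variables (N2 : R -> T2 -> nat) (xi2 : nat -> T2 -> G).
Hypothesis jd1 : jump_data P1 J N1 xi1.
Hypothesis jd2 : jump_data P2 J N2 xi2.
Hypothesis cG : countable [set: G].
Hypothesis J_even : forall x, J (- x) = J x.
Variable K : R.
Hypothesis JK : log_bound J K.

Local Notation W1 := (walk N1 xi1).
Local Notation W2 := (walk N2 xi2).

(** The factor 1 is the rate [1 - rho] at [rho = 0]. *)
Definition homogeneous_Z beta S : R :=
  partition_function P1 (fun t w => W1 (1 * t) w) (fun=> 0) beta S.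

Definition quenched_Z rho beta S w : R :=
  partition_function P1 (fun t v => W1 ((1 - rho) * t) v) (fun t => W2 (rho * t) w)
    beta S.

Variables (rho S : R).
Hypothesis rho_gt0 : 0 < rho.
Hypothesis rho_lt : rho < 2^-1.
Hypothesis S_gt0 : 0 < S.

Let speed_gt0 : 0 < 1 - rho. Proof. by move: rho_lt; lra. Qed.

Let env_step w : right_step (fun t => W2 (rho * t) w).
Proof. exact: (right_step_scale rho_gt0 (right_step_walk w jd2)). Qed.

Let env0 w : W2 (rho * 0) w = 0.
Proof. by rewrite mulr0 /walk (clock0 jd2) /partial_sum big_ord0. Qed.

Section limits.
Variable beta : R.
Hypothesis beta_ge0 : 0 <= beta.

Let qgrid_Z M w := grid_Z J (1 - rho) beta S (fun t => W2 (rho * t) w) M.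

Lemma quenched_Z_cvg w : qgrid_Z M w @[M --> \oo] --> quenched_Z rho beta S w.
Proof.
exact: (grid_Z_cvg jd1 cG speed_gt0 beta_ge0 S_gt0 (@env_step w) (env0 w)).
Qed.

Lemma quenched_Z_le w : 1 <= quenched_Z rho beta S w <= expR (beta * S).
Proof.
exact: (partition_function_le jd1 cG speed_gt0 beta_ge0 S_gt0 (@env_step w) (env0 w)).
Qed.

Lemma qgrid_ZE M : qgrid_Z M = env_Z J N2 xi2 ((1 - rho) * mesh S M) (rho * mesh S M)
   (beta * mesh S M) M.+1.
Proof.
apply/funext => w; apply: eq_bigr => j _; congr (pinned _ _ _).
by apply/funext => i; apply/funext => k; rewrite /env_kernel /contact_kernel !mulrA.
Qed.

Lemma measurable_ln_qgrid M : measurable_fun setT (fun w => ln (qgrid_Z M w)).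
Proof.
apply: (measurableT_comp (@measurable_ln R)); rewrite qgrid_ZE.
apply: (measurable_env_Z jd2 cG); by rewrite mulr_gt0 ?mesh_gt0.
Qed.

Lemma ln_qgrid_le M w : `|ln (qgrid_Z M w)| <= beta * S.
Proof.
have /andP[z1 z2] : 1 <= qgrid_Z M w <= expR (beta * S).
  exact: (grid_Z_le jd1 cG speed_gt0 beta_ge0 S_gt0 (env0 w)).
rewrite ger0_norm ?ln_ge0// -[leRHS]expRK ler_ln ?posrE ?expR_gt0//.
exact: lt_le_trans z1.
Qed.

Lemma ln_quenched_cvg w : ln (qgrid_Z M w) @[M --> \oo] --> ln (quenched_Z rho beta S w).
Proof.
apply: cvg_ln; last exact: quenched_Z_cvg.
by have /andP[z1 _] := quenched_Z_le w; exact: lt_le_trans z1.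
Qed.

Let P2T : (P2 setT < +oo)%E. Proof. by rewrite probability_setT ltry. Qed.

Lemma integrable_ln_quenched :
  P2.-integrable setT (EFin \o (fun w => ln (quenched_Z rho beta S w))).
Proof.
exact: (bounded_cvg_integrable measurableT P2T measurable_ln_qgrid
  (fun w _ => @ln_quenched_cvg w) (fun M w _ => ln_qgrid_le M w)).
Qed.

Lemma ln_quenched_ge0 w : 0 <= ln (quenched_Z rho beta S w).
Proof. by rewrite ln_ge0//; have /andP[] := quenched_Z_le w. Qed.

Lemma integral_ln_qgrid_cvg : \int[P2]_w ln (qgrid_Z M w) @[M --> \oo] -->
  \int[P2]_w ln (quenched_Z rho beta S w).
Proof.
exact: (bounded_cvg measurableT P2T measurable_ln_qgrid
  (fun w _ => @ln_quenched_cvg w) (fun M w _ => ln_qgrid_le M w)).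
Qed.

End limits.

(** Inequality (1) above, for [beta > 0]: both sides of [grid_comparison] pass
    to the limit of a vanishing mesh. *)
Lemma quenched_ge_homogeneous beta beta' : 0 < beta -> beta <= beta' ->
  Num.max K 0 * (rho / (1 - rho)) <= ln (beta' / beta) ->
  ((ln (homogeneous_Z beta S))%:E <= \int[P2]_w (ln (quenched_Z rho beta' S w))%:E)%E.
Proof.
move=> b0 bb' gain; have b'0 := lt_le_trans b0 bb'.
pose y0 : R -> G := fun=> 0.
have y0s : right_step y0 by move=> t _; exists 1.
have Zc := grid_Z_cvg jd1 cG ltr01 (ltW b0) S_gt0 y0s erefl.
have := @partition_function_le _ _ _ _ _ _ _ _ jd1 cG 1 beta S y0 ltr01 (ltW b0) S_gt0 y0s erefl.
rewrite -/(homogeneous_Z beta S) => /andP[Z1 _].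
have lc : ln (grid_Z J 1 beta S y0 M) @[M --> \oo] --> ln (homogeneous_Z beta S).
  by apply: cvg_ln => //; exact: lt_le_trans Z1.
have ic := integral_ln_qgrid_cvg (ltW b'0).
have ii := integrable_ln_quenched (ltW b'0).
rewrite -[leRHS]fineK; last exact: (integrable_fin_num _ ii).
rewrite lee_fin -/(Rintegral P2 setT (fun w => ln (quenched_Z rho beta' S w))).
have <- : lim (ln (grid_Z J 1 beta S y0 M) @[M --> \oo]) = ln (homogeneous_Z beta S).
  by apply/cvg_lim.
rewrite -(cvg_lim _ ic)//.
apply: ler_lim; [by apply/cvg_ex; eexists; exact: lc|by apply/cvg_ex; eexists; exact: ic|].
apply: nearW => M; have m0 := mesh_gt0 S_gt0 M.
have rm : 0 < rho * mesh S M by rewrite mulr_gt0.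
have vm : rho * mesh S M < (1 - rho) * mesh S M.
  by rewrite ltr_pM2r//; move: rho_lt; lra.
have JK' : K * (rho * mesh S M / ((1 - rho) * mesh S M)) <=
    ln (beta' * mesh S M / (beta * mesh S M)).
  have -> : rho * mesh S M / ((1 - rho) * mesh S M) = rho / (1 - rho).
    by field; rewrite !gt_eqF.
  have -> : beta' * mesh S M / (beta * mesh S M) = beta' / beta.
    by field; rewrite !gt_eqF.
  apply: le_trans gain; apply: ler_wpM2r; last by rewrite le_max lexx.
  by rewrite divr_ge0 ?ltW.
have e0 : 0 < beta * mesh S M by rewrite mulr_gt0.
have e'0 : 0 < beta' * mesh S M by rewrite mulr_gt0.
have := grid_comparison jd2 cG J_even rm vm JK e0 e'0 JK' M.+1.
have -> : free_Z J ((1 - rho) * mesh S M) (rho * mesh S M) (beta * mesh S M) M.+1 =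
    grid_Z J 1 beta S y0 M.
  apply: eq_bigr => j _; congr (pinned _ _ _).
  have -> : 1 * mesh S M = (1 - rho) * mesh S M + rho * mesh S M by ring.
  by apply/funext => i; apply/funext => k; rewrite /free_kernel /contact_kernel subr0.
rewrite -(qgrid_ZE beta' M).
rewrite -[leRHS]fineK ?lee_fin//.
apply: integrable_fin_num => //.
have PT : (P2 setT < +oo)%E by rewrite probability_setT ltry.
apply: (@bounded_cvg_integrable _ _ _ P2 setT (beta' * S)
  (fun _ w => ln (grid_Z J (1 - rho) beta' S (fun t => W2 (rho * t) w) M))) => //.
- by move=> _; exact: measurable_ln_qgrid.
- by move=> w _; exact: cvg_cst.
- by move=> _ w _; apply: ln_qgrid_le; exact: ltW.
Qed.

End comparison.

(** * Comparison of the free energies *)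

(** The integral of a nonnegative function is a supremum over the simple
    functions below it, so it is monotone even on nonmeasurable functions. *)
Lemma ge0_le_integral_all (disp : measure_display) (T : measurableType disp)
    (R : realType) (mu : {measure set T -> \bar R}) (D : set T) (f g : T -> \bar R) :
  (forall x, D x -> (0 <= f x)%E) -> (forall x, D x -> (f x <= g x)%E) ->
  (\int[mu]_(x in D) f x <= \int[mu]_(x in D) g x)%E.
Proof.
move=> f0 fg; rewrite !ge0_integralE//; last by move=> x Dx; exact: le_trans (f0 x Dx) (fg x Dx).
apply: ereal_sup_le => _ /= [h hf <-]; exists h => // x.
apply: (le_trans (hf x)); rewrite /patch; case: ifP => // xD; apply: fg; exact: set_mem.
Qed.

(** With probability at least [1 / e] the walk has not jumped by time 1, so the
    Green function is at least [1 / e]. If it is infinite then [fine] sends it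
    to 0, and [beta0] is 0. *)
Lemma beta0_bounds (R : realType) (disp : measure_display) (T : measurableType disp)
    (P : probability T R) (G : zmodType) (J : G -> R) (W : R -> T -> G) :
  countable [set: G] -> is_walk P J W -> 0 <= beta0 P W <= expR 1.
Proof.
move=> cG [N [xi [jd WE]]].
set I := (\int[lebesgue_measure]_(t in `[0%R, +oo[) P [set w | W t w = 0%R])%E.
have I0 : (0 <= I)%E by apply: integral_ge0 => t _.
have pt (t : R) : t \in `]0, 1[ -> ((expR (- 1))%:E <= P [set w | W t w = 0%R])%E.
  rewrite in_itv /= => /andP[t0 t1].
  pose ti (i : nat) := t * i%:R.
  have tiS i : ti i < ti i.+1 by rewrite ltr_pM2l// ltr_nat.
  have ti0 : 0 <= ti 0%N by rewrite /ti mulr0.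
  have := joint_law jd 1 0 (fun=> 0%N) (fun=> 0) ti0 tiS.
  rewrite big_ord1 big_ord0 mulr1 /ti mulr1 mulr0 subr0 /poisson_pmf t0 expr0 fact0 mul1r invr1 mul1r => H.
  apply: (@le_trans _ _ (expR (- t))%:E); first by rewrite lee_fin ler_expR lerN2 ltW.
  rewrite -H; apply: le_measure; rewrite ?inE.
  - rewrite (_ : [set _ | _] = N t @^-1` [set 0%N]); first exact: (clock_dmeasurable jd (ltW t0)).
    apply/seteqP; split=> w /=.
      by move=> [/(_ 0%N isT) + _]; rewrite mulr1 mulr0 (clock0 jd).
    by move=> Nt; split=> // i; rewrite ltnS leqn0 => /eqP ->; rewrite mulr1 mulr0 (clock0 jd).
  - have E : [set w | W t w = 0] = walk N xi t @^-1` [set 0].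
      by apply/seteqP; split=> w /=; rewrite (WE _ _ (ltW t0)).
    by rewrite E; exact: (walk_dmeasurable jd cG (ltW t0)).
  - move=> w /= [/(_ 0%N isT) + _]; rewrite mulr1 mulr0 (clock0 jd) (WE _ _ (ltW t0)) => ->.
    by rewrite big_ord0.
have Ige : ((expR (- 1))%:E <= I)%E.
  have -> : (expR (- 1))%:E = (\int[@lebesgue_measure R]_(t in `[0%R, +oo[)
       ((expR (- 1))%:E * (\1_(`]0, 1[) t)%:E))%E.
    have m1 : measurable_fun `[(0:R), +oo[ (EFin \o (\1_(`]0, 1[) : R -> R)).
      apply/measurable_EFinP; apply: measurable_funTS; apply: measurable_indic.
      exact: measurable_itv.
    rewrite ge0_integralZl//.
    rewrite integral_indic//.
    rewrite (_ : _ `&` _ = (`]0, 1[%classic : set R)); last first.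
      apply/setIidPl => t /=; rewrite !in_itv /= => /andP[t0 _].
      by rewrite (ltW t0).
    rewrite -[LHS]mule1; congr (_ * _)%E.
    by rewrite [RHS]lebesgue_measure_itv /= lte_fin ltr01 -EFinB subr0.
  apply: ge0_le_integral_all => t _.
    by rewrite mule_ge0// lee_fin expR_ge0.
  rewrite indicE; have [tI|] := boolP (t \in _); last by rewrite mule0.
  by rewrite mule1; apply: pt; move: tI; rewrite inE.
rewrite /beta0 -/I; case: I I0 Ige => [r r0|_ _|//]; last first.
  by rewrite /= invr0 lexx expR_ge0.
rewrite lee_fin /= => er.
have e0 := lt_le_trans (expR_gt0 (-1)) er.
by rewrite invr_ge0 (ltW e0) /= -[leRHS]invrK -expRN lef_pV2 ?posrE ?expR_gt0.
Qed.

Lemma partition_function_eq (R : realType) (disp : measure_display)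
    (T : measurableType disp) (P : probability T R) (G : zmodType)
    (X X' : R -> T -> G) (Y Y' : R -> G) (beta S : R) :
  (forall t w, 0 <= t -> X t w = X' t w) -> (forall t, 0 <= t -> Y t = Y' t) ->
  partition_function P X Y beta S = partition_function P X' Y' beta S.
Proof.
move=> XX' YY'; rewrite /partition_function; congr (fine (expectation _ _)).
apply/funext => w; congr (expR (_ * _)); apply: eq_Rintegral => t.
by rewrite inE /= in_itv /= => /andP[t0 _]; rewrite XX'// YY'.
Qed.

(** From [rho < 1/2], the left side is at most [2 K rho], and [exp x <= 1 + x
    exp x] makes the required increase of [beta] linear in [rho]. *)
Lemma coupling_gain (R : realType) (K B rho beta : R) :
  0 <= K -> 0 < rho -> rho < 2^-1 -> 0 < beta -> beta <= B ->
  K * (rho / (1 - rho)) <= ln ((beta + 2 * B * K * expR K * rho) / beta).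
Proof.
move=> K0 r0 r2 b0 bB.
have r1 : 0 < 1 - rho by lra.
have step1 : K * (rho / (1 - rho)) <= 2 * K * rho.
  rewrite [2 * K]mulrC -mulrA; apply: ler_wpM2l => //.
  rewrite ler_pdivrMr//.
  have : 0 <= rho * (1 - 2 * rho) by rewrite mulr_ge0//; lra.
  by lra.
apply: (le_trans step1).
have e0 : 0 < expR (2 * K * rho) by exact: expR_gt0.
have E0 : 0 <= 2 * K * rho * expR K by rewrite !mulr_ge0 ?expR_ge0//; lra.
rewrite -[leLHS]expRK ler_ln ?posrE//; last first.
  rewrite divr_gt0// ltr_wpDr//.
  by rewrite !mulr_ge0 ?expR_ge0//; lra.
have H1 : expR (2 * K * rho) <= 1 + 2 * K * rho * expR K.
  have := expR_ge1Dx (- (2 * K * rho)); rewrite expRN => H.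
  have H2 : expR (2 * K * rho) - 2 * K * rho * expR (2 * K * rho) <= 1.
    rewrite -[X in X - _]mul1r -mulrBl; apply: le_trans (ler_wpM2r (ltW e0) H) _.
    by rewrite mulVf ?gt_eqF.
  have H3 : 2 * K * rho * expR (2 * K * rho) <= 2 * K * rho * expR K.
    apply: ler_wpM2l; first by rewrite !mulr_ge0//; lra.
    rewrite ler_expR; have : 0 <= K * (1 - 2 * rho) by rewrite mulr_ge0//; lra.
    by lra.
  by lra.
apply: (le_trans H1); rewrite ler_pdivlMr//.
have -> : 2 * B * K * expR K * rho = 2 * K * rho * expR K * B by ring.
by rewrite [leLHS]mulrDl mul1r lerD2l; exact: ler_wpM2l.
Qed.

(** [S^-1 z S] tends to [F0] and is at most the mean of [S^-1 L], which tends
    to [F]. *)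
Lemma L1_limit_le (R : realType) (disp : measure_display) (T : measurableType disp)
    (P : probability T R) (L : T -> R -> R) (z : R -> R) (F F0 : R) :
  (forall S, 0 < S -> measurable_fun setT (fun w => L w S)) ->
  (forall S w, 0 < S -> 0 <= L w S) ->
  (forall S, 0 < S -> ((z S)%:E <= \int[P]_w (L w S)%:E)%E) ->
  (\int[P]_w `|S^-1 * L w S - F|%:E)%E @[S --> +oo] --> 0%E ->
  `|S^-1 * z S - F0| @[S --> +oo] --> 0 ->
  F0 <= F.
Proof.
move=> mL L0 zL LF zF.
have key S : 0 < S ->
    ((S^-1 * z S - F)%:E <= \int[P]_w `|S^-1 * L w S - F|%:E)%E.
  move=> S0; have Si : 0 <= S^-1 by rewrite invr_ge0 ltW.
  have H1 : ((S^-1 * z S + `|F|)%:E <=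
      \int[P]_w `|S^-1 * L w S - F|%:E + (F + `|F|)%:E)%E.
    apply: (@le_trans _ _ (\int[P]_w ((S^-1 * L w S)%:E + `|F|%:E))%E).
      rewrite ge0_integralD//; last 2 first.
      - by move=> w _; rewrite lee_fin mulr_ge0// L0.
      - by apply/measurable_EFinP; apply: measurable_funM => //; exact: mL.
      rewrite integral_prob_cst EFinD leeD2r//.
      rewrite (_ : (\int[P]_w _)%E = (\int[P]_w ((S^-1)%:E * (L w S)%:E))%E)//.
      rewrite ge0_integralZl//; last 2 first.
      - by apply/measurable_EFinP; exact: mL.
      - by move=> w _; rewrite lee_fin L0.
      by rewrite EFinM; apply: lee_wpmul2l; [rewrite lee_fin|exact: zL].
    have FF : 0 <= F + `|F| by rewrite -lerBlDl sub0r -normrN ler_norm.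
    have m1 : measurable_fun setT (fun w => `|S^-1 * L w S - F|).
      apply: measurableT_comp => //; apply: measurable_funB => //.
      by apply: measurable_funM => //; exact: mL.
    rewrite -(integral_prob_cst P (F + `|F|)) -ge0_integralD//; last first.
      exact/measurable_EFinP.
    apply: ge0_le_integral_all => w _.
      by rewrite -EFinD lee_fin addr_ge0// mulr_ge0// L0.
    rewrite -!EFinD lee_fin addrA lerD2r -lerBlDr; exact: ler_norm.
  move: H1; rewrite -leeBlDr// -EFinB; congr (_ <= _)%E; congr EFin; ring.
apply/ler_addgt0Pr => e e0.
have e20 : 0 < e / 2 by lra.
have near1 : \forall S \near +oo, (\int[P]_w `|S^-1 * L w S - F|%:E < (e / 2)%:E)%E.
  have := LF; move/fine_cvgP => [Lf Lc].
  have Lc' : \forall S \near +oo, fine (\int[P]_w `|S^-1 * L w S - F|%:E)%E < e / 2.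
    by apply: (cvgr_lt (0 : R)) => //; exact: Lc.
  by near=> S; rewrite -[ltLHS]fineK ?lte_fin; near: S.
have near2 : \forall S \near +oo, `|S^-1 * z S - F0| < e / 2.
  by apply: (cvgr_lt (0 : R)) => //; exact: zF.
have [S [S0 [S1 S2]]] : exists S, 0 < S /\
    (\int[P]_w `|S^-1 * L w S - F|%:E < (e / 2)%:E)%E /\ `|S^-1 * z S - F0| < e / 2.
  have near0 : \forall S \near (+oo : set_system R), 0 < S by exact: nbhs_pinfty_gt.
  near (+oo : set_system R) => S; exists S; split; first by near: S.
  by split; near: S.
have := le_lt_trans (key S S0) S1; rewrite lte_fin.
move: S2; rewrite ltr_norml => /andP[h1 h2] h3; lra.
Unshelve. all: by end_near.
Qed.

Lemma kernel_properties (R : realType) (G : zmodType) (J : G -> R) :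
  srw_or_stable J ->
  [/\ countable [set: G], (forall x, J (- x) = J x) &
      exists K, \tsum_(x) (J x)%:E = 1%E -> log_bound J K].
Proof.
case=> [d d3|gamma J' g01 sJ].
  split; [exact: countableP|exact: srw_even|].
  by exists (2 * d%:R) => Jm; exact: srw_log_bound.
split; [exact: countableP| |].
  by move=> x; have [_ [phi [_ _ JE]] _] := sJ; rewrite !JE normrN.
by have [K HK] := stable_log_bound g01 sJ; exists K.
Qed.

Theorem proposition4p1 (R : realType) (G : zmodType) (J : G -> R)
    (hJ : srw_or_stable J) :
  exists C0 : R,
  forall (d1 : measure_display) (T1 : measurableType d1)
         (P1 : probability T1 R) (W1 : R -> T1 -> G)
         (d2 : measure_display) (T2 : measurableType d2)
         (P2 : probability T2 R) (W2 : R -> T2 -> G),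
    is_walk P1 J W1 -> is_walk P2 J W2 ->
  forall rho beta : R,
    0 < rho < 2^-1 ->
    beta0 P1 W1 <= beta <= 2 * beta0 P1 W1 ->
  forall F_rho F_0 : R,
    is_free_energy P1 W1 P2 W2 rho (beta + C0 * rho) F_rho ->
    is_free_energy P1 W1 P2 W2 0 beta F_0 ->
    F_rho >= F_0.
Proof.
have [cG J_even [K HK]] := kernel_properties hJ.
pose K' := Num.max K 0; pose B := 2 * expR 1 : R.
have K'0 : 0 <= K' by rewrite /K' le_max lexx orbT.
exists (2 * B * K' * expR K').
set C0 := 2 * B * K' * expR K'.
move=> d1 T1 P1 W1 d2 T2 P2 W2 w1 w2 rho beta /andP[r0 r2] /andP[b1 b2] F_rho F_0.
have /andP[b00 b0e] := beta0_bounds cG w1.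
have beta_ge0 : 0 <= beta by exact: le_trans b1.
have betaB : beta <= B by apply: (le_trans b2); exact: ler_wpM2l.
have [N1 [xi1 [jd1 W1E]]] := w1; have [N2 [xi2 [jd2 W2E]]] := w2.
have JK := HK (kernel_mass jd1 cG).
have C00 : 0 <= C0 by rewrite !mulr_ge0 ?expR_ge0.
pose beta' := beta + C0 * rho.
have bb' : beta <= beta' by rewrite lerDl mulr_ge0// ltW.
have beta'0 : 0 <= beta' by exact: le_trans bb'.
rewrite /is_free_energy -/beta' => -[_ Lrho] [_ L0].
have rho1 : 0 <= 1 - rho by lra.
have qE S w : partition_function P1 (fun t => W1 ((1 - rho) * t))
    (fun t => W2 (rho * t) w) beta' S = quenched_Z P1 N1 xi1 N2 xi2 rho beta' S w.
  apply: partition_function_eq => [t v t0|t t0].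
    by rewrite W1E// mulr_ge0.
  by rewrite W2E// mulr_ge0// ltW.
have aE S w : partition_function P1 (fun t => W1 ((1 - 0) * t))
    (fun t => W2 (0 * t) w) beta S = homogeneous_Z P1 N1 xi1 beta S.
  apply: partition_function_eq => [t v t0|t t0]; first by rewrite subr0 W1E ?mul1r.
  by rewrite mul0r W2E// (clock0 jd2) big_ord0.
pose L w S := ln (quenched_Z P1 N1 xi1 N2 xi2 rho beta' S w).
pose z S := ln (homogeneous_Z P1 N1 xi1 beta S).
apply: (@L1_limit_le _ _ _ P2 L z).
- move=> S S0; apply/measurable_EFinP.
  exact: (measurable_int _ (integrable_ln_quenched jd1 jd2 cG r0 r2 S0 beta'0)).
- by move=> S w S0; exact: (ln_quenched_ge0 jd1 jd2 cG r0 r2 S0 beta'0).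
- move=> S S0; move: beta_ge0; rewrite le_eqVlt => /orP[/eqP b|b]; last first.
    apply: (quenched_ge_homogeneous jd1 jd2 cG J_even JK r0 r2 S0 b bb').
    exact: coupling_gain.
  have -> : z S = 0.
    rewrite /z /homogeneous_Z /partition_function -b.
    under [X in expectation _ X]eq_fun do rewrite mul0r expR0.
    by rewrite expectation_cst ln1.
  apply: integral_ge0 => w _; rewrite lee_fin.
  exact: (ln_quenched_ge0 jd1 jd2 cG r0 r2 S0 beta'0).
- apply: cvg_trans Lrho; apply: near_eq_cvg; apply: nearW => S.
  by apply: eq_integral => w _; rewrite qE.
- have E S : (\int[P2]_w `|S^-1 * ln (partition_function P1
      (fun t => W1 ((1 - 0) * t)) (fun t => W2 (0 * t) w) beta S) - F_0|%:E)%E =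
      (`|S^-1 * z S - F_0|%:E)%E.
    by rewrite -[RHS](integral_prob_cst P2); apply: eq_integral => w _; rewrite aE.
  have L0' : `|S^-1 * z S - F_0|%:E @[S --> +oo] --> 0%E.
    by apply: cvg_trans L0; apply: near_eq_cvg; apply: nearW => S; exact: E.
  exact: fine_cvg L0'.
Qed.
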